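(* Let $\lambda>0$, $y_d\in L^2(Q_T)$, and let $(y,p)\in (H^{1,\frac12}_{0,per}(Q_T))^2$ be the solution of the reduced optimality system $$\mathcal{B}((y,p),(z,q))=\int_{Q_T} y_d\,z\,d\boldsymbol{x}\,dt\qquad\forall\,(z,q)\in (H^{1,\frac12}_{0,per}(Q_T))^2 .$$ Let $\eta,\zeta\in H^{1,1}_{0,per}(Q_T)$ and $\boldsymbol{\tau},\boldsymbol{\rho}\in H(\mathrm{div},Q_T)$, and suppose that the bilinear form $\mathcal{B}$ satisfies $$\mu_1\|(w,r)\|_{1,\frac12}\le \sup_{0\ne(z,q)\in (H^{1,\frac12}_{0,per}(Q_T))^2}\frac{\mathcal{B}((w,r),(z,q))}{\|(z,q)\|_{1,\frac12}}\le\mu_2\|(w,r)\|_{1,\frac12}\qquad\forall\, w,r\in H^{1,\frac12}_{0,per}(Q_T),$$ where $$\mu_1=\frac{\min\{\frac1{\sqrt\lambda},\underline\nu,\underline\sigma\}\min\{\sqrt\lambda,\frac1{\sqrt\lambda}\}}{\sqrt{1+2\max\{\lambda,\frac1\lambda\}}},\qquad \mu_2=\max\{1,\tfrac1\lambda,\overline\nu,\overline\sigma\}.$$ Then the error $e=(y,p)-(\eta,\zeta)$ satisfies $$\|e\|_{1,\frac12}\le \frac{1}{\mu_1}\Big(\|\mathcal{R}_1(\eta,\zeta,\boldsymbol{\tau})\|^2+\|\mathcal{R}_2(\eta,\boldsymbol{\tau})\|^2+\|\mathcal{R}_3(\eta,\zeta,\boldsymbol{\rho})\|^2+\|\mathcal{R}_4(\zeta,\boldsymbol{\rho})\|^2\Big)^{1/2},$$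 where $$\mathcal{R}_1(\eta,\zeta,\boldsymbol{\tau})=\sigma\partial_t\eta+\lambda^{-1}\zeta-\mathrm{div}\,\boldsymbol{\tau},\quad \mathcal{R}_2(\eta,\boldsymbol{\tau})=\boldsymbol{\tau}-\nu\nabla\eta,$$ $$\mathcal{R}_3(\eta,\zeta,\boldsymbol{\rho})=\sigma\partial_t\zeta+\eta-\mathrm{div}\,\boldsymbol{\rho}-y_d,\quad \mathcal{R}_4(\zeta,\boldsymbol{\rho})=\boldsymbol{\rho}+\nu\nabla\zeta .$$
   Context: $\Omega\subset\mathbb{R}^d$, $d\in\{1,2,3\}$, is a bounded Lipschitz domain with boundary $\Gamma$; $T>0$, $\omega=2\pi/T$, $Q_T=\Omega\times(0,T)$, $\Sigma_T=\Gamma\times(0,T)$. The measurable coefficients $\sigma,\nu:\Omega\to\mathbb{R}$ satisfy $0<\underline\sigma\le\sigma\le\overline\sigma$ and $0<\underline\nu\le\nu\le\overline\nu$ with constants $\underline\sigma,\overline\sigma,\underline\nu,\overline\nu$. $\|\cdot\|$ is the $L^2(Q_T)$-norm (for scalar or vector functions; equal to $+\infty$ if the function is not square integrable), $\|\cdot\|_\Omega$ the $L^2(\Omega)$-norm, $\langle\cdot,\cdot\rangle_\Omega$ the $L^2(\Omega)$ inner product. $\nabla$ and $\mathrm{div}$ are the generalized spatial gradient and divergence, $\partial_t$ the generalized time derivative. Each $v\in L^2(Q_T)$ is expanded as $v(\boldsymbol{x},t)=v_0^c(\boldsymbol{x})+\sum_{k\ge1}(v_k^c(\boldsymbol{x})\cos(k\omega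 t)+v_k^s(\boldsymbol{x})\sin(k\omega t))$; put $\boldsymbol{v}_k=(v_k^c,v_k^s)^T$ and $\boldsymbol{v}_k^\perp=(-v_k^s,v_k^c)^T$. Define $\|\partial_t^{1/2}v\|^2:=\frac T2\sum_{k\ge1}k\omega\|\boldsymbol{v}_k\|_\Omega^2$ and $$\int_{Q_T}\sigma\,\partial_t^{1/2}y\,\partial_t^{1/2}v^\perp\,d\boldsymbol{x}\,dt:=\frac T2\sum_{k\ge1}k\omega\,\langle\sigma\boldsymbol{y}_k,\boldsymbol{v}_k^\perp\rangle_\Omega .$$ $H^{1,\frac12}_{0,per}(Q_T)$ is the space of $v\in L^2(Q_T)$ with $\nabla v\in[L^2(Q_T)]^d$, $\|\partial_t^{1/2}v\|<\infty$ and $v=0$ on $\Sigma_T$, with norm $\|v\|_{1,\frac12}^2=\|v\|^2+\|\nabla v\|^2+\|\partial_t^{1/2}v\|^2$; for pairs, $\|(y,p)\|_{1,\frac12}^2=\|y\|_{1,\frac12}^2+\|p\|_{1,\frac12}^2$. $H^{1,1}_{0,per}(Q_T)$ is the space of $v\in L^2(Q_T)$ with $\nabla v\in[L^2(Q_T)]^d$, $\partial_tv\in L^2(Q_T)$, $v=0$ on $\Sigma_T$ and $v(\cdot,0)=v(\cdot,T)$. $H(\mathrm{div},Q_T)=\{\boldsymbol{\rho}\in[L^2(Q_T)]^d:\mathrm{div}\,\boldsymbol{\rho}(\cdot,t)\in L^2(\Omega)\text{ for a.e. }t\in(0,T)\}$. The bilinear form is $$\mathcal{B}((y,p),(z,q))=\int_{Q_T}\Big(yz-\nu\nabla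 p\cdot\nabla z+\sigma\partial_t^{1/2}p\,\partial_t^{1/2}z^\perp+\nu\nabla y\cdot\nabla q+\sigma\partial_t^{1/2}y\,\partial_t^{1/2}q^\perp+\lambda^{-1}pq\Big)d\boldsymbol{x}\,dt .$$ *)

(* Defs.v *)
From HB Require Import structures.
From mathcomp Require Import all_boot all_order all_algebra.
From mathcomp Require Import all_classical all_reals all_analysis.

Set Implicit Arguments.
Unset Strict Implicit.
Unset Printing Implicit Defensive.

Import Order.TTheory GRing.Theory Num.Theory.
Import numFieldNormedType.Exports.

Local Open Scope classical_set_scope.
Local Open Scope ring_scope.

(* 'rV[R]_n carries the product (Borel) sigma-algebra, i.e. the one generated by
   the coordinates. *)
Definition rV_display : measure_display -> measure_display.
Proof. exact. Qed.

Section measurable_rV.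
Context (R : realType) (n : nat).

Definition rV_coord (i : 'I_n) (x : 'rV[R]_n) : R := x ord0 i.

Let rV_set0 : g_sigma_preimage rV_coord set0.
Proof. exact: sigma_algebra0. Qed.

Let rV_setC A : g_sigma_preimage rV_coord A -> g_sigma_preimage rV_coord (~` A).
Proof. exact: sigma_algebraC. Qed.

Let rV_bigcup (F : (set 'rV[R]_n)^nat) :
  (forall i, g_sigma_preimage rV_coord (F i)) ->
  g_sigma_preimage rV_coord (\bigcup_i (F i)).
Proof. exact: sigma_algebra_bigcup. Qed.

HB.instance Definition _ := @isMeasurable.Build (rV_display default_measure_display)
  'rV[R]_n (g_sigma_preimage rV_coord) rV_set0 rV_setC rV_bigcup.

Lemma measurable_rV_coord (i : 'I_n) : measurable_fun setT (rV_coord i).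
Proof.
move=> _ Y mY; rewrite setTI; apply: sub_sigma_algebra => /=.
rewrite -bigcup_seq/=; exists i => /=; first by rewrite mem_index_enum.
by exists Y => //; rewrite setTI.
Qed.

Lemma measurable_fun_rVP d (X : measurableType d) (f : X -> 'rV[R]_n) :
  (forall i, measurable_fun setT (fun x => f x ord0 i)) -> measurable_fun setT f.
Proof.
move=> mf _ A mA; rewrite setTI.
suff : g_sigma_preimage (fun i => rV_coord i \o f) `<=` measurable.
  rewrite g_sigma_preimage_comp; apply.
  by exists A => //; rewrite setTI.
apply: smallest_sub; first exact: sigma_algebra_measurable.
rewrite -bigcup_seq; apply: bigcup_sub => i _ B [C mC <-].
exact: mf.
Qed.

End measurable_rV.

(* Appends a last coordinate; Lebesgue measure on R^(m + 1) is the image under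
   this map of the product of Lebesgue measures on R^m and R. *)
Definition rV_rcons (R : realType) (n : nat) (p : 'rV[R]_n * R) : 'rV[R]_n.+1 :=
  \row_i oapp (p.1 ord0) p.2 (unlift ord_max i).

Lemma measurable_rV_rcons (R : realType) (n : nat) :
  measurable_fun setT (@rV_rcons R n).
Proof.
apply: measurable_fun_rVP => i.
under eq_fun do rewrite mxE.
case: (unlift ord_max i) => [j|] /=; last exact: measurable_snd.
exact: measurableT_comp (measurable_rV_coord j) measurable_fst.
Qed.

Fixpoint lebesgue_rV (R : realType) (n : nat) : set 'rV[R]_n -> \bar R :=
  match n with
  | 0 => \d_(0 : 'rV[R]_0)
  | m.+1 => pushforward (@lebesgue_rV R m \x lebesgue_measure)%E
              (@rV_rcons R m)
  end.
Arguments lebesgue_rV : clear implicits.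

Section lebesgue_rV_measure.
Context (R : realType).

Let lebesgue_rV_spec (n : nat) : [/\ lebesgue_rV R n set0 = 0%E,
  forall A, (0 <= lebesgue_rV R n A)%E &
  semi_sigma_additive (lebesgue_rV R n)].
Proof.
elim: n => [|n [m0 mge0 madd]].
  by split; [exact: measure0|exact: measure_ge0|exact: measure_semi_sigma_additive].
pose mixin := @isMeasure.Build _ _ R (lebesgue_rV R n) m0 mge0 madd.
pose M : {measure set 'rV[R]_n -> \bar R} := HB.pack (lebesgue_rV R n) mixin.
pose P : {measure set 'rV[R]_n.+1 -> \bar R} :=
  measure_function_pushforward__canonical__measure_function_Measure
    (M \x lebesgue_measure)%E (@measurable_rV_rcons R n).
have -> : lebesgue_rV R n.+1 = P by [].
split; [exact: measure0|exact: measure_ge0|exact: measure_semi_sigma_additive].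
Qed.

Let lebesgue_rV0 n : lebesgue_rV R n set0 = 0%E.
Proof. by case: (lebesgue_rV_spec n). Qed.

Let lebesgue_rV_ge0 n A : (0 <= lebesgue_rV R n A)%E.
Proof. by case: (lebesgue_rV_spec n). Qed.

Let lebesgue_rV_sigma_additive n : semi_sigma_additive (lebesgue_rV R n).
Proof. by case: (lebesgue_rV_spec n). Qed.

HB.instance Definition _ n := isMeasure.Build _ _ R (lebesgue_rV R n)
  (@lebesgue_rV0 n) (@lebesgue_rV_ge0 n) (@lebesgue_rV_sigma_additive n).

End lebesgue_rV_measure.

Section calculus.
Context {R : realType}.

Definition dot {d : nat} (u v : 'rV[R]_d) : R :=
  \sum_i u ord0 i * v ord0 i.

Definition boundary {d : nat} (Om : set 'rV[R]_d) : set 'rV[R]_d :=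
  closure Om `\` interior Om.

(* Near every boundary point, after a rotation A and up to the choice of the
   vertical coordinate i, the domain is the strict epigraph of a Lipschitz
   function g of the d - 1 other coordinates. *)
Definition lipschitz_boundary {d : nat} (Om : set 'rV[R]_d) : Prop :=
  forall x0, boundary Om x0 ->
    exists (A : 'M[R]_d) (i : 'I_d) (g : 'rV[R]_d.-1 -> R) (L : R),
      [/\ A *m A^T = 1%:M, L.-lipschitz g &
        \forall x \near x0,
          Om x <-> g (col' i (x *m A)) < (x *m A) ord0 i].

Definition bounded_lipschitz_domain {d : nat} (Om : set 'rV[R]_d) : Prop :=
  [/\ open Om, connected Om, Om !=set0, bounded_set Om & lipschitz_boundary Om].

(* f is of class C^k: all iterated directional derivatives up to order k exist
   and are continuous (V is finite dimensional in every use). *)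
Fixpoint Ck {V : normedModType R} (k : nat) (f : V -> R) : Prop :=
  match k with
  | 0 => continuous f
  | m.+1 => continuous f /\
      forall v : V, (forall x, derivable f x v) /\ Ck m (fun x => 'D_v f x)
  end.

Definition test_function {V : normedModType R} (U : set V) (phi : V -> R) : Prop :=
  (forall k, Ck k phi) /\
  exists K : set V, [/\ compact K, K `<=` U & forall x, ~ K x -> phi x = 0].

Definition classical_grad {d : nat} (phi : 'rV[R]_d -> R) (x : 'rV[R]_d) : 'rV[R]_d :=
  \row_i 'D_(delta_mx ord0 i) phi x.

End calculus.

Section L2.
Context {disp : measure_display} {X : measurableType disp} {R : realType}.
Variables (mu : {measure set X -> \bar R}) (D : set X).
Local Open Scope ereal_scope.

(* Squared L^2(D) norms, with value +oo when f is not square integrable. *)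
Definition sqnorm (f : X -> R) : \bar R := \int[mu]_(x in D) ((f x) ^+ 2)%:E.

Definition sqnormv {d : nat} (g : X -> 'rV[R]_d) : \bar R :=
  \int[mu]_(x in D) (dot (g x) (g x))%:E.

Definition L2 (f : X -> R) : Prop := measurable_fun D f /\ sqnorm f < +oo.

Definition L2v {d : nat} (g : X -> 'rV[R]_d) : Prop :=
  measurable_fun D g /\ sqnormv g < +oo.

End L2.

Section space_time.
Context {R : realType} {d : nat}.
Variables (Om : set 'rV[R]_d) (T : R).

Local Notation leb := (lebesgue_rV R d : {measure set _ -> \bar R}).
Local Notation lebt := (@lebesgue_measure R).
Local Notation lebQ := ((leb \x lebt)%E : {measure set _ -> \bar R}).
Local Notation point := ('rV[R]_d * R)%type.
Local Notation I_T := (`]0, T[%classic : set R).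

Definition QT : set point := Om `*` I_T.

Definition sqnormQ (v : point -> R) : \bar R := sqnorm lebQ QT v.
Definition sqnormQv (g : point -> 'rV[R]_d) : \bar R := sqnormv lebQ QT g.
Definition L2Q (v : point -> R) : Prop := L2 lebQ QT v.
Definition L2Qv (g : point -> 'rV[R]_d) : Prop := L2v lebQ QT g.

Definition is_grad (v : point -> R) (g : point -> 'rV[R]_d) : Prop :=
  L2Qv g /\
  forall (phi : point -> R) (i : 'I_d), test_function QT phi ->
    \int[lebQ]_(z in QT) (v z * 'D_((delta_mx ord0 i, 0) : point) phi z) =
    - \int[lebQ]_(z in QT) (g z ord0 i * phi z).

Definition is_dt (v w : point -> R) : Prop :=
  L2Q w /\
  forall phi : point -> R, test_function QT phi ->
    \int[lebQ]_(z in QT) (v z * 'D_((0, 1) : point) phi z) =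
    - \int[lebQ]_(z in QT) (w z * phi z).

(* The divergence is taken slice by slice in time and need not be square
   integrable over QT; g is a jointly measurable representative of
   (x, t) |-> div tau(., t) (x). *)
Definition is_div (tau : point -> 'rV[R]_d) (g : point -> R) : Prop :=
  measurable_fun QT g /\
  {ae lebt, forall t, I_T t ->
    L2 leb Om (fun x => g (x, t)) /\
    forall phi : 'rV[R]_d -> R, test_function Om phi ->
      \int[leb]_(x in Om) dot (tau (x, t)) (classical_grad phi x) =
      - \int[leb]_(x in Om) (g (x, t) * phi x)}.

(* Representatives of the generalized derivatives; they are determined up to
   null sets, and the default value 0 is irrelevant on the spaces below. *)
Definition grad (v : point -> R) : point -> 'rV[R]_d :=
  xget (fun=> 0) [set g | is_grad v g].
Definition dt (v : point -> R) : point -> R := xget (fun=> 0) [set w | is_dt v w].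
Definition div (tau : point -> 'rV[R]_d) : point -> R :=
  xget (fun=> 0) [set g | is_div tau g].

(* u belongs to H^1_0(Om), the closure of the test functions in H^1(Om),
   and has gradient g. *)
Definition H10_with_grad (u : 'rV[R]_d -> R) (g : 'rV[R]_d -> 'rV[R]_d) : Prop :=
  exists phi : nat -> 'rV[R]_d -> R,
    [/\ forall k, test_function Om (phi k),
        sqnorm leb Om (fun x => phi k x - u x) @[k --> \oo] --> 0%E &
        sqnormv leb Om (fun x => classical_grad (phi k) x - g x) @[k --> \oo] --> 0%E].

Definition zero_lateral_trace (v : point -> R) : Prop :=
  {ae lebt, forall t, I_T t ->
    H10_with_grad (fun x => v (x, t)) (fun x => grad v (x, t))}.

(* The representative w of v in C([0, T]; L^2(Om)) satisfies w(0) = w(T). *)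
Definition time_periodic (v : point -> R) : Prop :=
  exists w : R -> 'rV[R]_d -> R,
    [/\ forall t, 0 <= t <= T -> L2 leb Om (w t),
        {ae lebt, forall t, I_T t -> ae_eq leb Om (w t) (fun x => v (x, t))},
        (forall t, 0 <= t <= T -> forall e : R, 0 < e ->
           exists2 del : R, 0 < del & forall s, 0 <= s <= T -> `|s - t| < del ->
             (sqnorm leb Om (fun x => (w s x - w t x)%R) < e%:E)%E) &
        ae_eq leb Om (w 0) (w T)].

Definition omega : R := 2 * pi / T.

Definition fourier_cos (v : point -> R) (k : nat) (x : 'rV[R]_d) : R :=
  2 / T * \int[lebt]_(t in I_T) (v (x, t) * cos (k%:R * omega * t)).
Definition fourier_sin (v : point -> R) (k : nat) (x : 'rV[R]_d) : R :=
  2 / T * \int[lebt]_(t in I_T) (v (x, t) * sin (k%:R * omega * t)).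

(* The mean v_0^c does not enter the fractional expressions below, which sum over
   k >= 1; in half_form, v_k^perp = (- v_k^s, v_k^c). *)
Definition sqnorm_half (v : point -> R) : \bar R :=
  ((T / 2)%:E * \sum_(1 <= k <oo) ((k%:R * omega)%:E *
     (sqnorm leb Om (fourier_cos v k) + sqnorm leb Om (fourier_sin v k))))%E.

Definition half_form (sig : 'rV[R]_d -> R) (y v : point -> R) : R :=
  T / 2 * limn (fun N => \sum_(1 <= k < N) (k%:R * omega *
    \int[leb]_(x in Om) (sig x *
      (fourier_cos y k x * - fourier_sin v k x +
       fourier_sin y k x * fourier_cos v k x)))).

Definition H1half (v : point -> R) : Prop :=
  [/\ L2Q v, (exists g, is_grad v g), (sqnorm_half v < +oo)%E &
      zero_lateral_trace v].

Definition H11 (v : point -> R) : Prop :=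
  [/\ L2Q v, (exists g, is_grad v g), (exists w, is_dt v w),
      zero_lateral_trace v & time_periodic v].

Definition Hdiv (tau : point -> 'rV[R]_d) : Prop :=
  L2Qv tau /\ exists g, is_div tau g.

Definition norm_1half (y p : point -> R) : \bar R :=
  (((sqnormQ y + sqnormQv (grad y) + sqnorm_half y) +
    (sqnormQ p + sqnormQv (grad p) + sqnorm_half p)) `^ 2^-1)%E.

Definition intQ (f : point -> R) : R := \int[lebQ]_(z in QT) f z.

Definition ae_zeroQ (v : point -> R) : Prop := ae_eq lebQ QT v (fun=> 0).

Definition Bform (sig nu : 'rV[R]_d -> R) (lam : R) (y p z q : point -> R) : R :=
  intQ (fun s => y s * z s - nu s.1 * dot (grad p s) (grad z s)
                 + nu s.1 * dot (grad y s) (grad q s) + lam^-1 * (p s * q s))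
  + half_form sig p z + half_form sig y q.

Definition sup_quotient (sig nu : 'rV[R]_d -> R) (lam : R) (w r : point -> R) : \bar R :=
  ereal_sup [set a | exists z q : point -> R,
    [/\ H1half z, H1half q, ~ (ae_zeroQ z /\ ae_zeroQ q) &
        a = (Bform sig nu lam w r z q / fine (norm_1half z q))%:E]].

Definition Res1 (sig : 'rV[R]_d -> R) (lam : R) (eta zeta : point -> R)
    (tau : point -> 'rV[R]_d) (s : point) : R :=
  sig s.1 * dt eta s + lam^-1 * zeta s - div tau s.

Definition Res2 (nu : 'rV[R]_d -> R) (eta : point -> R)
    (tau : point -> 'rV[R]_d) (s : point) : 'rV[R]_d :=
  tau s - nu s.1 *: grad eta s.

Definition Res3 (sig : 'rV[R]_d -> R) (yd eta zeta : point -> R)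
    (rho : point -> 'rV[R]_d) (s : point) : R :=
  sig s.1 * dt zeta s + eta s - div rho s - yd s.

Definition Res4 (nu : 'rV[R]_d -> R) (zeta : point -> R)
    (rho : point -> 'rV[R]_d) (s : point) : 'rV[R]_d :=
  rho s + nu s.1 *: grad zeta s.

End space_time.

Definition mu1 {R : realType} (lam nu_lo sig_lo : R) : R :=
  Num.min (Num.min (1 / Num.sqrt lam) nu_lo) sig_lo *
  Num.min (Num.sqrt lam) (1 / Num.sqrt lam) /
  Num.sqrt (1 + 2 * Num.max lam (1 / lam)).

Definition mu2 {R : realType} (lam nu_up sig_up : R) : R :=
  Num.max (Num.max (Num.max 1 (1 / lam)) nu_up) sig_up.

(* Main.v *)
From HB Require Import structures.
Require Import Defs.
From mathcomp Require Import all_boot all_order all_algebra.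
From mathcomp Require Import all_classical all_reals all_analysis.
From mathcomp Require Import measurable_realfun ring lra.

Set Implicit Arguments.
Unset Strict Implicit.
Unset Printing Implicit Defensive.

Import Order.TTheory GRing.Theory Num.Theory.
Import numFieldNormedType.Exports.

Local Open Scope classical_set_scope.
Local Open Scope ring_scope.

(** The error [e = (y, p) - (eta, zeta)] belongs to the trial space, so the lower
    inf-sup bound reduces the estimate to bounding [B(e, (z, q))] by the residuals
    times the norm of [(z, q)].  Since [(y, p)] solves the optimality system,
    [B(e, (z, q))] is the integral of [yd z] minus [B((eta, zeta), (z, q))].  The
    approximation has a time derivative in L2, so its half-order terms are
    ordinary integrals, of [sig dt zeta z] and of [sig dt eta q].  Adding Green's
    formula for [tau] and [rho], that is, zero, turns the whole into

      - (R3, z) + (R4, grad z) - (R1, q) + (R2, grad q)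

    ([Bform_residuals]), and Cauchy-Schwarz bounds this by the norm of the
    residuals times a part of the norm of [(z, q)] ([Bform_residual_bound]).  If a
    residual is not square integrable, the right-hand side of the estimate is
    infinite.

    The substance lies in the facts about the spaces.

    - [half_form_dt]: the half-order form of a periodic function in H1 in time is
      the integral of its time derivative.  The coefficients of the derivative are
      those of the function, rotated and multiplied by the frequency
      ([fourier_dt]).  The weak derivative is only known against compactly
      supported functions of time, so periodicity enters through cutoffs whose
      boundary layers cancel ([periodic_weak_ibp]).  The series is then summed by
      Parseval's identity on almost every line parallel to the time axis
      ([parseval]) and integrated in space by dominated convergence.
    - [H11_H1half]: by Bessel's inequality the same relation between coefficients
      makes the half-order norm finite, so the approximation and the error lie in
      the trial space.
    - [parseval]: the functions that satisfy Parseval's identity form a closed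
      subspace of L2 of the interval.  It contains the steps, for which the
      identity amounts to a known trigonometric series, and then indicators of
      Borel sets by Dynkin's lemma, simple functions, and everything.
    - [fundamental_lemma]: an integrable function on the cylinder orthogonal to
      all products of test functions in space and in time vanishes.  It gives
      uniqueness of weak gradients, hence their linearity, and transfers identities
      tested in space to almost every point.
    - [div_green]: on almost every time slice the trial function is a limit in H1 of
      test functions, against which the divergence is defined. *)

(** * Integrable and square-integrable real functions *)

Notation integrableR mu D f := (integrable mu D (EFin \o f)).

(** Optimal weight: [s = sqrt Y / sqrt X], and [s] tending to infinity or to zero
    when [X] or [Y] vanishes.  Weighted inequalities, unlike the Cauchy-Schwarz
    ones, can be added termwise; this is how a sum of several pairings gets
    bounded by one product of two square roots. *)
Lemma amgm_sqrt (R : realType) (b X Y : R) : 0 <= X -> 0 <= Y ->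
  (forall s, 0 < s -> 2 * b <= s * X + s^-1 * Y) -> b <= Num.sqrt X * Num.sqrt Y.
Proof.
move=> X0 Y0 H.
have [x0|x0] := eqVneq X 0; last have [y0|y0] := eqVneq Y 0.
- rewrite x0 sqrtr0 mul0r leNgt; apply/negP => b0.
  have s0 : 0 < (Y + 1) / b by rewrite divr_gt0// ltr_wpDl.
  have := H _ s0; rewrite x0 mulr0 add0r invf_div mulrAC ler_pdivlMr ?ltr_wpDl//.
  by nra.
- rewrite y0 sqrtr0 mulr0 leNgt; apply/negP => b0.
  have s0 : 0 < b / (X + 1) by rewrite divr_gt0// ltr_wpDl.
  have := H _ s0; rewrite y0 mulr0 addr0 mulrAC ler_pdivlMr ?ltr_wpDl//.
  by nra.
- have sX : 0 < Num.sqrt X by rewrite sqrtr_gt0 lt_neqAle eq_sym x0.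
  have sY : 0 < Num.sqrt Y by rewrite sqrtr_gt0 lt_neqAle eq_sym y0.
  have := H (Num.sqrt Y / Num.sqrt X) (divr_gt0 sY sX).
  move: (sqr_sqrtr X0) (sqr_sqrtr Y0).
  set a := Num.sqrt X in sX *; set c := Num.sqrt Y in sY *.
  move=> <- <-; rewrite invf_div (_ : _ + _ = 2 * (a * c)); first lra.
  by field; rewrite !gt_eqF.
Qed.

Section real_integrals.
Context {dp : measure_display} {X : measurableType dp} {R : realType}.
Variables (mu : {measure set X -> \bar R}) (D : set X).
Hypothesis mD : measurable D.
Implicit Types f g h : X -> R.

Lemma intR_meas f : integrableR mu D f -> measurable_fun D f.
Proof. by case/integrableP => /measurable_EFinP. Qed.

Lemma eq_intR f g : (forall x, D x -> f x = g x) ->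
  integrableR mu D f -> integrableR mu D g.
Proof.
by move=> fg; apply: eq_integrable => // x /set_mem Dx /=; rewrite fg.
Qed.

Lemma eq_Rint f g : (forall x, D x -> f x = g x) ->
  \int[mu]_(x in D) f x = \int[mu]_(x in D) g x.
Proof. by move=> fg; apply: eq_Rintegral => x /set_mem /fg. Qed.

Lemma intRD f g : integrableR mu D f -> integrableR mu D g ->
  integrableR mu D (fun x => f x + g x).
Proof. by move=> fi gi; have := integrableD mD fi gi. Qed.

Lemma intRB f g : integrableR mu D f -> integrableR mu D g ->
  integrableR mu D (fun x => f x - g x).
Proof. by move=> fi gi; have := integrableB mD fi gi. Qed.

Lemma intRZ (k : R) f : integrableR mu D f -> integrableR mu D (fun x => k * f x).
Proof. by move=> fi; have := integrableZl mD k fi. Qed.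

Lemma intRN f : integrableR mu D f -> integrableR mu D (fun x => - f x).
Proof. by move=> fi; have := integrableN fi. Qed.

Lemma le_intR f g : measurable_fun D f -> (forall x, D x -> `|f x| <= g x) ->
  integrableR mu D g -> integrableR mu D f.
Proof.
move=> mf fg gi; apply: le_integrable gi => //; first exact/measurable_EFinP.
by move=> x Dx; rewrite /= lee_fin (le_trans (fg x Dx))// ler_norm.
Qed.

Lemma RintN f : integrableR mu D f ->
  \int[mu]_(x in D) (- f x) = - \int[mu]_(x in D) f x.
Proof.
by move=> fi; rewrite -mulN1r -RintegralZl//; apply: eq_Rint => x; rewrite mulN1r.
Qed.

Lemma intR_sum (I : Type) (s : seq I) (P : pred I) (h : I -> X -> R) :
  (forall i, P i -> integrableR mu D (h i)) ->
  integrableR mu D (fun x => \sum_(i <- s | P i) h i x).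
Proof.
move=> hi; elim: s => [|i s IH].
  by apply: (@eq_intR (fun=> 0)); [move=> x _; rewrite big_nil|exact: integrable0].
case: (boolP (P i)) => Pi.
  apply: (@eq_intR (fun x => h i x + \sum_(j <- s | P j) h j x)).
    by move=> x _; rewrite big_cons Pi.
  by apply: intRD => //; exact: hi.
by apply: (eq_intR _ IH) => x _; rewrite big_cons (negbTE Pi).
Qed.

Lemma Rint_sum (I : Type) (s : seq I) (P : pred I) (h : I -> X -> R) :
  (forall i, P i -> integrableR mu D (h i)) ->
  \int[mu]_(x in D) (\sum_(i <- s | P i) h i x) =
  \sum_(i <- s | P i) \int[mu]_(x in D) h i x.
Proof.
move=> hi; elim: s => [|i s IH].
  under eq_Rint do rewrite big_nil.
  by rewrite big_nil Rintegral_cst// mul0r.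
rewrite big_cons; case: (boolP (P i)) => Pi.
  rewrite -IH -RintegralD//; [|exact: hi|exact: intR_sum].
  by apply: eq_Rint => x _; rewrite big_cons Pi.
by rewrite -IH; apply: eq_Rint => x _; rewrite big_cons (negbTE Pi).
Qed.

Lemma intR_EFin f : integrableR mu D f ->
  (\int[mu]_(x in D) (f x)%:E = (\int[mu]_(x in D) f x)%:E)%E.
Proof. by move=> fi; rewrite fineK//; exact: integrable_fin_num. Qed.

Lemma Rint_ae f g : measurable_fun D f -> measurable_fun D g -> ae_eq mu D f g ->
  \int[mu]_(x in D) f x = \int[mu]_(x in D) g x.
Proof.
move=> mf mg fg; congr fine; apply: ae_eq_integral => //; try exact/measurable_EFinP.
by apply: filterS fg => x /= + Dx => /(_ Dx) ->.
Qed.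

Lemma intR_ae f g : measurable_fun D f -> measurable_fun D g -> ae_eq mu D f g ->
  integrableR mu D f -> integrableR mu D g.
Proof.
move=> mf mg fg /integrableP[_ fi]; apply/integrableP; split; first exact/measurable_EFinP.
rewrite (ae_eq_integral (fun x => `|(f x)%:E|)%E)//.
- by apply: measurableT_comp => //; exact/measurable_EFinP.
- by apply: measurableT_comp => //; exact/measurable_EFinP.
- by apply: filterS fg => x /= + Dx => /(_ Dx) ->.
Qed.

Lemma cst_intR (M : R) : (mu D < +oo)%E -> integrableR mu D (fun=> M).
Proof.
move=> fD; apply/integrableP; split; first exact: measurable_cst.
by rewrite integral_cst// lte_mul_pinfty.
Qed.

Lemma intR_bounded f (M : R) : (mu D < +oo)%E -> measurable_fun D f ->
  (forall x, D x -> `|f x| <= M) -> integrableR mu D f.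
Proof.
move=> fD mf fM; apply: (le_intR mf fM).
exact: cst_intR.
Qed.

Lemma L2P f : L2 mu D f <-> measurable_fun D f /\ integrableR mu D (fun x => f x ^+ 2).
Proof.
split=> -[mf fi]; split => //.
  apply/integrableP; split; first by apply/measurable_EFinP; exact: measurable_funX.
  rewrite (_ : integral _ _ _ = sqnorm mu D f)//; apply: eq_integral => x _ /=.
  by rewrite ger0_norm// sqr_ge0.
by rewrite /sqnorm (intR_EFin fi) ltry.
Qed.

Lemma eq_L2 f g : (forall x, D x -> f x = g x) -> L2 mu D f -> L2 mu D g.
Proof.
move=> fg /L2P[mf fi]; apply/L2P; split.
  by apply: eq_measurable_fun mf => x /set_mem; exact: fg.
by apply: (eq_intR _ fi) => x Dx; rewrite fg.
Qed.

Lemma L2_meas f : L2 mu D f -> measurable_fun D f. Proof. by case. Qed.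

Lemma L2_sq f : L2 mu D f -> integrableR mu D (fun x => f x ^+ 2).
Proof. by case/L2P. Qed.

Lemma sqnormE f : L2 mu D f ->
  sqnorm mu D f = (\int[mu]_(x in D) (f x ^+ 2))%:E.
Proof. by move=> /L2_sq/intR_EFin. Qed.

(** [|f g| <= f^2 + g^2]. *)
Lemma L2_mul f g : L2 mu D f -> L2 mu D g -> integrableR mu D (fun x => f x * g x).
Proof.
move=> f2 g2; apply: (@le_intR _ (fun x => f x ^+ 2 + g x ^+ 2)).
- by apply: measurable_funM; exact: L2_meas.
- move=> x _; rewrite ler_norml; apply/andP; split; nra.
- by apply: intRD; exact: L2_sq.
Qed.

Lemma L2D f g : L2 mu D f -> L2 mu D g -> L2 mu D (fun x => f x + g x).
Proof.
move=> f2 g2; apply/L2P; split; first by apply: measurable_funD; exact: L2_meas.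
apply: (@eq_intR (fun x => f x ^+ 2 + 2 * (f x * g x) + g x ^+ 2)).
  by move=> x _; ring.
apply: intRD; last exact: L2_sq.
by apply: intRD; [exact: L2_sq|apply: intRZ; exact: L2_mul].
Qed.

Lemma L2Z (k : R) f : L2 mu D f -> L2 mu D (fun x => k * f x).
Proof.
move=> f2; apply/L2P; split.
  by apply: measurable_funM => //; exact: L2_meas.
apply: (@eq_intR (fun x => k ^+ 2 * f x ^+ 2)); first by move=> x _; ring.
by apply: intRZ; exact: L2_sq.
Qed.

Lemma L2N f : L2 mu D f -> L2 mu D (fun x => - f x).
Proof.
by move=> /(L2Z (-1)); congr L2; apply/funext => x; rewrite mulN1r.
Qed.

Lemma L2B f g : L2 mu D f -> L2 mu D g -> L2 mu D (fun x => f x - g x).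
Proof. by move=> f2 g2; apply: L2D => //; exact: L2N. Qed.

Lemma L2_le f g : measurable_fun D f -> (forall x, D x -> `|f x| <= `|g x|) ->
  L2 mu D g -> L2 mu D f.
Proof.
move=> mf fg g2; apply/L2P; split => //.
apply: (le_intR _ _ (L2_sq g2)); first exact: measurable_funX.
by move=> x Dx; rewrite normrX -[leRHS]real_normK ?num_real// lerXn2r ?nnegrE// fg.
Qed.

Lemma L2_bmul f g (M : R) : measurable_fun D f -> (forall x, D x -> `|f x| <= M) ->
  L2 mu D g -> L2 mu D (fun x => f x * g x).
Proof.
move=> mf fM g2; have := L2Z M g2; apply: L2_le.
  by apply: measurable_funM => //; exact: L2_meas.
by move=> x Dx; rewrite !normrM ler_wpM2r// (le_trans (fM x Dx))// ler_norm.
Qed.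

Lemma L2_bounded f (M : R) : (mu D < +oo)%E -> measurable_fun D f ->
  (forall x, D x -> `|f x| <= M) -> L2 mu D f.
Proof.
move=> fD mf fM; apply/L2P; split => //.
apply: (@intR_bounded _ (M ^+ 2)) => //; first exact: measurable_funX.
move=> x Dx; have M0 := le_trans (normr_ge0 _) (fM x Dx).
by rewrite normrX lerXn2r ?nnegrE ?fM.
Qed.

Lemma L2_intR f : (mu D < +oo)%E -> L2 mu D f -> integrableR mu D f.
Proof.
move=> fD f2; have o2 : L2 mu D (fun=> 1).
  by apply: (@L2_bounded _ 1) => // x _; rewrite normr1.
by apply: (eq_intR _ (L2_mul f2 o2)) => x _; rewrite mulr1.
Qed.

Lemma Rint_le f g : integrableR mu D f -> integrableR mu D g ->
  (forall x, D x -> f x <= g x) ->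
  \int[mu]_(x in D) f x <= \int[mu]_(x in D) g x.
Proof. exact: le_Rintegral. Qed.

Lemma Rint_amgm f g (s : R) : 0 < s -> L2 mu D f -> L2 mu D g ->
  2 * `|\int[mu]_(x in D) (f x * g x)| <=
  s * \int[mu]_(x in D) (f x ^+ 2) + s^-1 * \int[mu]_(x in D) (g x ^+ 2).
Proof.
move=> s0 f2 g2; have fg := L2_mul f2 g2.
apply: (@le_trans _ _ (2 * \int[mu]_(x in D) `|f x * g x|)).
  by rewrite ler_pM2l//; exact: le_normr_Rintegral.
have fgi : integrableR mu D (fun x => `|f x * g x|).
  by apply: (le_intR _ _ (integrable_norm fg)) => [|x Dx];
    [apply: measurableT_comp => //; exact: (intR_meas fg)|rewrite normr_id].
rewrite -!RintegralZl//; try exact: L2_sq.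
rewrite -RintegralD//; try by apply: intRZ; exact: L2_sq.
apply: Rint_le; [exact: intRZ|by apply: intRD; apply: intRZ; exact: L2_sq|].
move=> x _; rewrite normrM -[f x ^+ 2]real_normK ?num_real//.
rewrite -[g x ^+ 2]real_normK ?num_real//.
set a := `|f x|; set b := `|g x|.
rewrite -subr_ge0 (_ : _ - _ = s^-1 * (s * a - b) ^+ 2).
  by rewrite mulr_ge0 ?sqr_ge0// invr_ge0 ltW.
by field; rewrite gt_eqF.
Qed.

Lemma Rint_CS f g : L2 mu D f -> L2 mu D g ->
  `|\int[mu]_(x in D) (f x * g x)| <=
  Num.sqrt (\int[mu]_(x in D) (f x ^+ 2)) * Num.sqrt (\int[mu]_(x in D) (g x ^+ 2)).
Proof.
move=> f2 g2; apply: amgm_sqrt.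
- by apply: Rintegral_ge0 => x _; exact: sqr_ge0.
- by apply: Rintegral_ge0 => x _; exact: sqr_ge0.
- by move=> s s0; exact: Rint_amgm.
Qed.

Lemma sqnorm_ge0 f : (0 <= sqnorm mu D f)%E.
Proof. by apply: integral_ge0 => x _; rewrite lee_fin sqr_ge0. Qed.

(** By Cauchy-Schwarz, pairing with a fixed square-integrable function is
    continuous for the distance of L2.  The [f n] are only asked to be
    measurable: [f n - f0], hence [f n], is square integrable as soon as the
    distance is finite. *)
Lemma L2_cvg_int (f : nat -> X -> R) f0 g : L2 mu D f0 -> L2 mu D g ->
  (forall n, measurable_fun D (f n)) ->
  sqnorm mu D (fun x => f n x - f0 x) @[n --> \oo] --> 0%E ->
  (fun n => \int[mu]_(x in D) (f n x * g x)) @ \oo --> \int[mu]_(x in D) (f0 x * g x).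
Proof.
move=> f02 g2 mf cvf.
have cvs : Num.sqrt (\int[mu]_(x in D) ((f n x - f0 x) ^+ 2)) @[n --> \oo] --> (0 : R).
  rewrite -[X in _ --> X]sqrtr0; apply: continuous_cvg; first exact: sqrt_continuous.
  exact: (fine_cvg cvf).
have d2 : \forall n \near \oo, L2 mu D (fun x => f n x - f0 x).
  have /fine_cvgP[+ _] := cvf; apply: filterS => n fn; split.
    by apply: measurable_funB => //; exact: L2_meas.
  by rewrite ltey_eq fn.
apply/subr_cvg0.
apply: (@squeeze_cvgr _ _ _ _
  (fun n => - (Num.sqrt (\int[mu]_(x in D) ((f n x - f0 x) ^+ 2)) *
          Num.sqrt (\int[mu]_(x in D) (g x ^+ 2))))
  (fun n => Num.sqrt (\int[mu]_(x in D) ((f n x - f0 x) ^+ 2)) *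
          Num.sqrt (\int[mu]_(x in D) (g x ^+ 2)))).
- near=> n; rewrite -ler_norml.
  have dn : L2 mu D (fun x => f n x - f0 x) by near: n.
  have fn2 : L2 mu D (f n).
    by apply: eq_ind (L2D dn f02) _ _; apply/funext => x; rewrite subrK.
  rewrite -RintegralB//; try exact: L2_mul.
  under eq_Rint do rewrite -mulrBl.
  exact: Rint_CS.
- rewrite -oppr0; apply: cvgN; rewrite -[X in _ --> X](mul0r (Num.sqrt (\int[mu]_(x in D) (g x ^+ 2)))).
  by apply: cvgM => //; exact: cvg_cst.
- rewrite -[X in _ --> X](mul0r (Num.sqrt (\int[mu]_(x in D) (g x ^+ 2)))).
  by apply: cvgM => //; exact: cvg_cst.
Unshelve. all: by end_near.
Qed.

(** Domination almost everywhere is the form needed for functions of [x] defined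
    by integrating slices in [t]: on the null set of the [x] whose slice is not
    square integrable, the real-valued integral is a default value that obeys
    no estimate. *)
Lemma intR_le_ae (f g : X -> R) : measurable_fun D f -> integrableR mu D g ->
  {ae mu, forall x, D x -> `|f x| <= g x} -> integrableR mu D f.
Proof.
move=> mf ig fg; apply/integrableP; split; first exact/measurable_EFinP.
have /integrableP[_] := ig; apply: le_lt_trans.
apply: ae_ge0_le_integral => //.
- by apply: measurableT_comp => //; exact/measurable_EFinP.
- by apply: measurableT_comp => //; apply/measurable_EFinP; exact: intR_meas ig.
- apply: filterS fg => x /= + Dx => /(_ Dx) h.
  by rewrite lee_fin (le_trans h)// ler_norm.
Qed.

Lemma L2_sq_le_ae (f g : X -> R) : measurable_fun D f -> integrableR mu D g ->
  {ae mu, forall x, D x -> f x ^+ 2 <= g x} -> L2 mu D f.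
Proof.
move=> mf ig fg; apply/L2P => //; split => //.
apply: (intR_le_ae _ ig); first exact: measurable_funX.
by apply: filterS fg => x /= + Dx => /(_ Dx); rewrite ger0_norm ?sqr_ge0.
Qed.

Lemma Rint_dominated_cvg (f_ : nat -> X -> R) (f g : X -> R) :
  (forall n, measurable_fun D (f_ n)) -> measurable_fun D f -> integrableR mu D g ->
  {ae mu, forall x, D x -> (fun n => f_ n x) @ \oo --> f x} ->
  {ae mu, forall x, D x -> forall n, `|f_ n x| <= g x} ->
  (fun n => \int[mu]_(x in D) f_ n x) @ \oo --> \int[mu]_(x in D) f x.
Proof.
move=> mf_ mf ig cf fg.
have [] := @dominated_convergence _ _ _ mu D mD (fun n x => (f_ n x)%:E)
  (fun x => (f x)%:E) (EFin \o g) _ _ _ ig _.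
- by move=> n; exact/measurable_EFinP.
- exact/measurable_EFinP.
- by apply: filterS cf => x /= + Dx => /(_ Dx) h; apply: cvg_EFin => //; apply: nearW.
- by apply: filterS fg => x /= h n Dx; rewrite lee_fin; exact: h.
move=> fi _ cv; apply: fine_cvg; rewrite fineK; last exact: integrable_fin_num.
exact: cv.
Qed.

End real_integrals.

Lemma ae_forall_countable d (X : measurableType d) (R : realType)
    (mu : {measure set X -> \bar R}) (I : countType) (P : I -> X -> Prop) :
  (forall i, {ae mu, forall x, P i x}) -> {ae mu, forall x, forall i, P i x}.
Proof.
move=> H; have : {ae mu, forall x, forall n, if unpickle n is Some i then P i x else True}.
  apply/ae_foralln => n; case: (unpickle n) => [i|]; [exact: H|exact: aeW].
by apply: filterS => x h i; have := h (pickle i); rewrite pickleK.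
Qed.

(** * Slices of functions on a product *)

Section product_slices.
Context d1 d2 (X1 : measurableType d1) (X2 : measurableType d2) {R : realType}.
Variables (m1 : {sigma_finite_measure set X1 -> \bar R})
  (m2 : {sigma_finite_measure set X2 -> \bar R}).
Local Notation m12 := ((m1 \x m2)%E : {measure set _ -> \bar R}).

(** Tonelli: the measures of the sections of a null set have integral zero, so
    almost all of them vanish. *)
Lemma ae_prod_slice1 (P : X1 * X2 -> Prop) :
  {ae m12, forall z, P z} -> {ae m1, forall x, {ae m2, forall t, P (x, t)}}.
Proof.
move=> [N [mN N0 PN]].
have mx : measurable_fun setT (m2 \o xsection N) by exact: measurable_fun_xsection.
have := N0; rewrite /= /product_measure1 => I0.
have : ae_eq m1 setT (m2 \o xsection N) (cst 0%E).
  apply/ae_eq_integral_abs => //; rewrite -[RHS]I0.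
  by apply: eq_integral => x _; rewrite gee0_abs// measure_ge0.
apply: filterS => x /(_ I) /= Nx; exists (xsection N x); split => //.
  exact: measurable_xsection.
by move=> t /= Pt; rewrite /xsection /= inE; exact: PN.
Qed.

Lemma ae_prod_slice2 (P : X1 * X2 -> Prop) :
  {ae m12, forall z, P z} -> {ae m2, forall t, {ae m1, forall x, P (x, t)}}.
Proof.
move=> [N [mN N0 PN]].
have mx : measurable_fun setT (m1 \o ysection N) by exact: measurable_fun_ysection.
have I0 : (\int[m2]_y (m1 \o ysection N) y = 0)%E.
  have := @indic_fubini_tonelli _ _ X1 X2 R m1 m2 N mN.
  rewrite (@indic_fubini_tonelli_GE _ _ X1 X2 R m1 N mN) => <-.
  rewrite -(@indic_fubini_tonelli1 _ _ _ _ _ m1 m2 N mN) integral_indic// setIT.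
  exact: N0.
have : ae_eq m2 setT (m1 \o ysection N) (cst 0%E).
  apply/ae_eq_integral_abs => //; rewrite -[RHS]I0.
  by apply: eq_integral => x _; rewrite gee0_abs// measure_ge0.
apply: filterS => t /(_ I) /= Nt; exists (ysection N t); split => //.
  exact: measurable_ysection.
by move=> x /= Pt; rewrite /ysection /= inE; exact: PN.
Qed.

Variables (A : set X1) (B : set X2).
Hypothesis (mA : measurable A) (mB : measurable B).
Implicit Types f g : X1 * X2 -> R.

Let mAB : measurable (A `*` B). Proof. exact: measurableX. Qed.

Lemma restrict_slice1 (f : X1 * X2 -> R) x :
  (fun t => (f \_ (A `*` B)) (x, t)) =
  (if x \in A then (fun t => f (x, t)) \_ B else fun=> 0).
Proof.
apply/funext => t; rewrite patchE in_setX /=.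
by case: (x \in A) => //=; rewrite patchE.
Qed.

Lemma restrict_slice2 (f : X1 * X2 -> R) t :
  (fun x => (f \_ (A `*` B)) (x, t)) =
  (if t \in B then (fun x => f (x, t)) \_ A else fun=> 0).
Proof.
apply/funext => x; rewrite patchE in_setX /= andbC.
by case: (t \in B) => //=; rewrite patchE.
Qed.

Lemma slice1_meas f x : measurable_fun (A `*` B) f -> A x ->
  measurable_fun B (fun t => f (x, t)).
Proof.
move=> mf Ax; have mf' : measurable_fun setT (f \_ (A `*` B)).
  by apply/(measurable_restrictT _ mAB).
have : measurable_fun setT (fun t => (f \_ (A `*` B)) (x, t)).
  by apply: measurableT_comp.
by rewrite restrict_slice1 mem_set//= => h; apply/(measurable_restrictT _ mB).
Qed.

Lemma slice2_meas f t : measurable_fun (A `*` B) f -> B t ->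
  measurable_fun A (fun x => f (x, t)).
Proof.
move=> mf Bt; have mf' : measurable_fun setT (f \_ (A `*` B)).
  by apply/(measurable_restrictT _ mAB).
have : measurable_fun setT (fun x => (f \_ (A `*` B)) (x, t)).
  by apply: measurableT_comp.
by rewrite restrict_slice2 mem_set//= => h; apply/(measurable_restrictT _ mA).
Qed.

Lemma intR_restrict d (Y : measurableType d) (mu : {measure set Y -> \bar R})
    (D : set Y) (f : Y -> R) : measurable D ->
  integrableR mu D f <-> integrableR mu setT (f \_ D).
Proof.
by move=> mD; rewrite integrable_mkcond// restrict_EFin.
Qed.

Let Fr (f : X1 * X2 -> R) x : (\int[m2]_t ((f \_ (A `*` B)) (x, t))%:E)%E =
  ((fun x => (\int[m2]_(t in B) (f (x, t))%:E)%E) \_ A) x.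
Proof.
rewrite patchE; have := restrict_slice1 f x; case: ifPn => xA /= e.
  rewrite [RHS]integral_mkcond; apply: eq_integral => t _.
  by rewrite restrict_EFin /= -e.
by rewrite integral0_eq// => t _; have /= -> := congr1 (@^~ t) e.
Qed.

Let Gr (f : X1 * X2 -> R) t : (\int[m1]_x ((f \_ (A `*` B)) (x, t))%:E)%E =
  ((fun t => (\int[m1]_(x in A) (f (x, t))%:E)%E) \_ B) t.
Proof.
rewrite patchE; have := restrict_slice2 f t; case: ifPn => tB /= e.
  rewrite [RHS]integral_mkcond; apply: eq_integral => x _.
  by rewrite restrict_EFin /= -e.
by rewrite integral0_eq// => x _; have /= -> := congr1 (@^~ x) e.
Qed.

Section integrable.
Variable f : X1 * X2 -> R.
Hypothesis fi : integrableR m12 (A `*` B) f.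

Let fi' : m12.-integrable setT (EFin \o (f \_ (A `*` B))).
Proof. by have /(intR_restrict _ _ mAB) := fi. Qed.

Lemma slice1_intR : {ae m1, forall x, A x -> integrableR m2 B (fun t => f (x, t))}.
Proof.
have := @ae_integrable1 _ _ _ _ _ m1 m2 _ fi'.
apply: filterS => x /= ix Ax; apply/intR_restrict => //.
by have := restrict_slice1 f x; rewrite mem_set//= => <-.
Qed.

Lemma slice2_intR : {ae m2, forall t, B t -> integrableR m1 A (fun x => f (x, t))}.
Proof.
have := @ae_integrable2 _ _ _ _ _ m1 m2 _ fi'.
apply: filterS => t /= it Bt; apply/intR_restrict => //.
by have := restrict_slice2 f t; rewrite mem_set//= => <-.
Qed.

Let Fi : m1.-integrable A (fun x => \int[m2]_(t in B) (f (x, t))%:E)%E.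
Proof.
have := @integrable_fubini_F _ _ _ _ _ m1 m2 _ fi'.
rewrite (_ : fubini_F _ _ = (fun x => \int[m2]_(t in B) (f (x, t))%:E)%E \_ A).
  by move=> h; apply/integrable_mkcond.
by apply/funext => x; exact: Fr.
Qed.

Let Gi : m2.-integrable B (fun t => \int[m1]_(x in A) (f (x, t))%:E)%E.
Proof.
have Gm := @measurable_fubini_G _ _ _ _ _ m1 m2 _ fi'.
have GE : fubini_G m1 (EFin \o (f \_ (A `*` B))) =
    (fun t => \int[m1]_(x in A) (f (x, t))%:E)%E \_ B.
  by apply/funext => x; exact: Gr.
apply/integrable_mkcond => //; rewrite -GE; apply/integrableP; split => //.
have /(integrable21ltyP _ _ (measurable_int _ fi')) := fi'.
apply: le_lt_trans; apply: ge0_le_integral => //.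
- exact: measurableT_comp.
- apply: (@measurable_fun_fubini_tonelli_G _ _ _ _ _ m1
    (fun z => `|(EFin \o (f \_ (A `*` B))) z|%E)) => //.
  by apply: measurableT_comp => //; exact: (measurable_int _ fi').
- move=> t _; apply: le_abse_integral => //.
  by apply: measurableT_comp => //; exact: (measurable_int _ fi').
Qed.

Lemma Rint_slice1_intR : integrableR m1 A (fun x => \int[m2]_(t in B) f (x, t)).
Proof.
move/integrableP : (Fi) => [mF iF]; apply/integrableP; split.
  by apply/measurable_EFinP; apply: measurableT_comp mF.
apply: le_lt_trans iF; apply: ge0_le_integral => //.
- apply: measurableT_comp => //; apply/measurable_EFinP.
  by apply: measurableT_comp mF.
- exact: measurableT_comp.
- move=> x Ax /=; rewrite /Rintegral.
  by case: (integral _ _ _) => [r| |] //=; rewrite ?normr0 ?leey.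
Qed.

Lemma Rint_slice2_intR : integrableR m2 B (fun t => \int[m1]_(x in A) f (x, t)).
Proof.
move/integrableP : (Gi) => [mF iF]; apply/integrableP; split.
  by apply/measurable_EFinP; apply: measurableT_comp mF.
apply: le_lt_trans iF; apply: ge0_le_integral => //.
- apply: measurableT_comp => //; apply/measurable_EFinP.
  by apply: measurableT_comp mF.
- exact: measurableT_comp.
- move=> x Ax /=; rewrite /Rintegral.
  by case: (integral _ _ _) => [r| |] //=; rewrite ?normr0 ?leey.
Qed.

Lemma Fubini1 : \int[m12]_(z in A `*` B) f z =
  \int[m1]_(x in A) \int[m2]_(t in B) f (x, t).
Proof.
congr fine; rewrite integral_mkcond restrict_EFin.
rewrite -[LHS](@integral12_prod_meas1 _ _ _ _ _ m1 m2 _ fi').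
rewrite (_ : fubini_F _ _ = (fun x => \int[m2]_(t in B) (f (x, t))%:E)%E \_ A).
  rewrite -integral_mkcond; apply: ae_eq_integral => //.
  - exact: measurable_int Fi.
  - exact: measurable_int Rint_slice1_intR.
  - apply: filterS slice1_intR => x /= /[apply] ix.
    by rewrite fineK//; exact: integrable_fin_num.
by apply/funext => x; exact: Fr.
Qed.

Lemma Fubini2 : \int[m12]_(z in A `*` B) f z =
  \int[m2]_(t in B) \int[m1]_(x in A) f (x, t).
Proof.
congr fine; rewrite integral_mkcond restrict_EFin.
rewrite -[LHS](@integral21_prod_meas1 _ _ _ _ _ m1 m2 _ fi').
rewrite (_ : fubini_G _ _ = (fun t => \int[m1]_(x in A) (f (x, t))%:E)%E \_ B).
  rewrite -integral_mkcond; apply: ae_eq_integral => //.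
  - exact: measurable_int Gi.
  - exact: measurable_int Rint_slice2_intR.
  - apply: filterS slice2_intR => x /= /[apply] ix.
    by rewrite fineK//; exact: integrable_fin_num.
by apply/funext => x; exact: Gr.
Qed.

End integrable.

Lemma slice1_L2 f : L2 m12 (A `*` B) f ->
  {ae m1, forall x, A x -> L2 m2 B (fun t => f (x, t))}.
Proof.
move=> f2; have := slice1_intR (L2_sq mAB f2).
apply: filterS => x /= + Ax => /(_ Ax) ix; apply/L2P => //; split => //.
exact: (slice1_meas (L2_meas f2)).
Qed.

Lemma slice2_L2 f : L2 m12 (A `*` B) f ->
  {ae m2, forall t, B t -> L2 m1 A (fun x => f (x, t))}.
Proof.
move=> f2; have := slice2_intR (L2_sq mAB f2).
apply: filterS => t /= + Bt => /(_ Bt) it; apply/L2P => //; split => //.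
exact: (slice2_meas (L2_meas f2)).
Qed.

Lemma ae_eq_slice1 f g : ae_eq m12 (A `*` B) f g ->
  {ae m1, forall x, A x -> ae_eq m2 B (fun t => f (x, t)) (fun t => g (x, t))}.
Proof.
by move/ae_prod_slice1; apply: filterS => x /= + Ax; apply: filterS => t /= h Bt; exact: h.
Qed.

End product_slices.

(** * Calculus on the real line *)

Section calculus_on_R.
Context {R : realType}.
Implicit Types (f g F : R -> R) (x a b : R).

Lemma is_derive_addf f g x df dg : is_derive x 1 f df -> is_derive x 1 g dg ->
  is_derive x 1 (fun t => f t + g t) (df + dg).
Proof. by move=> ? ?; exact: is_deriveD. Qed.

Lemma is_derive_mulf f g x df dg : is_derive x 1 f df -> is_derive x 1 g dg ->
  is_derive x 1 (fun t => f t * g t) (df * g x + f x * dg).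
Proof.
move=> fx gx; apply: (is_derive_eq (is_deriveM fx gx)).
by rewrite addrC /GRing.scale /= [g x * df]mulrC.
Qed.

Lemma is_derive_scalef (k : R) f x df : is_derive x 1 f df ->
  is_derive x 1 (fun t => k * f t) (k * df).
Proof. by move=> fx; exact: (is_deriveZ _ fx). Qed.

Lemma is_derive_idf x : is_derive x 1 (fun t : R => t) (1 : R).
Proof. exact: is_derive_id. Qed.

Lemma is_derive_cstf (c : R) x : is_derive x 1 (fun=> c) (0 : R).
Proof. exact: is_derive_cst. Qed.

Lemma is_derive_subf f g x df dg : is_derive x 1 f df -> is_derive x 1 g dg ->
  is_derive x 1 (fun t => f t - g t) (df - dg).
Proof. by move=> ? ?; exact: is_deriveB. Qed.

Lemma is_derive_comp_lin f x (m c : R) df : is_derive (m * x + c) 1 f df ->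
  is_derive x 1 (fun t => f (m * t + c)) (m * df).
Proof.
move=> fx; rewrite mulrC.
apply: (@is_derive1_comp _ f (fun t => m * t + c) x _ _ fx).
have := is_derive_addf (is_derive_scalef m (is_derive_id x 1)) (is_derive_cst c x 1).
by rewrite mulr1 addr0.
Qed.

Lemma is_derive_cosM (m x : R) :
  is_derive x 1 (fun t => cos (m * t)) (- m * sin (m * x)).
Proof.
have := @is_derive_comp_lin cos x m 0 _ (is_derive_cos _).
rewrite addr0 mulrN -mulNr; congr is_derive.
by apply/funext => t; rewrite addr0.
Qed.

Lemma is_derive_sinM (m x : R) :
  is_derive x 1 (fun t => sin (m * t)) (m * cos (m * x)).
Proof.
have := @is_derive_comp_lin sin x m 0 _ (is_derive_sin _).
by rewrite addr0; congr is_derive; apply/funext => t; rewrite addr0.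
Qed.

Lemma is_derive_continuous f : (forall x, exists df, is_derive x 1 f df) ->
  continuous f.
Proof.
move=> fd x; have [df [fx _]] := fd x.
by apply: differentiable_continuous; exact/derivable1_diffP.
Qed.

Lemma Rint_FTC f F a b : a < b -> continuous f ->
  (forall x, is_derive x 1 F (f x)) ->
  \int[lebesgue_measure]_(t in `]a, b[%classic) f t = F b - F a.
Proof.
move=> ab cf Ff; have cF : continuous F.
  by apply: is_derive_continuous => x; exists (f x).
rewrite /Rintegral -(@integral_itv_bndoo _ a b _ true false)//; last first.
  apply/measurable_EFinP; apply: measurable_funTS.
  exact: continuous_measurable_fun.
rewrite [X in fine X](_ : _ = (F b - F a)%:E)//.
rewrite EFinB; apply: continuous_FTC2 => //.
- exact: continuous_subspaceT.
- split.
  + by move=> x _; case: (Ff x).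
  + by apply: cvg_at_right_filter; exact: cF.
  + by apply: cvg_at_left_filter; exact: cF.
- by move=> x _; rewrite derive1E; case: (Ff x).
Qed.

Lemma lebesgue_itvoo_lty a b : (lebesgue_measure `]a, b[%classic < +oo :> \bar R)%E.
Proof.
by rewrite lebesgue_measure_itv /=; case: ifP => _; rewrite -?EFinB ltry.
Qed.

Lemma continuous_intR f a b : continuous f ->
  integrableR (@lebesgue_measure R) `]a, b[%classic f.
Proof.
move=> cf; apply: (@integrableS _ (measurableTypeR R) _ _ `[a, b]%classic) => //.
  exact: subset_itv_oo_cc.
apply: continuous_compact_integrable; first exact: segment_compact.
exact: continuous_subspaceT.
Qed.

Lemma continuous_L2 f a b : continuous f ->
  L2 (@lebesgue_measure R) `]a, b[%classic f.
Proof.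
move=> cf; apply/L2P => //; split.
  by apply: measurable_funTS; exact: continuous_measurable_fun.
apply: continuous_intR => x; rewrite /=; apply: continuousM; exact: cf.
Qed.

Lemma continuous_itv_bounded f a b : continuous f ->
  exists M, forall t, `]a, b[%classic t -> `|f t| <= M.
Proof.
move=> cf; have : compact (f @` `[a, b]%classic).
  apply: continuous_compact; last exact: segment_compact.
  exact: continuous_subspaceT.
move=> /compact_bounded[M [_ HM]]; exists (`|M| + 1) => t It.
apply: HM; first by rewrite (le_lt_trans (ler_norm _))// ltrDl.
by exists t => //; exact: subset_itv_oo_cc.
Qed.

Lemma inv_meas : measurable_fun setT (fun x : R => x^-1).
Proof.
rewrite (_ : (fun x => _) = (fun x => x * (x ^+ 2) `^ (-1))).
  apply: measurable_funM => //.
  have h := @measurable_powR R (-1).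
  have h2 := @exprn_measurable R setT 2.
  exact: measurableT_comp h h2.
apply/funext => x; have [->|x0] := eqVneq x 0; first by rewrite invr0 mul0r.
by rewrite powR_inv1 ?sqr_ge0//; field.
Qed.

End calculus_on_R.

Lemma norm_dot2_le (R : realType) (a b c e : R) :
  `|a * b + c * e| <= a * a + c * c + (b * b + e * e).
Proof.
have := sqr_ge0 (a + b); have := sqr_ge0 (a - b).
have := sqr_ge0 (c + e); have := sqr_ge0 (c - e).
have := sqr_ge0 a; have := sqr_ge0 b; have := sqr_ge0 c; have := sqr_ge0 e.
by rewrite ler_norml => *; apply/andP; split; lra.
Qed.

(** * Parseval's identity for the trigonometric system *)

Section trigonometric_system.
Context {R : realType} (T : R).
Hypothesis T0 : 0 < T.
Local Notation I := (`]0, T[%classic : set R).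
Local Notation leb := (@lebesgue_measure R).
Local Notation om := (omega T).
Local Notation C k := (fun t : R => cos (k%:R * om * t)).
Local Notation S k := (fun t : R => sin (k%:R * om * t)).
Local Notation L2I := (L2 leb I).
Implicit Types (f g : R -> R) (k l n N : nat).

Let mI : @measurable _ (measurableTypeR R) I. Proof. exact: measurable_itv. Qed.
Let Ifin : (leb I < +oo)%E. Proof. exact: lebesgue_itvoo_lty. Qed.

Lemma omega_gt0 : 0 < om.
Proof. by rewrite /omega divr_gt0// mulr_gt0// pi_gt0. Qed.

Lemma freqT k : k%:R * om * T = (pi *+ 2) *+ k.
Proof. by rewrite /omega -mulrA divfK ?gt_eqF// mulr_natl mulr_natl. Qed.

Lemma cos_freqT k : cos (k%:R * om * T) = 1.
Proof. by rewrite freqT -[LHS](congr1 cos (add0r _)) (periodicn (@cosD2pi R)) cos0. Qed.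

Lemma sin_freqT k : sin (k%:R * om * T) = 0.
Proof. by rewrite freqT -[LHS](congr1 sin (add0r _)) (periodicn (@sinD2pi R)) sin0. Qed.

Lemma freq_gt0 k : (0 < k)%N -> 0 < k%:R * om.
Proof. by move=> k0; rewrite mulr_gt0 ?ltr0n// omega_gt0. Qed.

Lemma continuous_cosM (m : R) : continuous (fun t => cos (m * t)).
Proof. by apply: is_derive_continuous => x; eexists; exact: is_derive_cosM. Qed.

Lemma continuous_sinM (m : R) : continuous (fun t => sin (m * t)).
Proof. by apply: is_derive_continuous => x; eexists; exact: is_derive_sinM. Qed.

Lemma L2_cosM (m : R) : L2I (fun t => cos (m * t)).
Proof. exact/continuous_L2/continuous_cosM. Qed.

Lemma L2_sinM (m : R) : L2I (fun t => sin (m * t)).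
Proof. exact/continuous_L2/continuous_sinM. Qed.

Lemma L2_cst (c : R) : L2I (fun=> c).
Proof. by apply: continuous_L2; exact: cst_continuous. Qed.

Lemma leb_oo (a : R) : 0 < a -> fine (leb `]0, a[%classic) = a.
Proof. by move=> a0; rewrite lebesgue_measure_itv /= lte_fin a0 -EFinB /= subr0. Qed.

Lemma leb_I : fine (leb I) = T.
Proof. exact: leb_oo. Qed.

Lemma Rint_cstI (c : R) : \int[leb]_(t in I) c = c * T.
Proof. by rewrite Rintegral_cst// leb_I. Qed.

Lemma Rint_cosM (m : R) : m != 0 ->
  \int[leb]_(t in I) cos (m * t) = sin (m * T) / m.
Proof.
move=> m0; have H (x : R) : is_derive x 1 (fun t => m^-1 * sin (m * t)) (cos (m * x)).
  by have := is_derive_scalef m^-1 (is_derive_sinM m x); rewrite mulKf.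
by rewrite (Rint_FTC T0 (@continuous_cosM m) H) mulr0 sin0 mulr0 subr0 mulrC.
Qed.

Lemma Rint_sinM (m : R) : m != 0 ->
  \int[leb]_(t in I) sin (m * t) = (1 - cos (m * T)) / m.
Proof.
move=> m0; have H (x : R) : is_derive x 1 (fun t => - m^-1 * cos (m * t)) (sin (m * x)).
  by have := is_derive_scalef (- m^-1) (is_derive_cosM m x); rewrite mulrA mulrNN mulVf// mul1r.
by rewrite (Rint_FTC T0 (@continuous_sinM m) H) mulr0 cos0; field.
Qed.

Lemma Rint_C k : (0 < k)%N -> \int[leb]_(t in I) C k t = 0.
Proof. by move=> k0; rewrite Rint_cosM ?gt_eqF ?freq_gt0// sin_freqT mul0r. Qed.

Lemma Rint_S k : \int[leb]_(t in I) S k t = 0.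
Proof.
case: k => [|k].
  rewrite -[RHS](mul0r T) -(Rint_cstI 0); apply: eq_Rint => t _.
  by rewrite !mul0r sin0.
by rewrite Rint_sinM ?gt_eqF ?freq_gt0// cos_freqT subrr mul0r.
Qed.

Lemma prodCC k l t : (k <= l)%N -> C k t * C l t = 2^-1 * (C (l - k)%N t + C (l + k)%N t).
Proof.
move=> kl; rewrite natrB// natrD !mulrBl !mulrDl cosB cosD; lra.
Qed.

Lemma prodSS k l t : (k <= l)%N -> S k t * S l t = 2^-1 * (C (l - k)%N t - C (l + k)%N t).
Proof.
move=> kl; rewrite natrB// natrD !mulrBl !mulrDl cosB cosD; lra.
Qed.

Lemma prodSC k l t : (k <= l)%N -> S k t * C l t = 2^-1 * (S (l + k)%N t - S (l - k)%N t).
Proof.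
move=> kl; rewrite natrB// natrD !mulrBl !mulrDl sinB sinD; lra.
Qed.

Lemma prodCS k l t : (k <= l)%N -> C k t * S l t = 2^-1 * (S (l + k)%N t + S (l - k)%N t).
Proof.
move=> kl; rewrite natrB// natrD !mulrBl !mulrDl sinB sinD; lra.
Qed.

Let iC k : integrableR leb I (C k).
Proof. exact/continuous_intR/continuous_cosM. Qed.
Let iS k : integrableR leb I (S k).
Proof. exact/continuous_intR/continuous_sinM. Qed.

Lemma orthCC k l : (k < l)%N -> \int[leb]_(t in I) (C k t * C l t) = 0.
Proof.
move=> kl; under eq_Rint do rewrite prodCC 1?ltnW//.
rewrite RintegralZl//; last exact: intRD.
by rewrite RintegralD// !Rint_C ?addr0 ?mulr0// ?subn_gt0// addn_gt0 (leq_ltn_trans _ kl).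
Qed.

Lemma orthSS k l : (k < l)%N -> \int[leb]_(t in I) (S k t * S l t) = 0.
Proof.
move=> kl; under eq_Rint do rewrite prodSS 1?ltnW//.
rewrite RintegralZl//; last exact: intRB.
by rewrite RintegralB// !Rint_C ?subr0 ?mulr0// ?subn_gt0// addn_gt0 (leq_ltn_trans _ kl).
Qed.

Lemma orthSC k l : (k <= l)%N -> \int[leb]_(t in I) (S k t * C l t) = 0.
Proof.
move=> kl; under eq_Rint do rewrite prodSC//.
rewrite RintegralZl//; last exact: intRB.
by rewrite RintegralB// !Rint_S subr0 mulr0.
Qed.

Lemma orthCS k l : (k <= l)%N -> \int[leb]_(t in I) (C k t * S l t) = 0.
Proof.
move=> kl; under eq_Rint do rewrite prodCS//.
rewrite RintegralZl//; last exact: intRD.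
by rewrite RintegralD// !Rint_S addr0 mulr0.
Qed.

Lemma normC k : (0 < k)%N -> \int[leb]_(t in I) (C k t * C k t) = T / 2.
Proof.
move=> k0; under eq_Rint do rewrite prodCC// subnn.
rewrite RintegralZl//; last exact: intRD.
rewrite RintegralD// (@Rint_C (k + k)%N) ?addn_gt0 ?k0//.
under eq_Rint do rewrite mulr0n !mul0r cos0.
by rewrite Rint_cstI addr0 mul1r mulrC.
Qed.

Lemma normS k : (0 < k)%N -> \int[leb]_(t in I) (S k t * S k t) = T / 2.
Proof.
move=> k0; under eq_Rint do rewrite prodSS// subnn.
rewrite RintegralZl//; last exact: intRB.
rewrite RintegralB// (@Rint_C (k + k)%N) ?addn_gt0 ?k0//.
under eq_Rint do rewrite mulr0n !mul0r cos0.
by rewrite Rint_cstI subr0 mul1r mulrC.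
Qed.

Definition fcos f k : R := 2 / T * \int[leb]_(t in I) (f t * C k t).
Definition fsin f k : R := 2 / T * \int[leb]_(t in I) (f t * S k t).

Lemma Rint_fcos f k : \int[leb]_(t in I) (f t * C k t) = T / 2 * fcos f k.
Proof. by rewrite /fcos; field; rewrite gt_eqF. Qed.

Lemma Rint_fsin f k : \int[leb]_(t in I) (f t * S k t) = T / 2 * fsin f k.
Proof. by rewrite /fsin; field; rewrite gt_eqF. Qed.

Lemma eq_fcos f f' k : (forall t, I t -> f t = f' t) -> fcos f k = fcos f' k.
Proof. by move=> ff'; congr (_ * _); apply: eq_Rint => t It; rewrite ff'. Qed.

Lemma eq_fsin f f' k : (forall t, I t -> f t = f' t) -> fsin f k = fsin f' k.
Proof. by move=> ff'; congr (_ * _); apply: eq_Rint => t It; rewrite ff'. Qed.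

Lemma RintL (a b : R) f g : integrableR leb I f -> integrableR leb I g ->
  \int[leb]_(t in I) (a * f t + b * g t) =
  a * \int[leb]_(t in I) f t + b * \int[leb]_(t in I) g t.
Proof.
move=> fi gi; rewrite RintegralD//; try exact: intRZ.
by rewrite !RintegralZl.
Qed.

Lemma fcosL (a b : R) f g k : L2I f -> L2I g ->
  fcos (fun t => a * f t + b * g t) k = a * fcos f k + b * fcos g k.
Proof.
move=> f2 g2; rewrite /fcos (@eq_Rint _ (measurableTypeR R) _ leb I _
  (fun t => a * (f t * C k t) + b * (g t * C k t))); last by move=> t _; ring.
have := RintL a b (L2_mul mI f2 (L2_cosM (k%:R * om))) (L2_mul mI g2 (L2_cosM (k%:R * om))).
by move=> ->; rewrite mulrDr; congr (_ + _); rewrite mulrCA.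
Qed.

Lemma fsinL (a b : R) f g k : L2I f -> L2I g ->
  fsin (fun t => a * f t + b * g t) k = a * fsin f k + b * fsin g k.
Proof.
move=> f2 g2; rewrite /fsin (@eq_Rint _ (measurableTypeR R) _ leb I _
  (fun t => a * (f t * S k t) + b * (g t * S k t))); last by move=> t _; ring.
have := RintL a b (L2_mul mI f2 (L2_sinM (k%:R * om))) (L2_mul mI g2 (L2_sinM (k%:R * om))).
by move=> ->; rewrite mulrDr; congr (_ + _); rewrite mulrCA.
Qed.

(** Partial sums of the right-hand side of Parseval's identity, without the
    contribution of the means. *)
Definition fpart N f g : R := T / 2 * \sum_(1 <= k < N) (fcos f k * fcos g k + fsin f k * fsin g k).

(** The failure of Parseval's identity at order [N].  It is bilinear, and
    nonnegative on the diagonal because it is the squared norm of a residual;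
    so the functions whose defect tends to zero form a closed subspace, and it
    suffices to find enough of them. *)
Definition defect N f g : R := \int[leb]_(t in I) (f t * g t)
  - (\int[leb]_(t in I) f t) * (\int[leb]_(t in I) g t) / T - fpart N f g.

(** [f] minus its partial Fourier sum of the mean and the modes [k < N]; the case
    [N = 0] subtracts nothing and only starts the recursion. *)
Fixpoint residual N f : R -> R := match N with
  | 0 => f
  | 1 => fun t => f t - (\int[leb]_(s in I) f s) / T
  | M.+1 => fun t => residual M f t - (fcos f M * C M t + fsin f M * S M t)
  end.

Lemma residualS N f t : residual N.+2 f t =
  residual N.+1 f t - (fcos f N.+1 * C N.+1 t + fsin f N.+1 * S N.+1 t).
Proof. by []. Qed.

Lemma residual_L2 N f : L2I f -> L2I (residual N f).
Proof.
move=> f2; elim: N => [//|[|N] IH].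
  by apply: L2B => //; exact: L2_cst.
by apply: L2B => //; apply: L2D => //; apply: L2Z => //; [exact: L2_cosM|exact: L2_sinM].
Qed.

(** Subtracting modes of lower order does not change the coefficients of order
    at least [N]. *)
Lemma residual_C N f k : L2I f -> (0 < N <= k)%N ->
  \int[leb]_(t in I) (residual N f t * C k t) = T / 2 * fcos f k.
Proof.
move=> f2; elim: N => [//|[|N] IH /andP[_ Nk]].
  rewrite /=; under eq_Rint do rewrite mulrBl.
  have fi := L2_mul mI f2 (L2_cosM (k%:R * om)).
  rewrite RintegralB//; last exact/intRZ.
  by rewrite RintegralZl// Rint_C// mulr0 subr0 Rint_fcos.
have r2 := residual_L2 N.+1 f2.
have rC := L2_mul mI r2 (L2_cosM (k%:R * om)).
have CC := L2_mul mI (L2_cosM (N.+1%:R * om)) (L2_cosM (k%:R * om)).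
have SC := L2_mul mI (L2_sinM (N.+1%:R * om)) (L2_cosM (k%:R * om)).
rewrite (@eq_Rint _ (measurableTypeR R) _ leb _ _ (fun t => residual N.+1 f t * C k t -
  (fcos f N.+1 * (C N.+1 t * C k t) + fsin f N.+1 * (S N.+1 t * C k t)))); last first.
  by move=> t _ /=; ring.
rewrite RintegralB//; last by apply: intRD => //; exact: intRZ.
have -> := RintL (fcos f N.+1) (fsin f N.+1) CC SC.
rewrite (IH (ltnW Nk)) (orthCC Nk) (orthSC (ltnW Nk)).
by rewrite !mulr0 addr0 subr0.
Qed.

Lemma residual_S N f k : L2I f -> (0 < N <= k)%N ->
  \int[leb]_(t in I) (residual N f t * S k t) = T / 2 * fsin f k.
Proof.
move=> f2; elim: N => [//|[|N] IH /andP[_ Nk]].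
  rewrite /=; under eq_Rint do rewrite mulrBl.
  have fi := L2_mul mI f2 (L2_sinM (k%:R * om)).
  rewrite RintegralB//; last exact/intRZ.
  by rewrite RintegralZl// Rint_S// mulr0 subr0 Rint_fsin.
have r2 := residual_L2 N.+1 f2.
have rC := L2_mul mI r2 (L2_sinM (k%:R * om)).
have CC := L2_mul mI (L2_cosM (N.+1%:R * om)) (L2_sinM (k%:R * om)).
have SC := L2_mul mI (L2_sinM (N.+1%:R * om)) (L2_sinM (k%:R * om)).
rewrite (@eq_Rint _ (measurableTypeR R) _ leb _ _ (fun t => residual N.+1 f t * S k t -
  (fcos f N.+1 * (C N.+1 t * S k t) + fsin f N.+1 * (S N.+1 t * S k t)))); last first.
  by move=> t _ /=; ring.
rewrite RintegralB//; last by apply: intRD => //; exact: intRZ.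
have -> := RintL (fcos f N.+1) (fsin f N.+1) CC SC.
rewrite (IH (ltnW Nk)) (orthSS Nk) (orthCS (ltnW Nk)).
by rewrite !mulr0 addr0 subr0.
Qed.

Lemma defect_residual N f : L2I f ->
  \int[leb]_(t in I) (residual N.+1 f t ^+ 2) = defect N.+1 f f.
Proof.
move=> f2; have fi := L2_intR mI Ifin f2.
elim: N => [|N IH].
  rewrite /defect /fpart big_geq// mulr0 subr0 /=.
  set F := \int[leb]_(s in I) f s.
  rewrite (@eq_Rint _ (measurableTypeR R) _ leb _ _ (fun t => (f t * f t - (2 * F / T) * f t) + (F / T) ^+ 2)); last first.
    by move=> t _; field; rewrite gt_eqF.
  have ff := L2_mul mI f2 f2.
  rewrite RintegralD//; [|by apply: intRB => //; exact: intRZ|exact: cst_intR].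
  rewrite RintegralB//; last exact: intRZ.
  by rewrite RintegralZl// Rint_cstI -/F; field; rewrite gt_eqF.
have r2 := residual_L2 N.+1 f2.
pose c := fcos f N.+1; pose s := fsin f N.+1.
have Cc := L2_cosM (N.+1%:R * om); have Ss := L2_sinM (N.+1%:R * om).
rewrite (@eq_Rint _ (measurableTypeR R) _ leb _ _ (fun t => (residual N.+1 f t ^+ 2 +
  (- 2 * c) * (residual N.+1 f t * C N.+1 t)) +
  ((- 2 * s) * (residual N.+1 f t * S N.+1 t) +
   (c ^+ 2 * (C N.+1 t * C N.+1 t) + (s ^+ 2 * (S N.+1 t * S N.+1 t) +
    (2 * c * s) * (C N.+1 t * S N.+1 t)))))); last first.
  by move=> t _; rewrite residualS -/c -/s; ring.
have i1 := L2_sq mI r2; have i2 := L2_mul mI r2 Cc; have i3 := L2_mul mI r2 Ss.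
have i4 := L2_mul mI Cc Cc; have i5 := L2_mul mI Ss Ss; have i6 := L2_mul mI Cc Ss.
pose r := residual N.+1 f.
have j1 : integrableR leb I (fun t => r t ^+ 2 + (- 2 * c) * (r t * C N.+1 t)).
  by apply: intRD => //; exact: intRZ.
have j2 : integrableR leb I (fun t => s ^+ 2 * (S N.+1 t * S N.+1 t) +
    (2 * c * s) * (C N.+1 t * S N.+1 t)).
  by apply: intRD => //; exact: intRZ.
have j3 := intRD mI (intRZ mI (c ^+ 2) i4) j2.
have j4 := intRD mI (intRZ mI (- 2 * s) i3) j3.
rewrite (RintegralD mI j1 j4) (RintegralD mI i1 (intRZ mI (- 2 * c) i2)).
rewrite (RintegralD mI (intRZ mI (- 2 * s) i3) j3).
rewrite (RintegralD mI (intRZ mI (c ^+ 2) i4) j2).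
rewrite (RintL (s ^+ 2) (2 * c * s) i5 i6).
rewrite (RintegralZl (- 2 * c) mI i2) (RintegralZl (- 2 * s) mI i3) (RintegralZl (c ^+ 2) mI i4).
rewrite IH (@normC N.+1)// (@normS N.+1)// (@orthCS N.+1 N.+1)//.
rewrite (@residual_C N.+1 f N.+1) ?leqnn// (@residual_S N.+1 f N.+1) ?leqnn//.
rewrite /defect /fpart [in RHS]big_nat_recr//= -/c -/s.
by field; rewrite gt_eqF.
Qed.

Lemma defect_ge0 N f : L2I f -> (0 < N)%N -> 0 <= defect N f f.
Proof.
case: N => // N f2 _; rewrite -defect_residual//.
by apply: Rintegral_ge0 => t _; exact: sqr_ge0.
Qed.

Lemma fpart_ge0 N f : 0 <= fpart N f f.
Proof.
apply: mulr_ge0; first by rewrite divr_ge0// ltW.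
apply: sumr_ge0 => k _.
by rewrite addr_ge0// -expr2 sqr_ge0.
Qed.

Lemma bessel N f : L2I f -> fpart N f f <= \int[leb]_(t in I) (f t ^+ 2).
Proof.
move=> f2; case: N => [|N].
  by rewrite /fpart big_geq// mulr0 Rintegral_ge0// => t _; exact: sqr_ge0.
have := @defect_ge0 N.+1 f f2 isT; rewrite /defect -expr2 subr_ge0 => /le_trans; apply.
by rewrite lerBlDr lerDl divr_ge0 ?sqr_ge0 1?ltW.
Qed.

Lemma defectL N (a b c e : R) f g : L2I f -> L2I g ->
  defect N (fun t => a * f t + b * g t) (fun t => c * f t + e * g t) =
  a * c * defect N f f + (a * e + b * c) * defect N f g + b * e * defect N g g.
Proof.
move=> f2 g2; rewrite /defect.
have fi := L2_intR mI Ifin f2; have gi := L2_intR mI Ifin g2.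
have ff := L2_mul mI f2 f2; have fg := L2_mul mI f2 g2; have gg := L2_mul mI g2 g2.
rewrite (@eq_Rint _ (measurableTypeR R) _ leb _ _ (fun t => (a * c) * (f t * f t) +
   ((a * e + b * c) * (f t * g t) + (b * e) * (g t * g t)))); last first.
  by move=> t _; ring.
rewrite RintegralD//; [|exact: intRZ|by apply: intRD => //; exact: intRZ].
rewrite !RintL// RintegralZl// /fpart.
under eq_bigr do rewrite !fcosL// !fsinL//.
set P := \sum_(1 <= k < N) (fcos f k * fcos f k + fsin f k * fsin f k).
set Q := \sum_(1 <= k < N) (fcos f k * fcos g k + fsin f k * fsin g k).
set Z := \sum_(1 <= k < N) (fcos g k * fcos g k + fsin g k * fsin g k).
rewrite (_ : \sum_(1 <= k < N) _ = a * c * P + (a * e + b * c) * Q + b * e * Z).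
  by field; rewrite gt_eqF.
rewrite /P /Q /Z !mulr_sumr -!big_split /=; apply: eq_bigr => k _; ring.
Qed.

Lemma eq_defect N f f' g g' : (forall t, I t -> f t = f' t) ->
  (forall t, I t -> g t = g' t) -> defect N f g = defect N f' g'.
Proof.
move=> ff' gg'; rewrite /defect /fpart.
rewrite (@eq_Rint _ (measurableTypeR R) _ leb I (fun t => f t * g t) (fun t => f' t * g' t)); last first.
  by move=> t It; rewrite ff'// gg'.
rewrite (eq_Rint leb ff') (eq_Rint leb gg'); congr (_ - _ * _).
apply: eq_bigr => k _.
by rewrite !(eq_fcos k ff') !(eq_fsin k ff') !(eq_fcos k gg') !(eq_fsin k gg').
Qed.

Lemma defect_le N f : L2I f -> (0 < N)%N ->
  defect N f f <= \int[leb]_(t in I) (f t ^+ 2).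
Proof.
move=> f2 N0; rewrite /defect -expr2.
have : 0 <= (\int[leb]_(t in I) f t) ^+ 2 / T by rewrite divr_ge0 ?sqr_ge0 1?ltW.
have := fpart_ge0 N f.
rewrite (@eq_Rint _ (measurableTypeR R) _ leb I (fun t => f t * f t) (fun t => f t ^+ 2))//; lra.
Qed.

(** Expand the nonnegative defects of [f + g] and [f - g]. *)
Lemma defect_polar N f g : L2I f -> L2I g -> (0 < N)%N ->
  `|defect N f g| <= 2^-1 * (defect N f f + defect N g g).
Proof.
move=> f2 g2 N0.
have := @defect_ge0 N (fun t => 1 * f t + 1 * g t) _ N0.
rewrite defectL// => /(_ (L2D mI (L2Z mI 1 f2) (L2Z mI 1 g2))) h1.
have := @defect_ge0 N (fun t => 1 * f t + -1 * g t) _ N0.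
rewrite defectL// => /(_ (L2D mI (L2Z mI 1 f2) (L2Z mI (-1) g2))) h2.
by rewrite ler_norml; apply/andP; split; lra.
Qed.

(** Parseval's identity for [f], in the form that passes to linear combinations
    and to L2 limits. *)
Definition complete f := (fun N => defect N f f) @ \oo --> (0 : R).

Lemma complete_cross f g : L2I f -> L2I g -> complete f -> complete g ->
  (fun N => defect N f g) @ \oo --> (0 : R).
Proof.
move=> f2 g2 cf cg.
have h : (fun N => 2^-1 * (defect N f f + defect N g g)) @ \oo --> (0 : R).
  rewrite -(mulr0 2^-1); apply: cvgM; first exact: cvg_cst.
  by rewrite -(addr0 0); exact: cvgD.
apply: (@squeeze_cvgr _ _ _ _ (fun N => - (2^-1 * (defect N f f + defect N g g)))
   (fun N => 2^-1 * (defect N f f + defect N g g))) => //.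
  by near=> N; rewrite -ler_norml defect_polar//; near: N; exact: nbhs_infty_gt.
by rewrite -oppr0; exact: cvgN.
Unshelve. all: by end_near.
Qed.

Lemma complete_lin (a b : R) f g : L2I f -> L2I g -> complete f -> complete g ->
  complete (fun t => a * f t + b * g t).
Proof.
move=> f2 g2 cf cg; have pg := complete_cross f2 g2 cf cg.
rewrite /complete; under eq_fun do rewrite defectL//.
rewrite (_ : 0 = a * a * 0 + (a * b + b * a) * 0 + b * b * 0); last by ring.
by apply: cvgD; [apply: cvgD|]; apply: cvgM => //; exact: cvg_cst.
Qed.

Lemma eq_complete f g : (forall t, I t -> f t = g t) -> complete f -> complete g.
Proof. by move=> fg; rewrite /complete; under eq_fun do rewrite (eq_defect _ fg fg). Qed.

(** [defect f <= 2 defect (f - g) + 2 defect g], and the defect of [f - g] is at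
    most its squared norm; hence the two quarters of [e]. *)
Lemma complete_closed f : L2I f ->
  (forall e, 0 < e -> exists g, [/\ L2I g, complete g &
     \int[leb]_(t in I) ((f t - g t) ^+ 2) <= e]) -> complete f.
Proof.
move=> f2 H; apply/cvgrPdist_le => e e0.
have [g [g2 cg fg]] := H (e / 4) ltac:(by rewrite divr_gt0).
move/cvgrPdist_le : cg => /(_ (e / 4) ltac:(by rewrite divr_gt0)) cg.
near=> N; have N0 : (0 < N)%N by near: N; exact: nbhs_infty_gt.
have : `|0 - defect N g g| <= e / 4 by near: N.
have d2 := L2B mI f2 g2.
rewrite !sub0r !normrN !ger0_norm ?defect_ge0// => gN.
have hd := le_trans (defect_le d2 N0) fg.
have := @defect_ge0 N (fun t => 1 * (f t - g t) + -1 * g t) _ N0.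
rewrite defectL// => /(_ (L2D mI (L2Z mI 1 d2) (L2Z mI (-1) g2))) h.
rewrite (@eq_defect N f (fun t => 1 * (f t - g t) + 1 * g t) f (fun t => 1 * (f t - g t) + 1 * g t)); last 2 first.
- by move=> t _; ring.
- by move=> t _; ring.
rewrite defectL//; lra.
Unshelve. all: by end_near.
Qed.

Lemma complete_dominated (h : nat -> R -> R) f : L2I f ->
  (forall n, L2I (h n)) -> (forall n, complete (h n)) ->
  (forall n t, I t -> `|f t - h n t| <= `|f t|) ->
  (forall t, I t -> h ^~ t @ \oo --> f t) -> complete f.
Proof.
move=> f2 h2 hc hf hcv; apply: complete_closed => // e e0.
have cv : (fun n => \int[leb]_(t in I) ((f t - h n t) ^+ 2)) @ \oo --> (0 : R).
  have := @Rint_dominated_cvg _ _ _ leb I mI (fun n t => (f t - h n t) ^+ 2) (fun=> 0)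
    (fun t => f t ^+ 2) _ _ (L2_sq mI f2).
  rewrite Rint_cstI mul0r; apply.
  - by move=> n; apply: measurable_funX; apply: measurable_funB; [exact: L2_meas f2|exact: L2_meas (h2 n)].
  - exact: measurable_cst.
  - apply: aeW => t It; rewrite -[X in _ --> X](expr0n R 2) -(subrr (f t)).
    by apply: cvgM; apply: cvgB; [exact: cvg_cst|exact: hcv|exact: cvg_cst|exact: hcv].
  - apply: aeW => t It n; rewrite normrX -[leRHS]real_normK ?num_real//.
    by rewrite lerXn2r ?nnegrE// hf.
move/cvgrPdist_le : cv => /(_ e e0) [n _ /(_ n (leqnn n))] /= hn.
exists (h n); split => //; apply: le_trans hn.
by rewrite sub0r normrN ler_norm.
Qed.

(** From [u cos u <= sin u] at [u = x / 2] and the duplication formulas. *)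
Lemma sin_ge_half (x : R) : 0 <= x <= pi / 2 -> x / 2 <= sin x.
Proof.
move=> /andP[x0 xpi]; have pi0 := pi_gt0 R.
have hcos : forall y : R, 0 <= y <= pi / 2 -> y * cos y <= sin y.
  move=> y /andP[]; rewrite le_eqVlt => /predU1P[<- _|y0 ypi]; first by rewrite mul0r sin0.
  have [c cin E] := @MVT R sin cos 0 y y0 (fun t _ => is_derive_sin t)
    (continuous_subspaceT (@continuous_sin R)).
  move: cin; rewrite in_itv /= => /andP[c0 cy].
  move: E; rewrite sin0 !subr0 => ->; rewrite mulrC ler_pM2r// ltW// ltr_cos//.
  - by rewrite in_itv /=; lra.
  - by rewrite in_itv /=; lra.
have h : 0 <= x / 2 <= pi / 2 by lra.
have := hcos _ h; set u := x / 2 => hu.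
have cu : 0 <= cos u by apply: cos_ge0_pihalf; rewrite /u; lra.
have cx : 0 <= cos x by apply: cos_ge0_pihalf; lra.
have E : x = u *+ 2 by rewrite /u mulr2n; lra.
have -> : sin x = 2 * (cos u * sin u) by rewrite E sin_mulr2n mulr_natl.
have c2 : 2 * cos u ^+ 2 = cos x + 1 by rewrite E cos_mulr2n; ring.
have : cos u * (u * cos u) <= cos u * sin u by rewrite ler_wpM2l.
have u0 : 0 <= u by rewrite /u; lra.
rewrite -/u; nra.
Qed.

Lemma sin_ge_parabola (x : R) : 0 <= x <= pi -> x * (pi - x) <= 2 * pi * sin x.
Proof.
have H : forall y : R, 0 <= y <= pi / 2 -> y * (pi - y) <= 2 * pi * sin y.
  move=> y hy; have := sin_ge_half hy; have pi0 := pi_gt0 R.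
  move: hy => /andP[y0 ypi] h; apply: (@le_trans _ _ (pi * y)); first by nra.
  by nra.
move=> /andP[x0 xpi]; have [h|h] := leP x (pi / 2); first by apply: H; rewrite x0.
have -> : sin x = sin (pi - x) by rewrite sinB sinpi cospi mul0r sub0r mulN1r opprK.
have h' : 0 <= pi - x <= pi / 2 by lra.
by have := H _ h'; rewrite opprB addrCA subrr addr0 mulrC.
Qed.

(** On the interval this parabola vanishes where [sin (om / 2 (t - a))] does.  Its
    quotient by that sine is bounded, so against [par a] the Dirichlet
    kernel centred at [a] becomes a high-frequency sine against a
    square-integrable function.  This yields the sum of [cos (k om a) / k^2] by the
    Riemann-Lebesgue lemma alone, without pointwise convergence of Fourier
    series. *)
Definition par (a t : R) := t * (T - t) - a * (T - a).

Definition quot (a t : R) := par a t * (sin (om / 2 * (t - a)))^-1.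

Lemma par_sin (a t : R) : 0 <= a < T -> I t ->
  `|par a t| <= 2 * (T / pi) ^+ 2 * pi * `|sin (om / 2 * (t - a))|.
Proof.
move=> /andP[a0 aT]; rewrite /= in_itv /= => /andP[t0 tT]; have pi0 := pi_gt0 R.
pose u := `|t - a|; have u0 : 0 <= u by exact: normr_ge0.
have uT : u <= T by rewrite ler_norml; lra.
pose th := pi / T * u.
have th0 : 0 <= th by rewrite mulr_ge0// divr_ge0// ltW.
have thpi : th <= pi by rewrite /th mulrAC ler_pdivrMr// ler_pM2l.
have -> : `|sin (om / 2 * (t - a))| = sin th.
  have -> : om / 2 * (t - a) = pi / T * (t - a).
    by rewrite /omega; field; rewrite gt_eqF.
  rewrite /th /u; have [h|h] := leP 0 (t - a).
    rewrite [in RHS]ger0_norm// ger0_norm// sin_ge0_pi//.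
    by move: th0 thpi; rewrite /th /u ger0_norm// => -> ->.
  rewrite [in RHS]ltr0_norm// mulrN -[LHS]normrN -sinN ger0_norm// sin_ge0_pi//.
  by move: th0 thpi; rewrite /th /u ltr0_norm// mulrN => -> ->.
have := @sin_ge_parabola th; rewrite th0 thpi => /(_ isT) h.
have E : u * (T - u) = (T / pi) ^+ 2 * (th * (pi - th)).
  pose q := pi / T; have q0 : 0 < q by rewrite divr_gt0.
  have piE : pi = q * T by rewrite /q divfK// gt_eqF.
  rewrite /th -/q -invf_div -/q piE; field.
  by rewrite gt_eqF.
apply: (@le_trans _ _ (u * (T - u))).
  have -> : par a t = (t - a) * (T - t - a) by rewrite /par; ring.
  rewrite normrM ler_wpM2l// /u ler_norml.
  by have [?|?] := leP 0 (t - a); [rewrite ger0_norm//|rewrite ltr0_norm//]; lra.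
rewrite E; have -> : 2 * (T / pi) ^+ 2 * pi * sin th = (T / pi) ^+ 2 * (2 * pi * sin th) by ring.
by rewrite ler_wpM2l// sqr_ge0.
Qed.

(** Holds also where the sine vanishes, since [par a] vanishes there too. *)
Lemma quotK (a t : R) : 0 <= a < T -> I t -> quot a t * sin (om / 2 * (t - a)) = par a t.
Proof.
move=> ha It; rewrite /quot; have [s0|s0] := eqVneq (sin (om / 2 * (t - a))) 0.
  have := par_sin ha It; rewrite s0 normr0 mulr0 normr_le0 => /eqP ->.
  by rewrite mulr0.
by rewrite mulfVK.
Qed.

Lemma is_derive_par (a x : R) : is_derive x 1 (par a) (T - 2 * x).
Proof.
have idx := is_derive_idf x.
have d := is_derive_subf (is_derive_mulf idx (is_derive_subf (is_derive_cstf T x) idx))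
  (is_derive_cstf (a * (T - a)) x).
by apply: (is_derive_eq d); ring.
Qed.

Lemma continuous_par a : continuous (par a).
Proof.
by apply: is_derive_continuous => x; eexists; exact: is_derive_par.
Qed.

Lemma continuous_sin_half (a : R) : continuous (fun t => sin (om / 2 * (t - a))).
Proof.
apply: is_derive_continuous => x; eexists.
have := @is_derive_comp_lin _ sin x (om / 2) (- (om / 2 * a)) _ (is_derive_sin _).
by congr is_derive; apply/funext => t; rewrite mulrBr.
Qed.

Lemma quot_L2 a : 0 <= a < T -> L2I (quot a).
Proof.
move=> ha; apply: (@L2_bounded _ _ _ _ _ mI _ (2 * (T / pi) ^+ 2 * pi)) => //.
  apply: measurable_funTS; apply: measurable_funM.
    by apply: continuous_measurable_fun; exact: continuous_par.
  by apply: measurableT_comp; [exact: inv_meas|by apply: continuous_measurable_fun; exact: continuous_sin_half].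
move=> t It; rewrite /quot; have [s0|s0] := eqVneq (sin (om / 2 * (t - a))) 0.
  rewrite s0 invr0 mulr0 normr0; have pi0 := pi_gt0 R.
  by rewrite mulr_ge0 ?(ltW pi0)// mulr_ge0// sqr_ge0.
by rewrite normrM normfV ler_pdivrMr ?normr_gt0//; exact: par_sin.
Qed.

(** Bessel's inequality makes the squared coefficients summable. *)
Lemma cvg_coef f : L2I f -> (fcos f k @[k --> \oo] --> (0 : R)) /\ (fsin f k @[k --> \oo] --> (0 : R)).
Proof.
move=> f2; pose u k := fcos f k * fcos f k + fsin f k * fsin f k.
have u0 k : 0 <= u k by rewrite /u addr_ge0// -expr2 sqr_ge0.
have cu : cvgn (series u).
  apply: nondecreasing_is_cvgn.
    by apply/nondecreasing_seqP => n; rewrite -subr_ge0 /series /= big_nat_recr//= addrAC subrr add0r.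
  exists (u 0%N + 2 / T * \int[leb]_(t in I) (f t ^+ 2)) => _ [n _ <-].
  apply: (@le_trans _ _ (u 0%N + \sum_(1 <= k < n) u k)).
    case: n => [|n]; first by rewrite /series /= !big_geq// addr0.
    by rewrite /series /= big_nat_recl// big_add1.
  rewrite lerD2l -(ler_pM2l (divr_gt0 T0 (ltr0n R 2))) mulrA.
  have -> : T / 2 * (2 / T) = 1 by field; rewrite gt_eqF.
  by rewrite mul1r; exact: bessel.
have cu0 := cvg_series_cvg_0 cu.
have sq : Num.sqrt (u k) @[k --> \oo] --> (0 : R).
  rewrite -[X in _ --> X]sqrtr0; apply: continuous_cvg => //; exact: sqrt_continuous.
split.
  apply: (@squeeze_cvgr _ _ _ _ (fun k => - Num.sqrt (u k)) (fun k => Num.sqrt (u k))) => //.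
    apply: nearW => k; rewrite -ler_norml -sqrtr_sqr ler_sqrt ?u0// /u expr2 lerDl -expr2 sqr_ge0//.
  by rewrite -oppr0; exact: cvgN.
apply: (@squeeze_cvgr _ _ _ _ (fun k => - Num.sqrt (u k)) (fun k => Num.sqrt (u k))) => //.
  apply: nearW => k; rewrite -ler_norml -sqrtr_sqr ler_sqrt ?u0// /u [leRHS]addrC expr2 lerDl -expr2 sqr_ge0//.
by rewrite -oppr0; exact: cvgN.
Qed.

(** Expanding the sine of [N om t + (om / 2 (t - a) - N om a)] expresses the
    integral through the coefficients of order [N] of [f] times a cosine and
    [f] times a sine of the half angle, with bounded factors. *)
Lemma riemann_lebesgue f (a : R) : L2I f ->
  (fun N => \int[leb]_(t in I) (f t * sin ((N%:R + 2^-1) * om * (t - a)))) @ \oo --> (0 : R).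
Proof.
move=> f2.
pose c t := cos (om / 2 * (t - a)); pose s t := sin (om / 2 * (t - a)).
have cont_c : continuous c.
  apply: is_derive_continuous => x; eexists.
  have := @is_derive_comp_lin _ cos x (om / 2) (- (om / 2 * a)) _ (is_derive_cos _).
  by congr is_derive; apply/funext => t; rewrite /c mulrBr.
have c2 : L2I (fun t => c t * f t).
  apply: (@L2_bmul _ _ _ _ _ mI _ _ 1) => //; last by move=> t _; exact: cos_max.
  by apply: measurable_funTS; exact: continuous_measurable_fun.
have s2 : L2I (fun t => s t * f t).
  apply: (@L2_bmul _ _ _ _ _ mI _ _ 1) => //; last by move=> t _; exact: sin_max.
  by apply: measurable_funTS; apply: continuous_measurable_fun; exact: continuous_sin_half.
have [cc cs] := cvg_coef c2; have [sc ss] := cvg_coef s2.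
pose E N := T / 2 * (cos (N%:R * om * a) * fsin (fun t => c t * f t) N
   - sin (N%:R * om * a) * fcos (fun t => c t * f t) N
   + (cos (N%:R * om * a) * fcos (fun t => s t * f t) N
   + sin (N%:R * om * a) * fsin (fun t => s t * f t) N)).
rewrite (_ : (fun N => _) = E); last first.
  apply/funext => N; rewrite /E.
  have i1 := L2_mul mI c2 (L2_sinM (N%:R * om)).
  have i2 := L2_mul mI c2 (L2_cosM (N%:R * om)).
  have i3 := L2_mul mI s2 (L2_cosM (N%:R * om)).
  have i4 := L2_mul mI s2 (L2_sinM (N%:R * om)).
  pose al := cos (N%:R * om * a); pose be := sin (N%:R * om * a).
  rewrite -/al -/be.
  rewrite (@eq_Rint _ (measurableTypeR R) _ leb I _ (fun t =>
   (al * (c t * f t * S N t) + - be * (c t * f t * C N t)) +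
   (al * (s t * f t * C N t) + be * (s t * f t * S N t)))); last first.
    move=> t _; have -> : (N%:R + 2^-1) * om * (t - a) =
        (N%:R * om * t - N%:R * om * a) + om / 2 * (t - a) by field.
    by rewrite sinD sinB cosB -/al -/be -/(c t) -/(s t); ring.
  have j1 := intRD mI (intRZ mI al i1) (intRZ mI (- be) i2).
  have j2 := intRD mI (intRZ mI al i3) (intRZ mI be i4).
  by rewrite (RintegralD mI j1 j2) (RintL al (- be) i1 i2) (RintL al be i3 i4) !Rint_fcos !Rint_fsin; ring.
have bd (g h : nat -> R) : (forall n, `|g n| <= 1) -> h @ \oo --> (0 : R) ->
    (fun n => g n * h n) @ \oo --> (0 : R).
  move=> g1 h0; have h0' : (fun n => `|h n|) @ \oo --> (0 : R).
    by rewrite -[X in _ --> X](normr0 R); apply: cvg_norm.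
  apply: (@squeeze_cvgr _ _ _ _ (fun k => - `|h k|) (fun k => `|h k|)) => //.
    by apply: nearW => k; rewrite -ler_norml normrM ler_piMl.
  by rewrite -oppr0; exact: cvgN.
rewrite -[X in _ --> X](mulr0 (T / 2)); apply: cvgM; first exact: cvg_cst.
rewrite -[X in _ --> X](addr0 0); apply: cvgD.
  rewrite -[X in _ --> X](subr0 0); apply: cvgB; apply: bd => //.
  - by move=> n; exact: cos_max.
  - by move=> n; exact: sin_max.
rewrite -[X in _ --> X](addr0 0); apply: cvgD; apply: bd => //.
- by move=> n; exact: cos_max.
- by move=> n; exact: sin_max.
Qed.

Lemma dirichlet N (u : R) :
  2 * sin (om / 2 * u) * (\sum_(1 <= k < N.+1) cos (k%:R * om * u)) =
  sin ((N%:R + 2^-1) * om * u) - sin (om / 2 * u).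
Proof.
elim: N => [|N IH].
  by rewrite big_geq// mulr0 add0r [2^-1 * om]mulrC subrr.
rewrite big_nat_recr//= mulrDr IH.
have -> : (N.+1%:R + 2^-1) * om * u = N.+1%:R * om * u + om / 2 * u by ring.
have -> : (N%:R + 2^-1) * om * u = N.+1%:R * om * u - om / 2 * u.
  by rewrite -(natr1 N); field.
by rewrite !sinD sinN cosN; ring.
Qed.

Lemma parI (a : R) : \int[leb]_(t in I) par a t = T ^+ 3 / 6 - a * (T - a) * T.
Proof.
have H (x : R) : is_derive x 1 (fun t : R => T / 2 * (t * t) + - (1 / 3) * (t * (t * t)) + - (a * (T - a)) * t) (par a x).
  have idx := is_derive_idf x; have dd := is_derive_mulf idx idx.
  have d := is_derive_addf (is_derive_addf (is_derive_scalef (T / 2) dd)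
    (is_derive_scalef (- (1 / 3)) (is_derive_mulf idx dd))) (is_derive_scalef (- (a * (T - a))) idx).
  apply: (is_derive_eq d).
  by rewrite /par; field.
by rewrite (Rint_FTC T0 (@continuous_par a) H); field.
Qed.

Lemma par0cos k : (0 < k)%N ->
  \int[leb]_(t in I) (par 0 t * C k t) = - (2 * T) / (k%:R * om) ^+ 2.
Proof.
move=> k0; have m0 := freq_gt0 k0; set m := k%:R * om in m0 *.
have H (x : R) : is_derive x 1 (fun t : R => m^-1 * (par 0 t * sin (m * t)) +
   ((m ^+ 2)^-1 * ((T - 2 * t) * cos (m * t)) + 2 / m ^+ 3 * sin (m * t))) (par 0 x * cos (m * x)).
  have idx := is_derive_idf x.
  have d := is_derive_addf
    (is_derive_scalef (m^-1) (is_derive_mulf (is_derive_par 0 x) (is_derive_sinM m x)))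
    (is_derive_addf (is_derive_scalef (m ^+ 2)^-1 (is_derive_mulf
       (is_derive_subf (is_derive_cstf T x) (is_derive_scalef 2 idx)) (is_derive_cosM m x)))
     (is_derive_scalef (2 / m ^+ 3) (is_derive_sinM m x))).
  apply: (is_derive_eq d).
  by rewrite /par; field; rewrite gt_eqF.
have cc : continuous (fun t => par 0 t * cos (m * t)).
  by move=> x; apply: continuousM; [exact: continuous_par|exact: continuous_cosM].
rewrite (Rint_FTC T0 cc H) mulr0 sin0 cos0 /m cos_freqT sin_freqT -/m /par.
by field; rewrite gt_eqF.
Qed.

Lemma par0sin k : (0 < k)%N -> \int[leb]_(t in I) (par 0 t * S k t) = 0.
Proof.
move=> k0; have m0 := freq_gt0 k0; set m := k%:R * om in m0 *.
have H (x : R) : is_derive x 1 (fun t : R => - m^-1 * (par 0 t * cos (m * t)) +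
   ((m ^+ 2)^-1 * ((T - 2 * t) * sin (m * t)) + - (2 / m ^+ 3) * cos (m * t))) (par 0 x * sin (m * x)).
  have idx := is_derive_idf x.
  have d := is_derive_addf
    (is_derive_scalef (- m^-1) (is_derive_mulf (is_derive_par 0 x) (is_derive_cosM m x)))
    (is_derive_addf (is_derive_scalef (m ^+ 2)^-1 (is_derive_mulf
       (is_derive_subf (is_derive_cstf T x) (is_derive_scalef 2 idx)) (is_derive_sinM m x)))
     (is_derive_scalef (- (2 / m ^+ 3)) (is_derive_cosM m x))).
  apply: (is_derive_eq d).
  by rewrite /par; field; rewrite gt_eqF.
have cc : continuous (fun t => par 0 t * sin (m * t)).
  by move=> x; apply: continuousM; [exact: continuous_par|exact: continuous_sinM].
rewrite (Rint_FTC T0 cc H) mulr0 sin0 cos0 /m cos_freqT sin_freqT -/m /par.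
by field; rewrite gt_eqF.
Qed.

Lemma cosBM k (a t : R) : cos (k%:R * om * (t - a)) =
  cos (k%:R * om * a) * C k t + sin (k%:R * om * a) * S k t.
Proof. by rewrite mulrBr cosB; ring. Qed.

Lemma par_cosB k (a : R) : (0 < k)%N ->
  \int[leb]_(t in I) (par a t * cos (k%:R * om * (t - a))) =
  - (2 * T) * cos (k%:R * om * a) / (k%:R * om) ^+ 2.
Proof.
move=> k0; have p2 : L2I (par 0) by exact/continuous_L2/continuous_par.
have i1 := L2_mul mI p2 (L2_cosM (k%:R * om)).
have i2 := L2_mul mI p2 (L2_sinM (k%:R * om)).
pose al := cos (k%:R * om * a); pose be := sin (k%:R * om * a).
rewrite (@eq_Rint _ (measurableTypeR R) _ leb I _ (fun t =>
  (al * (par 0 t * C k t) + be * (par 0 t * S k t)) +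
  (- (a * (T - a)) * al * C k t + - (a * (T - a)) * be * S k t))); last first.
  by move=> t _; rewrite cosBM -/al -/be /par; ring.
have j1 := intRD mI (intRZ mI al i1) (intRZ mI be i2).
have j2 := intRD mI (intRZ mI (- (a * (T - a)) * al) (iC k)) (intRZ mI (- (a * (T - a)) * be) (iS k)).
rewrite (RintegralD mI j1 j2) (RintL al be i1 i2) (RintL _ _ (iC k) (iS k)).
rewrite par0cos// par0sin// Rint_C// Rint_S -/al; field.
by rewrite ?gt_eqF ?freq_gt0 ?ltr0n ?omega_gt0.
Qed.

(** The sum is the integral of [par a] against the Dirichlet kernel without its
    constant term; by [dirichlet] that is half the integral in
    [riemann_lebesgue] for the quotient, minus half the integral of [par a]. *)
Lemma dirichlet_cvg (a : R) : 0 <= a < T ->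
  (fun N => \sum_(1 <= k < N.+1) (- (2 * T) * cos (k%:R * om * a) / (k%:R * om) ^+ 2)) @ \oo -->
  - (2^-1 * (T ^+ 3 / 6 - a * (T - a) * T)).
Proof.
move=> ha; have q2 := quot_L2 ha.
have p2 : L2I (par a) by exact/continuous_L2/continuous_par.
have pI := L2_intR mI Ifin p2.
have := riemann_lebesgue a q2 => cv.
rewrite (_ : (fun N => _) = (fun N => 2^-1 * \int[leb]_(t in I) (quot a t * sin ((N%:R + 2^-1) * om * (t - a))) +
   - (2^-1 * (T ^+ 3 / 6 - a * (T - a) * T)))).
  set L := - (_ * _); rewrite -[X in _ --> X]add0r; apply: cvgD; last exact: cvg_cst.
  by rewrite -[X in _ --> X](mulr0 2^-1); apply: cvgM => //; exact: cvg_cst.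
apply/funext => N; rewrite -parI.
transitivity (\sum_(1 <= k < N.+1) \int[leb]_(t in I) (par a t * cos (k%:R * om * (t - a)))).
  rewrite [in LHS]big_nat [in RHS]big_nat; apply: eq_bigr => k /andP[k0 _].
  by rewrite par_cosB.
have ic k : integrableR leb I (fun t => par a t * cos (k%:R * om * (t - a))).
  apply: continuous_intR => x; apply: continuousM; first exact: continuous_par.
  apply: (@is_derive_continuous _ (fun t => cos (k%:R * om * (t - a)))) => y; eexists.
  have := @is_derive_comp_lin _ cos y (k%:R * om) (- (k%:R * om * a)) _ (is_derive_cos _).
  by congr is_derive; apply/funext => t; rewrite mulrBr.
rewrite -Rint_sum//.
rewrite (@eq_Rint _ (measurableTypeR R) _ leb I _ (fun t =>
   2^-1 * (quot a t * sin ((N%:R + 2^-1) * om * (t - a))) + - 2^-1 * par a t)); last first.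
  move=> t It; rewrite -mulr_sumr -{1}(quotK ha It) -[par a t in RHS](quotK ha It).
  have := dirichlet N (t - a); set D := \sum_(1 <= k < N.+1) _.
  set s1 := sin (om / 2 * (t - a)); set s2 := sin ((N%:R + _) * om * _) => h.
  have -> : quot a t * s1 * D = 2^-1 * quot a t * (2 * s1 * D) by field.
  by rewrite h; ring.
have i1 : integrableR leb I (fun t => quot a t * sin ((N%:R + 2^-1) * om * (t - a))).
  apply: L2_mul => //; apply: continuous_L2.
  apply: is_derive_continuous => y; eexists.
  have := @is_derive_comp_lin _ sin y ((N%:R + 2^-1) * om) (- ((N%:R + 2^-1) * om * a)) _ (is_derive_sin _).
  by congr is_derive; apply/funext => t; rewrite mulrBr.
by rewrite (RintL 2^-1 (- 2^-1) i1 pI) mulNr.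
Qed.

Definition step_indic (a : R) : R -> R := \1_(`]-oo, a[%classic : set R).

Lemma step_indicE (a t : R) : step_indic a t = (t < a)%R%:R.
Proof.
rewrite /step_indic indicE; congr (_%:R); congr nat_of_bool.
by apply/idP/idP => [/set_mem|h]; rewrite /= ?in_itv//=; rewrite inE /= in_itv.
Qed.

Lemma step_mul (a : R) (h : R -> R) : 0 < a < T ->
  \int[leb]_(t in I) (step_indic a t * h t) = \int[leb]_(t in `]0, a[%classic) h t.
Proof.
move=> /andP[a0 aT].
have -> : (`]0, a[%classic : set R) = I `&` `]-oo, a[%classic.
  apply/seteqP; split => t /=; rewrite !in_itv /=; first by move=> /andP[-> ta]; rewrite ta (lt_trans ta).
  by move=> [/andP[-> _] ->].
rewrite (@Rintegral_mkcondr _ (measurableTypeR R)); apply: eq_Rint => t It.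
rewrite patchE step_indicE.
by case: ifPn; rewrite ?inE ?notin_setE /= in_itv /= => h'; [rewrite h' mul1r|move/negP/negbTE : h' => ->; rewrite mul0r].
Qed.

(** The coefficients of a step combine, by [sin^2 + (1 - cos)^2 = 2 (1 - cos)],
    into the series evaluated in [dirichlet_cvg]. *)
Lemma step_defect (a : R) N : 0 < a < T -> defect N (step_indic a) (step_indic a) =
  a - a ^+ 2 / T - 4 / T * \sum_(1 <= k < N) ((1 - cos (k%:R * om * a)) / (k%:R * om) ^+ 2).
Proof.
move=> ha; have /andP[a0 aT] := ha.
have F0 : \int[leb]_(t in `]0, a[%classic) (1 : R) = a.
  by rewrite Rintegral_cst// leb_oo// mul1r.
have F1 : \int[leb]_(t in I) step_indic a t = a.
  rewrite -[RHS]F0 -(step_mul (fun=> 1) ha).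
  by apply: eq_Rint => t _; rewrite mulr1.
have F2 : \int[leb]_(t in I) (step_indic a t * step_indic a t) = a.
  rewrite -[RHS]F1; apply: eq_Rint => t _.
  by rewrite step_indicE -natrM mulnb andbb.
rewrite /defect F1 F2 /fpart -expr2; congr (_ - _ - _).
have -> : 4 / T = T / 2 * (8 / T ^+ 2) by field; rewrite gt_eqF.
rewrite -[RHS]mulrA; congr (_ * _); rewrite mulr_sumr big_nat [RHS]big_nat.
apply: eq_bigr => k /andP[k0 _]; have m0 := freq_gt0 k0.
rewrite /fcos /fsin !step_mul//.
set m := k%:R * om in m0 *.
have Hc (x : R) : is_derive x 1 (fun t => m^-1 * sin (m * t)) (cos (m * x)).
  by have := is_derive_scalef m^-1 (is_derive_sinM m x); rewrite mulKf// gt_eqF.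
have Hs (x : R) : is_derive x 1 (fun t => - m^-1 * cos (m * t)) (sin (m * x)).
  by have := is_derive_scalef (- m^-1) (is_derive_cosM m x); rewrite mulrA mulrNN mulVf ?gt_eqF// mul1r.
rewrite (Rint_FTC a0 (@continuous_cosM m) Hc) (Rint_FTC a0 (@continuous_sinM m) Hs).
rewrite !mulr0 sin0 cos0.
have := cos2Dsin2 (m * a); set c := cos (m * a); set s := sin (m * a) => cs.
have -> : 1 - c = 2^-1 * (s ^+ 2 + (1 - c) ^+ 2) by nra.
by field; rewrite !gt_eqF.
Qed.

(** Subtracting [dirichlet_cvg] at [a] from its value at [0] sums the series of
    [step_defect] to exactly the amount that cancels the defect. *)
Lemma step_complete (a : R) : 0 < a < T -> complete (step_indic a).
Proof.
move=> ha; have /andP[a0 aT] := ha.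
pose u k := (1 - cos (k%:R * om * a)) / (k%:R * om) ^+ 2.
have cu : (fun N => \sum_(1 <= k < N.+1) u k) @ \oo --> a * (T - a) / 4.
  have h1 := @dirichlet_cvg a ltac:(by rewrite (ltW a0)).
  have h2 := @dirichlet_cvg 0 ltac:(by rewrite lexx).
  rewrite (_ : a * (T - a) / 4 = (2 * T)^-1 *
    (- (2^-1 * (T ^+ 3 / 6 - a * (T - a) * T)) - - (2^-1 * (T ^+ 3 / 6 - 0 * (T - 0) * T)))); last first.
    by field; rewrite gt_eqF.
  rewrite (_ : (fun N => _) = (fun N => (2 * T)^-1 *
    (\sum_(1 <= k < N.+1) (- (2 * T) * cos (k%:R * om * a) / (k%:R * om) ^+ 2)
     - \sum_(1 <= k < N.+1) (- (2 * T) * cos (k%:R * om * 0) / (k%:R * om) ^+ 2)))).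
    by apply: cvgM; [exact: cvg_cst|exact: cvgB].
  apply/funext => N.
  rewrite -sumrB mulr_sumr big_nat [RHS]big_nat; apply: eq_bigr => k /andP[k0 _].
  have := freq_gt0 k0; rewrite /u mulr0 cos0; set m := k%:R * om => m0.
  by field; rewrite !gt_eqF.
rewrite /complete -(cvg_shiftS (fun N => defect N _ _)).
rewrite (_ : (fun N => _) = (fun N => a - a ^+ 2 / T - 4 / T * \sum_(1 <= k < N.+1) u k)); last first.
  by apply/funext => N; rewrite step_defect.
have h := cvgB (cvg_cst (a - a ^+ 2 / T)) (cvgM (cvg_cst (4 / T)) cu).
have E : a - a ^+ 2 / T - 4 / T * (a * (T - a) / 4) = 0.
  by field; rewrite gt_eqF.
rewrite E in h; exact: h.
Qed.

Lemma cst_complete (c : R) : complete (fun=> c).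
Proof.
rewrite /complete; apply: cvg_near_cst; near=> N.
rewrite /defect !Rint_cstI /fpart big_nat big1 => [|k /andP[k0 _]].
  by rewrite mulr0 subr0; field; rewrite gt_eqF.
have -> : fcos (fun=> c) k = 0.
  by rewrite /fcos (RintegralZl c mI (iC k)) Rint_C// !mulr0.
have -> : fsin (fun=> c) k = 0.
  by rewrite /fsin (RintegralZl c mI (iS k)) Rint_S !mulr0.
by rewrite mulr0 addr0.
Unshelve. all: by end_near.
Qed.

Lemma ray_complete (a : R) : complete (\1_(`]-oo, a[%classic : set R) : R -> R).
Proof.
have [a0|a0] := leP a 0.
  apply: (eq_complete _ (cst_complete 0)) => t /=; rewrite in_itv /= => /andP[t0 _].
  by rewrite -/(step_indic a t) step_indicE ltNge (le_trans a0 (ltW t0)).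
have [aT|aT] := ltP a T; first by apply: step_complete; rewrite a0.
apply: (eq_complete _ (cst_complete 1)) => t /=; rewrite in_itv /= => /andP[_ tT].
by rewrite -/(step_indic a t) step_indicE (lt_le_trans tT aT).
Qed.

Lemma indic_L2 (A : set (measurableTypeR R)) : measurable A -> L2I (\1_A : R -> R).
Proof.
move=> mA; apply: (@L2_bounded _ _ _ _ _ mI _ 1) => //.
by move=> t _; rewrite indicE; case: (_ \in _); rewrite /= ?normr1 ?normr0.
Qed.

(** Dynkin's lemma on the intersection-stable class of rays: completeness is
    stable under complements, and under disjoint countable unions by dominated
    convergence. *)
Lemma indic_complete (A : set (measurableTypeR R)) : measurable A -> complete (\1_A : R -> R).
Proof.
pose P := [set A : set (measurableTypeR R) | complete (\1_A : R -> R)].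
move=> mA; suff : P A by [].
move: mA; rewrite RGenInftyO.measurableE => mA.
apply: (@dynkin_induction _ (measurableTypeR R) (@RGenInftyO.G R) P) => //.
- exact: RGenInftyO.measurableE.
- move=> _ _ [a ->] [b ->]; exists (Num.min a b).
  by apply/predeqP => t; rewrite /= !in_itv /= lt_min; split => [[-> ->]//|/andP[-> ->]].
- by apply: (eq_complete _ (cst_complete 1)) => t _; rewrite indicT.
- by move=> _ [a ->]; exact: ray_complete.
- move=> S mS PS.
  have := complete_lin 1 (-1) (L2_cst 1) (indic_L2 mS) (cst_complete 1) PS.
  apply: eq_complete => t _; rewrite !indicE in_setC.
  by case: (t \in S) => /=; ring.
- move=> F mF tF PF.
  have mU n : measurable (\big[setU/set0]_(i < n) F i) by apply: bigsetU_measurable.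
  apply: (@complete_dominated (fun n => \1_(\big[setU/set0]_(i < n) F i))).
  + by apply: indic_L2; exact: bigcup_measurable.
  + by move=> n; exact: indic_L2.
  + elim=> [|n IH].
      by apply: (eq_complete _ (cst_complete 0)) => t _; rewrite big_ord0 indic0.
    have := complete_lin 1 1 (indic_L2 (mU n)) (indic_L2 (mF n)) IH (PF n).
    apply: eq_complete => t _; rewrite big_ord_recr /= !mul1r !indicE in_setU.
    case: (boolP (t \in F n)) => tn; rewrite ?orbT ?orbF ?addr0//.
    rewrite (_ : (t \in _) = false) ?add0r//; apply/negbTE; rewrite notin_setE -bigcup_mkord => -[i /= ni Fit].
    move/trivIsetP : tF => /(_ i n Logic.I Logic.I); rewrite neq_ltn ni => /(_ isT) /seteqP[+ _].
    by move=> /(_ t); apply; split => //; exact/set_mem.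
  + move=> n t _; rewrite !indicE; case: (boolP (t \in \bigcup_k F k)) => h.
      by case: (_ \in _) => /=; rewrite ?subrr ?subr0 ?normr0 ?normr1.
    rewrite (_ : (t \in _) = false) ?subr0//; apply/negbTE; move: h; rewrite !notin_setE => h.
    by rewrite -bigcup_mkord => -[i _ Fi]; apply: h; exists i.
  + move=> t _; apply: cvg_near_cst.
    case: (boolP (t \in \bigcup_k F k)) => [tU|h].
      have [i _ Fi] := set_mem tU; near=> n; rewrite !indicE tU mem_set//.
      rewrite -bigcup_mkord; exists i => //=; near: n; exact: nbhs_infty_gt.
    apply: nearW => n; rewrite !indicE (negbTE h) (_ : (t \in _) = false)//; apply/negbTE.
    move: h; rewrite !notin_setE => h.
    by rewrite -bigcup_mkord => -[i _ Fi]; apply: h; exists i.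
Unshelve. all: by end_near.
Qed.

Import HBNNSimple.

Lemma nnsfun_complete (f : {nnsfun (measurableTypeR R) >-> R}) : L2I f /\ complete f.
Proof.
have -> : (f : R -> R) = (fun t => \sum_(y <- finmap.enum_fset (fset_set (range f))) (y * \1_(f @^-1` [set y]) t)).
  by apply/funext => t; rewrite fimfunE fsbig_finite.
elim: (finmap.enum_fset (fset_set (range f))) => [|y s [IH2 IHc]].
  split; first by apply: (eq_L2 _ _ (L2_cst 0)) => // t _; rewrite big_nil.
  by apply: (eq_complete _ (cst_complete 0)) => t _; rewrite big_nil.
have my : measurable (f @^-1` [set y]) by [].
split.
  apply: (eq_L2 _ _ (L2D mI (L2Z mI y (indic_L2 my)) IH2)) => // t _.
  by rewrite big_cons.
have := complete_lin y 1 (indic_L2 my) IH2 (indic_complete my) IHc.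
by apply: eq_complete => t _; rewrite big_cons mul1r.
Qed.

Lemma nonneg_complete f : (forall t, 0 <= f t) -> L2I f -> complete f.
Proof.
move=> f0 f2; have mf : measurable_fun I (EFin \o f) by apply/measurable_EFinP; case: f2.
pose g := nnsfun_approx mI mf.
have cg (t : R) : I t -> g ^~ t @ \oo --> f t.
  move=> It; have := @cvg_nnsfun_approx _ _ _ _ mI _ mf (fun t _ => f0 t) t It.
  by move/fine_cvg.
apply: (@complete_dominated (fun n => g n)) => //.
- by move=> n; have [] := nnsfun_complete (g n).
- by move=> n; have [] := nnsfun_complete (g n).
- move=> n t It; have gt : g n t <= f t.
    have nd : nondecreasing_seq (g ^~ t).
      by move=> a b ab; have /lefP := @nd_nnsfun_approx _ _ _ _ mI _ mf a b ab; exact.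
    by rewrite -(cvg_lim _ (cg t It))//; apply: nondecreasing_cvgn_le => //; apply/cvg_ex; exists (f t); exact: cg.
  rewrite !ger0_norm ?subr_ge0 ?f0// lerBlDr lerDl; exact: fun_ge0.
Qed.

Lemma L2_complete f : L2I f -> complete f.
Proof.
move=> f2.
have [mf _] := f2.
have p2 : L2I (f ^\+).
  apply: (L2_le mI _ _ f2) => [|t _]; first exact: measurable_funrpos.
  by rewrite /funrpos; have [h|h] := leP (f t) 0; rewrite ?normr0.
have n2 : L2I (f ^\-).
  apply: (L2_le mI _ _ f2) => [|t _]; first exact: measurable_funrneg.
  by rewrite /funrneg; have [h|h] := leP (- f t) 0; rewrite ?normr0 ?normrN.
have := complete_lin 1 (-1) p2 n2 (nonneg_complete (fun t => funrpos_ge0 f t) p2) (nonneg_complete (fun t => funrneg_ge0 f t) n2).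
apply: eq_complete => t _; rewrite mul1r mulN1r.
by have := congr1 (@^~ t) (funrposBneg f).
Qed.

Lemma parseval f g : L2I f -> L2I g ->
  (fun N => fpart N f g) @ \oo --> \int[leb]_(t in I) (f t * g t) -
    (\int[leb]_(t in I) f t) * (\int[leb]_(t in I) g t) / T.
Proof.
move=> f2 g2.
have d0 := complete_cross f2 g2 (L2_complete f2) (L2_complete g2).
set L := _ - _; rewrite -[X in _ --> X](subr0 L).
rewrite (_ : (fun N => _) = (fun N => L - defect N f g)).
  by apply: cvgB => //; exact: cvg_cst.
by apply/funext => N; rewrite /defect -/L opprB addrCA subrr addr0.
Qed.

(** A bound uniform in [N]: it dominates the partial sums when Parseval's
    identity is integrated over the space variable. *)
Lemma fpart_bound N f g : L2I f -> L2I g ->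
  `|fpart N f g| <= \int[leb]_(t in I) (f t ^+ 2) + \int[leb]_(t in I) (g t ^+ 2).
Proof.
move=> f2 g2; apply: (@le_trans _ _ (fpart N f f + fpart N g g)); last first.
  by apply: lerD; exact: bessel.
rewrite /fpart -mulrDr normrM [`|T / 2|]ger0_norm; last by rewrite divr_ge0// ltW.
rewrite ler_pM2l ?divr_gt0// -big_split /= (le_trans (ler_norm_sum _ _ _))//.
by apply: ler_sum => k _; exact: norm_dot2_le.
Qed.

End trigonometric_system.

(** * Smooth functions and test functions *)

Section smooth_functions.
Context {R : realType}.

Section Ck.
Context {V : normedModType R}.
Implicit Types (f g : V -> R) (k : nat).

Lemma CkW k f : Ck k.+1 f -> Ck k f.
Proof.
elim: k f => [f []//|k IH f [cf Df]]; split => // v.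
by have [df Dv] := Df v; split => //; exact: IH.
Qed.

Lemma Ck_cst k (c : R) : Ck k (fun _ : V => c).
Proof.
elim: k c => [|k IH] c; first exact: cst_continuous.
split=> [|v]; first exact: cst_continuous.
split=> [x|]; first exact: derivable_cst.
by under eq_fun do rewrite derive_cst; exact: IH.
Qed.

Lemma CkD k f g : Ck k f -> Ck k g -> Ck k (fun x => f x + g x).
Proof.
elim: k f g => [f g cf cg|k IH f g [cf Df] [cg Dg]].
  by move=> x; apply: continuousD; [exact: cf|exact: cg].
split=> [x|v]; first by apply: continuousD; [exact: cf|exact: cg].
have [df Cf] := Df v; have [dg Cg] := Dg v.
split=> [x|]; first exact: derivableD.
rewrite (_ : (fun x => _) = (fun x => 'D_v f x + 'D_v g x)); first exact: IH.
by apply/funext => x; rewrite -deriveD.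
Qed.

Lemma CkM k f g : Ck k f -> Ck k g -> Ck k (fun x => f x * g x).
Proof.
elim: k f g => [f g cf cg|k IH f g Kf Kg].
  by move=> x; apply: continuousM; [exact: cf|exact: cg].
have fk := CkW Kf; have gk := CkW Kg.
move: Kf Kg => [cf Df] [cg Dg].
split=> [x|v]; first by apply: continuousM; [exact: cf|exact: cg].
have [df Cf] := Df v; have [dg Cg] := Dg v.
split=> [x|]; first exact: derivableM.
rewrite (_ : (fun x => _) = (fun x => f x * 'D_v g x + g x * 'D_v f x)).
  by apply: CkD; exact: IH.
by apply/funext => x; have := deriveM (df x) (dg x).
Qed.

Lemma CkZ k (c : R) f : Ck k f -> Ck k (fun x => c * f x).
Proof. by move=> fk; apply: CkM => //; exact: Ck_cst. Qed.

Lemma CkB k f g : Ck k f -> Ck k g -> Ck k (fun x => f x - g x).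
Proof.
move=> fk gk; have := CkD fk (CkZ (-1) gk).
by congr Ck; apply/funext => x; rewrite mulN1r.
Qed.

Lemma CkV k f : (forall x, f x != 0) -> Ck k f -> Ck k (fun x => (f x)^-1).
Proof.
move=> f0; elim: k => [cf|k IH Kf].
  by move=> x; apply: continuousV => //; exact: cf.
have fk := IH (CkW Kf); move: Kf => [cf Df].
split=> [x|v]; first by apply: continuousV => //; exact: cf.
have [df Cf] := Df v.
split=> [x|]; first exact: derivableV.
rewrite (_ : (fun x => _) = (fun x => -1 * (((f x)^-1 * (f x)^-1) * 'D_v f x))).
  by apply: CkZ; apply: CkM => //; exact: CkM.
apply/funext => x; rewrite (deriveV (f0 x) (df x)) /GRing.scale /=.
by rewrite -exprVn expr2 mulN1r mulNr.
Qed.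

Lemma Ck_prod k n (f : 'I_n -> V -> R) : (forall i, Ck k (f i)) ->
  Ck k (fun x => \prod_(i < n) f i x).
Proof.
elim: n f => [f _|n IH f fk].
  by under eq_fun do rewrite big_ord0; exact: Ck_cst.
by under eq_fun do rewrite big_ord_recl; apply: CkM => //; exact: IH.
Qed.

End Ck.

Section Ck_comp.
(* [l] is the linear part of the affine map [L]. *)
Context {V W : normedModType R} (L l : V -> W).
Hypothesis cL : continuous L.
Hypothesis Ll : forall (t : R) v x, L (t *: v + x) = t *: l v + L x.

Lemma derive_comp_affine (f : W -> R) v x : 'D_v (f \o L) x = 'D_(l v) f (L x).
Proof. by rewrite /derive /=; under eq_fun do rewrite /shift /= Ll. Qed.

Lemma derivable_comp_affine (f : W -> R) v x :
  derivable f (L x) (l v) -> derivable (f \o L) x v.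
Proof.
have E : (fun h : R => h^-1 *: (((f \o L) \o shift x) (h *: v) - (f \o L) x)) =
    (fun h : R => h^-1 *: ((f \o shift (L x)) (h *: l v) - f (L x))).
  by apply/funext => h; rewrite /shift /= Ll.
by rewrite /derivable E.
Qed.

Lemma Ck_comp_affine k (f : W -> R) : Ck k f -> Ck k (fun x => f (L x)).
Proof.
elim: k f => [f cf x|k IH f [cf Df]].
  by apply: continuous_comp; [exact: cL|exact: cf].
split=> [x|v]; first by apply: continuous_comp; [exact: cL|exact: cf].
have [df Cf] := Df (l v); split=> [x|]; first exact: derivable_comp_affine.
rewrite (_ : (fun x => _) = (fun x => 'D_(l v) f (L x))); first exact: (IH (fun y => 'D_(l v) f y)).
by apply/funext => x; rewrite -derive_comp_affine.
Qed.

End Ck_comp.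

Section one_dimensional.
Implicit Types (f : R -> R) (k n : nat).

Lemma derive_dir1 f (x v : R) : derivable f x 1 -> derivable f x v /\ 'D_v f x = v * 'D_1 f x.
Proof.
move=> /derivable1_diffP df; split; first exact: diff_derivable.
by rewrite !deriveE// -[v in LHS]mulr1 -[v * 1]/(v *: 1) linearZ.
Qed.

Lemma CkS_is_derive k f f' : (forall x : R, is_derive x 1 f (f' x)) -> Ck k f' -> Ck k.+1 f.
Proof.
move=> ff' Cf'; split=> [|v].
  by apply: is_derive_continuous => x; exists (f' x).
have h x : derivable f x v /\ 'D_v f x = v * f' x.
  by have [df <-] := ff' x; exact: derive_dir1.
split=> [x|]; first by have [] := h x.
rewrite (_ : (fun x => _) = (fun x => v * f' x)); first exact: CkZ.
by apply/funext => x; have [] := h x.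
Qed.

Definition smooth f := forall k, Ck k f.

Lemma smooth_trig (m : R) : smooth (fun t => cos (m * t)) /\ smooth (fun t => sin (m * t)).
Proof.
suff h k : Ck k (fun t => cos (m * t)) /\ Ck k (fun t => sin (m * t)).
  by split=> k; have [] := h k.
elim: k => [|k [IHc IHs]]; first by split; [exact: continuous_cosM|exact: continuous_sinM].
split.
  by apply: (CkS_is_derive (fun x => is_derive_cosM m x)); exact: CkZ.
by apply: (CkS_is_derive (fun x => is_derive_sinM m x)); exact: CkZ.
Qed.

(** The functions [x^-n exp (- 1 / x)], extended by zero, form a family stable
    under differentiation, so that all of them are smooth by one induction on
    the order. *)
Definition flat n (x : R) : R := if 0 < x then x^-1 ^+ n * expR (- x^-1) else 0.

Lemma flat_ge0 n x : 0 <= flat n x.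
Proof.
rewrite /flat; case: ifPn => // x0.
by rewrite mulr_ge0 ?expR_ge0// exprn_ge0// invr_ge0 ltW.
Qed.

Lemma flat_gt0 n x : 0 < x -> 0 < flat n x.
Proof. by move=> x0; rewrite /flat x0 mulr_gt0 ?expR_gt0// exprn_gt0// invr_gt0. Qed.

Lemma flat_le0 n x : x <= 0 -> flat n x = 0.
Proof. by move=> x0; rewrite /flat ltNge x0. Qed.

(** The term of order [n + 1] of the exponential series at [1 / x]; applied at
    [n + 1], the bound gives the derivative zero of [flat n] at the origin. *)
Lemma flat_bound n x : flat n x <= n.+1`!%:R * `|x|.
Proof.
rewrite /flat; case: ifPn => [x0|_]; last by rewrite mulr_ge0.
rewrite gtr0_norm// expRN; set u := x^-1.
have u0 : 0 < u by rewrite invr_gt0.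
have h : u ^+ n.+1 / n.+1`!%:R <= expR u.
  by apply: le_trans (expR_ge1Dxn n (ltW u0)); rewrite lerDr.
rewrite -[x]invrK -/u ler_pdivlMr// mulrAC -exprSr ler_pdivrMr ?expR_gt0//.
by rewrite mulrC -ler_pdivrMr// ltr0n fact_gt0.
Qed.

Lemma is_derive_flat n (x : R) : is_derive x 1 (flat n) (flat n.+2 x - n%:R * flat n.+1 x).
Proof.
have [x0|x0|->] := ltgtP x 0.
- rewrite !flat_le0 ?ltW// mulr0 subr0.
  apply: (near_eq_is_derive _ (is_derive_cstf 0 x)).
  by near=> y; rewrite flat_le0// ltW//; near: y; exact: lt_nbhsl.
- have xn0 : x != 0 by rewrite gt_eqF.
  have dV : is_derive x 1 (fun y : R => y^-1) (- x ^- 2 * 1).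
    exact: (@is_deriveV R id x 1 1).
  have dN : is_derive x 1 (fun y : R => - y^-1) (x^-1 ^+ 2).
    by apply: (is_derive_eq (is_deriveN dV)); rewrite mulr1 opprK exprVn.
  have dE : is_derive x 1 (fun y : R => expR (- y^-1)) (expR (- x^-1) * x^-1 ^+ 2).
    exact: (@is_derive1_comp _ expR (fun y => - y^-1) x _ _ (is_derive_expR _) dN).
  have dX : is_derive x 1 (fun y : R => (y^-1) ^+ n) (- (n%:R * x^-1 ^+ n.+1)).
    elim: n => [|n IH].
      by rewrite mul0r oppr0; exact: is_derive_cst.
    have := is_derive_mulf dV IH; congr is_derive.
      by apply/funext => y; rewrite exprS.
    rewrite -exprVn mulr1 -natr1 !exprS; ring.
  have E : \near x, (fun y : R => (y^-1) ^+ n * expR (- y^-1)) x = flat n x.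
    near=> y; rewrite /flat ifT//; near: y; exact: lt_nbhsr.
  apply: (is_derive_eq (near_eq_is_derive E (is_derive_mulf dX dE))).
  by rewrite /flat x0 !exprS; ring.
- rewrite !flat_le0// mulr0 subr0.
  have cv : h^-1 *: ((flat n \o shift 0) (h *: 1) - flat n 0) @[h --> 0^'] --> (0 : R).
    have cb : (fun h : R => n.+2`!%:R * `|h|) @ 0^' --> (0 : R).
      rewrite -[X in _ --> X](mulr0 n.+2`!%:R); apply: cvgM; first exact: cvg_cst.
      rewrite -[X in _ --> X](normr0 R); apply: cvg_norm; exact: nbhs_dnbhs.
    apply: (@squeeze_cvgr _ _ _ _ (fun h => - (n.+2`!%:R * `|h|)) (fun h => n.+2`!%:R * `|h|)) => //.
      near=> h; rewrite -ler_norml.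
      have -> : h^-1 *: ((flat n \o shift 0) (h *: 1) - flat n 0) = h^-1 * flat n h.
        by rewrite /= /shift /= addr0 [h *: 1]mulr1 (flat_le0 n (lexx 0)) subr0.
      apply: le_trans (flat_bound n.+1 h); rewrite normrM [`|flat _ _|]ger0_norm ?flat_ge0// /flat.
      case: ifPn => h0; last by rewrite mulr0.
      by rewrite gtr0_norm ?invr_gt0// exprS mulrA.
    have cbN := cvgN cb; rewrite oppr0 in cbN; exact: cbN.
  by apply: DeriveDef; [apply/cvg_ex; exists 0|exact: cvg_lim].
Unshelve. all: by end_near.
Qed.

Lemma flat_smooth n : smooth (flat n).
Proof.
move=> k; elim: k n => [|k IH] n.
  by apply: is_derive_continuous => x; eexists; exact: is_derive_flat.
by apply: (CkS_is_derive (is_derive_flat n)); apply: CkB => //; exact: CkZ.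
Qed.

Lemma smooth_affine (m c : R) f : smooth f -> smooth (fun t => f (m * t + c)).
Proof.
move=> sf k; apply: (@Ck_comp_affine R R (fun t => m * t + c) (fun t => m * t)) => //.
  apply: is_derive_continuous => x; exists (m * 1).
  by have := is_derive_addf (is_derive_scalef m (is_derive_idf x)) (is_derive_cstf c x); rewrite addr0.
by move=> t v x; rewrite /GRing.scale /=; ring.
Qed.

Definition smoothstep (x : R) : R := flat 0 x / (flat 0 x + flat 0 (1 - x)).

Lemma smoothstep_den x : 0 < flat 0 x + flat 0 (1 - x).
Proof.
have [x0|x0] := ltP 0 x; first by rewrite ltr_wpDr ?flat_ge0 ?flat_gt0.
by rewrite ltr_wpDl ?flat_ge0// flat_gt0// subr_gt0 (le_lt_trans x0).
Qed.

Lemma smoothstep_smooth : smooth smoothstep.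
Proof.
move=> k; apply: CkM; first exact: flat_smooth.
apply: CkV; first by move=> x; rewrite gt_eqF// smoothstep_den.
apply: CkD; first exact: flat_smooth.
have := smooth_affine (-1) 1 (flat_smooth 0) k.
by congr Ck; apply/funext => x; rewrite mulN1r addrC.
Qed.

Lemma smoothstep0 x : x <= 0 -> smoothstep x = 0.
Proof. by move=> x0; rewrite /smoothstep flat_le0// mul0r. Qed.

Lemma smoothstep1 x : 1 <= x -> smoothstep x = 1.
Proof.
move=> x1; rewrite /smoothstep (flat_le0 0 (x := 1 - x)) ?subr_le0// addr0 divff//.
by rewrite gt_eqF// flat_gt0// (lt_le_trans _ x1).
Qed.

Lemma smoothstep_ge0 x : 0 <= smoothstep x.
Proof. by rewrite divr_ge0 ?flat_ge0// ltW// smoothstep_den. Qed.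

Lemma smoothstep_le1 x : smoothstep x <= 1.
Proof. by rewrite ler_pdivrMr ?smoothstep_den// mul1r lerDl flat_ge0. Qed.

(** Supported in [[a + 1/(n+1), b - 1/(n+1)]] and equal to [1] between
    [a + 2/(n+1)] and [b - 2/(n+1)]. *)
Definition cutoff (a b : R) n (t : R) : R :=
  smoothstep (n.+1%:R * t + - (n.+1%:R * a + 1)) *
  smoothstep (- n.+1%:R * t + (n.+1%:R * b - 1)).

Lemma cutoff_smooth a b n : smooth (cutoff a b n).
Proof. by move=> k; apply: CkM; exact: smooth_affine smoothstep_smooth k. Qed.

Lemma cutoff_bound a b n t : 0 <= cutoff a b n t <= 1.
Proof.
rewrite mulr_ge0 ?smoothstep_ge0//=.
by rewrite mulr_ile1 ?smoothstep_ge0 ?smoothstep_le1.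
Qed.

Lemma cutoff_support a b n t :
  ~ (a + n.+1%:R^-1 <= t <= b - n.+1%:R^-1) -> cutoff a b n t = 0.
Proof.
have n0 : 0 < n.+1%:R :> R by rewrite ltr0n.
move=> /negP; rewrite negb_and -!ltNge => /orP[h|h]; rewrite /cutoff.
  rewrite (@smoothstep0 (n.+1%:R * t + _)) ?mul0r//.
  rewrite subr_le0 -(ler_pM2l (x := n.+1%:R^-1)) ?invr_gt0// mulrDr !mulKf ?gt_eqF// mulr1.
  exact: ltW.
rewrite (@smoothstep0 (- n.+1%:R * t + _)) ?mulr0//.
rewrite mulNr addrC subr_le0 -(ler_pM2l (x := n.+1%:R^-1)) ?invr_gt0// mulrBr !mulKf ?gt_eqF// mulr1.
exact: ltW.
Qed.

Lemma cutoff_cvg a b t : cutoff a b ^~ t @ \oo --> ((t \in `]a, b[)%:R : R).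
Proof.
apply: cvg_near_cst; rewrite in_itv /=.
case: (boolP (_ < t < _)) => [/andP[at_ tb]|h]; last first.
  apply: nearW => n; apply: cutoff_support => /andP[h1 h2]; move/negP: h; apply.
  have n0 : 0 < n.+1%:R^-1 :> R by rewrite invr_gt0 ltr0n.
  by rewrite (lt_le_trans _ h1) ?ltrDl// (le_lt_trans h2)// ltrBlDr ltrDl.
have h1 : \forall n \near \oo, 2 <= (t - a) * n.+1%:R.
  near=> n; rewrite mulrC -ler_pdivrMr ?subr_gt0//; apply: ltW.
  near: n; have [M _ HM] := @nbhs_infty_gtr R (2 / (t - a)).
  by exists M => // n Mn; have /= := HM n Mn => /lt_trans; apply; rewrite ltr_nat.
have h2 : \forall n \near \oo, 2 <= (b - t) * n.+1%:R.
  near=> n; rewrite mulrC -ler_pdivrMr ?subr_gt0//; apply: ltW.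
  near: n; have [M _ HM] := @nbhs_infty_gtr R (2 / (b - t)).
  by exists M => // n Mn; have /= := HM n Mn => /lt_trans; apply; rewrite ltr_nat.
near=> n.
have g1 : 2 <= (t - a) * n.+1%:R by near: n.
have g2 : 2 <= (b - t) * n.+1%:R by near: n.
by rewrite /cutoff !smoothstep1 ?mulr1//; lra.
Unshelve. all: by end_near.
Qed.

End one_dimensional.
End smooth_functions.

Section test_functions.
Context {R : realType}.

Definition box {d : nat} (a b : 'rV[R]_d) : set 'rV[R]_d :=
  [set x | forall i, a ord0 i < x ord0 i < b ord0 i].

Definition box_cutoff {d : nat} (a b : 'rV[R]_d) n (x : 'rV[R]_d) : R :=
  \prod_(i < d) cutoff (a ord0 i) (b ord0 i) n (x ord0 i).

Lemma box_cutoff_test d (Om : set 'rV[R]_d) (a b : 'rV[R]_d) n :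
  box a b `<=` Om -> test_function Om (box_cutoff a b n).
Proof.
move=> abO; split=> [k|].
  apply: Ck_prod => i.
  apply: (@Ck_comp_affine R 'rV[R]_d R (fun x => x ord0 i) (fun x => x ord0 i)).
  - exact: coord_continuous.
  - by move=> t v x; rewrite !mxE.
  - exact: cutoff_smooth.
exists [set x : 'rV[R]_d | forall i, `[a ord0 i + n.+1%:R^-1, b ord0 i - n.+1%:R^-1]%classic (x ord0 i)].
have n0 : 0 < n.+1%:R^-1 :> R by rewrite invr_gt0 ltr0n.
split.
- apply: (@rV_compact R d (fun i => `[a ord0 i + n.+1%:R^-1, b ord0 i - n.+1%:R^-1]%classic)) => i.
  exact: segment_compact.
- move=> x /= xK; apply: abO => i; have := xK i; rewrite in_itv /= => /andP[h1 h2].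
  by rewrite (lt_le_trans _ h1) ?ltrDl// (le_lt_trans h2)// ltrBlDr ltrDl.
- move=> x /existsNP[i xi]; rewrite /box_cutoff (bigD1 i)//=.
  by rewrite cutoff_support ?mul0r// => h; apply: xi; rewrite /= in_itv.
Qed.

Lemma box_cutoff_bound d (a b : 'rV[R]_d) n x : 0 <= box_cutoff a b n x <= 1.
Proof.
rewrite /box_cutoff; elim/big_ind: _ => [|u v|i _]; rewrite ?ler01 ?lexx//; last first.
  exact: cutoff_bound.
by move=> /andP[u0 u1] /andP[v0 v1]; rewrite mulr_ge0//= mulr_ile1.
Qed.

Lemma cvg_bigprod n (f : 'I_n -> nat -> R) (l : 'I_n -> R) :
  (forall i, f i @ \oo --> l i) ->
  (fun k => \prod_(i < n) f i k) @ \oo --> \prod_(i < n) l i.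
Proof.
elim: n f l => [f l _|n IH f l fl].
  by rewrite big_ord0; under eq_fun do rewrite big_ord0; exact: cvg_cst.
rewrite big_ord_recl; under eq_fun do rewrite big_ord_recl.
by apply: cvgM => //; exact: (IH (fun i => f (lift ord0 i))).
Qed.

Lemma box_cutoff_cvg d (a b : 'rV[R]_d) x :
  box_cutoff a b ^~ x @ \oo --> (\1_(box a b) x : R).
Proof.
have -> : \1_(box a b) x = \prod_(i < d) ((x ord0 i \in `]a ord0 i, b ord0 i[)%:R : R).
  rewrite indicE; case: (boolP (x \in box a b)) => [/set_mem xb|].
    by rewrite big1// => i _; rewrite in_itv /= xb.
  rewrite notin_setE => /existsNP[i xi]; rewrite (bigD1 i)//= in_itv /=.
  by rewrite (_ : (_ < x ord0 i < _) = false) ?mul0r//; apply/negbTE/negP.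
by apply: cvg_bigprod => i; exact: cutoff_cvg.
Qed.

Lemma cutoff_test (T a b : R) n : 0 <= a -> b <= T ->
  test_function (`]0, T[%classic : set R) (cutoff a b n).
Proof.
move=> a0 bT; split; first exact: cutoff_smooth.
exists `[a + n.+1%:R^-1, b - n.+1%:R^-1]%classic; split.
- exact: segment_compact.
- have n0 : 0 < n.+1%:R^-1 :> R by rewrite invr_gt0 ltr0n.
  move=> t /=; rewrite !in_itv /= => /andP[h1 h2].
  by rewrite (lt_le_trans _ h1) ?(le_lt_trans a0) ?ltrDl// (le_lt_trans h2)// (lt_le_trans _ bT)// ltrBlDr ltrDl.
- by move=> t h; apply: cutoff_support => h'; apply: h; rewrite /= in_itv.
Qed.

Lemma test_function_prod d (Om : set 'rV[R]_d) (T : R) psi chi :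
  test_function Om psi -> test_function (`]0, T[%classic : set R) chi ->
  test_function (QT Om T) (fun z => psi z.1 * chi z.2).
Proof.
move=> [spsi [K [cK KO psi0]]] [schi [J [cJ JI chi0]]]; split=> [k|].
  apply: CkM.
    apply: (@Ck_comp_affine R ('rV[R]_d * R)%type 'rV[R]_d fst fst _ _ k _ (spsi k)) => //.
    by move=> z; exact: cvg_fst.
  apply: (@Ck_comp_affine R ('rV[R]_d * R)%type R snd snd _ _ k _ (schi k)) => //.
  by move=> z; exact: cvg_snd.
exists (K `*` J); split; first exact: compact_setX.
- by move=> [x t] [/= /KO Kx /JI Jt].
- move=> [x t] /= /not_andP[/psi0 ->|/chi0 ->]; by rewrite ?mul0r ?mulr0.
Qed.

Lemma derive_prod_t d (psi : 'rV[R]_d -> R) (chi : R -> R) (z : 'rV[R]_d * R) :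
  derivable chi z.2 1 ->
  'D_((0, 1) : 'rV[R]_d * R) (fun z => psi z.1 * chi z.2) z = psi z.1 * 'D_1 chi z.2.
Proof.
move=> dchi; rewrite -[RHS]deriveMr//.
rewrite /derive; apply: congr1; apply: congr2 => //; apply/funext => h /=.
by rewrite /shift /= scaler0 add0r ![psi _ * _]mulrC.
Qed.

End test_functions.

(** * Lebesgue measure on row vectors *)

Section boxes.
Context {R : realType}.

Lemma box_measurable d (a b : 'rV[R]_d) : measurable (box a b).
Proof.
have -> : box a b = \bigcap_(i in [set: 'I_d]) (rV_coord i @^-1` `]a ord0 i, b ord0 i[%classic).
  by apply/seteqP; split=> x /= h i; have := h i; rewrite /= in_itv //; apply.
apply: fin_bigcap_measurable; first exact: finite_finset.
move=> i _; rewrite -[X in measurable X]setTI; apply: measurable_rV_coord => //.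
Qed.

(** A countable base of the topology. *)
Definition rat_box {d} (p : 'rV[rat]_d * 'rV[rat]_d) : set 'rV[R]_d :=
  box (map_mx ratr p.1) (map_mx ratr p.2).

Lemma open_rat_box d (A : set 'rV[R]_d) : open A ->
  A = \bigcup_(p in [set p | rat_box p `<=` A]) rat_box p.
Proof.
move=> oA; apply/seteqP; split=> [x Ax|x [p pA]]; last exact: pA.
have : nbhs x A by exact: open_nbhs_nbhs.
move=> /nbhs_ballP[e /= e0 eA].
have lo i : exists q : rat, x ord0 i - e < ratr q < x ord0 i.
  by have [|q] := @rat_in_itvoo R (x ord0 i - e) (x ord0 i);
    [rewrite ltrBlDr ltrDl|rewrite in_itv; exists q].
have up i : exists q : rat, x ord0 i < ratr q < x ord0 i + e.
  by have [|q] := @rat_in_itvoo R (x ord0 i) (x ord0 i + e);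
    [rewrite ltrDl|rewrite in_itv; exists q].
have [l Hl] := choice lo; have [u Hu] := choice up.
exists (\row_i l i, \row_i u i) => /=.
  move=> y /= yb; apply: eA; split=> // i j; rewrite (ord1 i).
  have := yb j; rewrite !mxE; have := Hl j; have := Hu j.
  rewrite /ball /= => /andP[_ h1] /andP[h2 _] /andP[h3 h4].
  by rewrite ltr_distlC; apply/andP; split; lra.
by move=> i; rewrite !mxE; have /andP[_ ->] := Hl i; have /andP[-> _] := Hu i.
Qed.

Lemma open_rV_measurable d (A : set 'rV[R]_d) : open A -> measurable A.
Proof.
move=> /open_rat_box ->; rewrite bigcup_mkcond; apply: countable_bigcupT_measurable.
  exact: countableP.
by move=> p; case: ifP => _ //; exact: box_measurable.
Qed.

Lemma continuous_rV_measurable d (f : 'rV[R]_d -> R) : continuous f -> measurable_fun setT f.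
Proof.
move=> /continuousP cf; apply: (measurability _ (RGenOpens.measurableE R)).
move=> _ [_ [a [b ->]] <-]; rewrite setTI; apply: open_rV_measurable.
exact/cf/interval_open.
Qed.

Definition cube {d} (k : nat) : set 'rV[R]_d := box (const_mx (- k%:R)) (const_mx k%:R).

Lemma cube_lty d k : (lebesgue_rV R d (cube k) < +oo)%E.
Proof.
elim: d => [|d IH].
  by rewrite /= diracE; case: (_ \in _); rewrite /= ltry.
rewrite /= /pushforward.
have -> : @rV_rcons R d @^-1` cube k = cube k `*` `](- k%:R), k%:R[%classic.
  apply/seteqP; split=> [[x t] /= h|[x t] [/= hx ht] i].
    split; last by have := h ord_max; rewrite !mxE unlift_none /= in_itv.
    by move=> i; have := h (lift ord_max i); rewrite !mxE liftK.
  rewrite !mxE; case: unliftP => [j _|_] /=; last by move: ht; rewrite in_itv.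
  by have := hx j; rewrite !mxE.
rewrite product_measure1E//; last exact: box_measurable.
apply: lte_mul_pinfty => //; last exact: lebesgue_itvoo_lty.
by rewrite ge0_fin_numE.
Qed.

Lemma cube_cover d : [set: 'rV[R]_d] = \bigcup_k cube k.
Proof.
apply/esym/seteqP; split=> // x _.
exists (Num.truncn (\sum_i `|x ord0 i|)).+1 => // i; rewrite !mxE -ltr_norml.
apply: le_lt_trans (_ : \sum_i `|x ord0 i| < _).
  by rewrite (bigD1 i)//= lerDl sumr_ge0.
by rewrite truncnS_gt.
Qed.

Lemma lebesgue_rV_sigma_finite d : sigma_finite setT (lebesgue_rV R d).
Proof.
exists cube; first exact: cube_cover.
by move=> k; split; [exact: box_measurable|exact: cube_lty].
Qed.

Lemma bounded_lebesgue_lty d (A : set 'rV[R]_d) : measurable A -> bounded_set A ->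
  (lebesgue_rV R d A < +oo)%E.
Proof.
move=> mA [M [_ HM]].
have hM : M < `|M| + 1 by rewrite (le_lt_trans (ler_norm _))// ltrDl.
apply: le_lt_trans (cube_lty d (Num.truncn (`|M| + 1)).+1).
apply: le_measure; rewrite ?inE//; first exact: box_measurable.
move=> x Ax i; rewrite !mxE -ltr_norml.
apply: le_lt_trans (truncnS_gt (`|M| + 1)).
apply: le_trans (HM _ hM x Ax).
rewrite [leRHS]/Num.norm /= mx_normrE; apply/bigmax_geP; right => /=.
by exists (ord0, i).
Qed.

HB.instance Definition _ d := Measure_isSigmaFinite.Build _ _ _ (lebesgue_rV R d)
  (@lebesgue_rV_sigma_finite d).

End boxes.

(** * The fundamental lemma of the calculus of variations *)

Section fundamental_lemma.
Context {R : realType} {d : nat}.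
Variables (Om : set 'rV[R]_d) (T : R).
Hypotheses (Om_open : open Om) (T0 : 0 < T).
Local Notation leb := (lebesgue_rV R d : {measure set _ -> \bar R}).
Local Notation lebt := (@lebesgue_measure R).
Local Notation lebQ := ((leb \x lebt)%E : {measure set _ -> \bar R}).
Local Notation I_T := (`]0, T[%classic : set R).
Local Notation Q := (QT Om T).
Local Notation point := ('rV[R]_d * measurableTypeR R)%type.

Lemma QT_measurable : measurable (Q : set point).
Proof. by apply: measurableX; [exact: open_rV_measurable|exact: measurable_itv]. Qed.

(** [None] stands for the whole line.  Rectangles with such sides are stable under
    intersection and include the strips that generate the product sigma-algebra,
    so they suit Dynkin's lemma. *)
Definition oset (o : option (R * R)) : set R := if o is Some p then `]p.1, p.2[%classic else setT.
Definition omeet (o o' : option (R * R)) := match o, o' with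
  | Some p, Some q => Some (Num.max p.1 q.1, Num.min p.2 q.2)
  | Some p, None => Some p
  | None, _ => o' end.

Lemma omeetP o o' : oset (omeet o o') = oset o `&` oset o'.
Proof.
case: o o' => [[u v]|] [[u' v']|] /=; rewrite ?setIT ?setTI//.
apply/predeqP => t; rewrite /= !in_itv /= lt_min gt_max.
by split=> [/andP[/andP[-> ->] /andP[-> ->]]//|[/andP[-> ->] /andP[-> ->]]].
Qed.

Definition orect (f : 'I_d -> option (R * R)) (o : option (R * R)) : set point :=
  [set z : 'rV[R]_d * R | (forall i, oset (f i) (z.1 ord0 i)) /\ oset o z.2].
Definition orects : set (set point) := [set A | exists f o, A = orect f o].

Lemma orects_setI : setI_closed orects.
Proof.
move=> _ _ [f [ot ->]] [g [ot' ->]]; exists (fun i => omeet (f i) (g i)), (omeet ot ot').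
apply/seteqP; split=> z /=.
  by move=> [[hf ho] [hg ho']]; split; [move=> i|]; rewrite omeetP.
move=> [h ho]; rewrite omeetP in ho; have [h1 h2] := ho.
by split; split => // i; have := h i; rewrite omeetP => -[].
Qed.

Lemma orectsE : @measurable _ point = <<s orects >>.
Proof.
apply/seteqP; split.
- pose X' := g_sigma_algebraType orects.
  have m1 : measurable_fun setT (fun z : X' => z.1 : 'rV[R]_d).
    apply: measurable_fun_rVP => i; apply: (measurability _ (RGenOpens.measurableE R)).
    move=> _ [_ [u [v ->]] <-]; rewrite setTI; apply: sub_sigma_algebra.
    exists (fun j => if j == i then Some (u, v) else None), None.
    apply/seteqP; split=> z /=; last by move=> [/(_ i)]; rewrite eqxx.
    by move=> h; split => // j; case: eqP => [->|].
  have m2 : measurable_fun setT (fun z : X' => z.2 : R).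
    apply: (measurability _ (RGenOpens.measurableE R)).
    move=> _ [_ [u [v ->]] <-]; rewrite setTI; apply: sub_sigma_algebra.
    exists (fun j => None), (Some (u, v)).
    by apply/seteqP; split=> z /=; [|case].
  apply: smallest_sub; first exact: smallest_sigma_algebra.
  move=> _ [[B mB <-]|[B mB <-]].
    exact: (m1 measurableT B mB).
  exact: (m2 measurableT B mB).
- apply: smallest_sub; first exact: sigma_algebra_measurable.
  move=> _ [f [ot ->]].
  have mo o' : measurable (oset o' : set (measurableTypeR R)).
    by case: o' => [p|] /=; [exact: measurable_itv|exact: measurableT].
  have -> : orect f ot = [set x : 'rV[R]_d | forall i, oset (f i) (x ord0 i)] `*` oset ot.
    by apply/seteqP; split.
  apply: measurableX => //.
  have -> : [set x : 'rV[R]_d | forall i, oset (f i) (x ord0 i)] =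
     \bigcap_(i in [set: 'I_d]) (rV_coord i @^-1` oset (f i)).
    by apply/seteqP; split=> x /= h i; [move=> _|]; apply: h.
  apply: fin_bigcap_measurable; first exact: finite_finset.
  by move=> i _; rewrite -[X in measurable X]setTI; apply: measurable_rV_coord => //; exact: mo.
Qed.

Variable f : point -> R.
Hypothesis fi : integrableR lebQ Q f.
Hypothesis f_ortho : forall psi chi, test_function Om psi -> test_function I_T chi ->
  \int[lebQ]_(z in Q) (f z * (psi z.1 * chi z.2)) = 0.

Let mQ := QT_measurable.

Lemma cutoff_fun_measurable (a b : 'rV[R]_d) (c e : R) n :
  measurable_fun setT (fun z : point => box_cutoff a b n z.1 * cutoff c e n z.2).
Proof.
apply: measurable_funM.
  apply: (measurableT_comp _ (@measurable_fst _ _ 'rV[R]_d (measurableTypeR R))).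
  apply: continuous_rV_measurable.
  by have [+ _] := @box_cutoff_test R d setT a b n (@subsetT _ _); move=> /(_ 0%N).
apply: (measurableT_comp _ (@measurable_snd _ _ 'rV[R]_d (measurableTypeR R))).
exact: (continuous_measurable_fun (cutoff_smooth c e n 0%N)).
Qed.

(** Tensor products of cutoffs are admissible test functions and converge boundedly
    to the indicator of the box. *)
Lemma integral_box_eq0 (a b : 'rV[R]_d) (c e : R) : box a b `<=` Om -> 0 <= c -> e <= T ->
  (\int[lebQ]_(z in box a b `*` `]c, e[%classic) (f z)%:E = 0)%E.
Proof.
move=> abO c0 eT.
pose h n (z : point) := f z * (box_cutoff a b n z.1 * cutoff c e n z.2).
pose B : set point := box a b `*` `]c, e[%classic.
have mB : measurable B by apply: measurableX; [exact: box_measurable|exact: measurable_itv].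
have BQ : B `<=` Q.
  move=> [x t] [/= /abO xO]; rewrite in_itv /= => /andP[ct te]; split => //=.
  by rewrite in_itv /= (le_lt_trans c0 ct) (lt_le_trans te eT).
have fB : measurable_fun Q (fun z => f z * \1_B z).
  by apply: measurable_funM; [exact: intR_meas fi|exact: measurable_indic].
have cv : (fun n => \int[lebQ]_(z in Q) h n z) @ \oo --> \int[lebQ]_(z in Q) (f z * \1_B z).
  apply: (Rint_dominated_cvg mQ _ fB (integrable_norm fi)).
  - move=> n; apply: measurable_funM; first exact: intR_meas fi.
    exact: (measurable_funS measurableT (@subsetT _ _) (cutoff_fun_measurable _ _ _ _ _)).
  - apply: aeW => z _; apply: cvgM; first exact: cvg_cst.
    have -> : \1_B z = \1_(box a b) z.1 * (z.2 \in `]c, e[)%:R :> R.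
      rewrite !indicE -natrM mulnb; congr (_%:R); congr nat_of_bool.
      apply/idP/andP => [/set_mem[/= h1 h2]|[/set_mem h1 h2]]; last by rewrite inE; split.
      by rewrite mem_set.
    apply: cvgM; [exact: box_cutoff_cvg|exact: cutoff_cvg].
  - apply: aeW => z _ n; rewrite /h normrM ler_piMr//.
    have /andP[h1 h2] := box_cutoff_bound a b n z.1.
    have /andP[h3 h4] := cutoff_bound c e n z.2.
    by rewrite ger0_norm; [exact: mulr_ile1|exact: mulr_ge0].
have fBi : integrableR lebQ Q (fun z => f z * \1_B z).
  apply: (le_intR mQ fB _ (integrable_norm fi)) => z _.
  by rewrite normrM ler_piMr// indicE; case: (z \in B); rewrite ?normr1 ?normr0.
have : (\int[lebQ]_(z in Q) (f z * \1_B z)%:E = 0)%E.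
  rewrite (intR_EFin mQ fBi); congr EFin.
  rewrite (_ : (fun n => _) = (fun=> 0)) in cv; last first.
    by apply/funext => n; exact: (f_ortho (box_cutoff_test n abO) (cutoff_test n c0 eT)).
  by rewrite -(cvg_lim (@Rhausdorff R) cv) lim_cst.
rewrite -/B => <-.
have -> : (\int[lebQ]_(z in B) (f z)%:E = \int[lebQ]_(z in Q `&` B) (f z)%:E)%E.
  by rewrite setIidr.
rewrite integral_mkcondr; apply: eq_integral => z zQ.
by rewrite patchE indicE; case: (z \in B) => /=; rewrite ?mulr1 ?mulr0.
Qed.

(** A box inside the domain meets every rectangle in a box, on which the integral
    vanishes; Dynkin's lemma extends this to all measurable subsets. *)
Lemma ae_eq0_on_box (a b : 'rV[R]_d) : box a b `<=` Om ->
  ae_eq lebQ (box a b `*` I_T) f (fun=> 0).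
Proof.
move=> abO; pose B : set point := box a b `*` I_T.
have mB : measurable B by apply: measurableX; [exact: box_measurable|exact: measurable_itv].
have BQ : B `<=` Q by move=> [x t] [/= /abO].
have fiB : integrableR lebQ B f by exact: integrableS fi.
pose P := [set A : set point | (\int[lebQ]_(z in A `&` B) (f z)%:E = 0)%E].
have PA A : measurable A -> P A.
  rewrite orectsE; apply: (dynkin_induction orectsE orects_setI).
  - by rewrite /P /= setTI; exact: integral_box_eq0.
  - move=> _ [g [ot ->]]; rewrite /P /=.
    pose lo i := if g i is Some p then Num.max p.1 (a ord0 i) else a ord0 i.
    pose hi i := if g i is Some p then Num.min p.2 (b ord0 i) else b ord0 i.
    pose lot := if ot is Some p then Num.max p.1 0 else 0.
    pose hit := if ot is Some p then Num.min p.2 T else T.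
    have -> : orect g ot `&` B = box (\row_i lo i) (\row_i hi i) `*` `]lot, hit[%classic.
      apply/predeqP => -[x t]; split=> [[[/= hg ho] [/= hx]]|[/= hx]].
        rewrite in_itv /= => /andP[t0 tT]; split=> [i|/=].
          rewrite !mxE /lo /hi; have := hg i; have := hx i.
          case: (g i) => [p|] //=; rewrite in_itv /= => /andP[ax xb] /andP[px xp].
          by rewrite gt_max lt_min ax xb px xp.
        rewrite in_itv /= {}/lot {}/hit; case: ot ho => [p|] /=; last by rewrite t0 tT.
        by rewrite in_itv /= gt_max lt_min t0 tT => /andP[-> ->].
      rewrite in_itv /= => ht; split; split.
      + move=> i; have := hx i; rewrite !mxE /lo /hi.
        by case: (g i) => [p|] //=; rewrite in_itv /= gt_max lt_min => /andP[/andP[-> _] /andP[-> _]].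
      + rewrite {}/lot {}/hit in ht *; case: ot ht => [p|] //=.
        by rewrite in_itv /= gt_max lt_min => /andP[/andP[-> _] /andP[-> _]].
      + move=> i; have := hx i; rewrite !mxE /lo /hi.
        by case: (g i) => [p|] //=; rewrite gt_max lt_min => /andP[/andP[_ ->] /andP[_ ->]].
      + rewrite {}/lot {}/hit /= in_itv /= in ht *; case: ot ht => [p|] //=.
        by rewrite gt_max lt_min => /andP[/andP[_ ->] /andP[_ ->]].
    apply: integral_box_eq0.
    + move=> x hx; apply: abO => i; have := hx i; rewrite !mxE /lo /hi.
      by case: (g i) => [p|] //=; rewrite gt_max lt_min => /andP[/andP[_ ->] /andP[_ ->]].
    + by rewrite {}/hit {}/lot; case: ot => [p|] //=; rewrite le_max lexx orbT.
    + by rewrite {}/lot {}/hit; case: ot => [p|] //=; rewrite ge_min lexx orbT.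
  - move=> S mS PS; rewrite /P /=.
    have BE : B = (S `&` B) `|` (~` S `&` B) by rewrite -setIUl setUCr setTI.
    have B0 : (\int[lebQ]_(z in B) (f z)%:E = 0)%E by exact: integral_box_eq0.
    have := B0; rewrite {1}BE integral_setU//.
    + by rewrite [X in (X + _)%E]PS add0e.
    + exact: measurableI.
    + by apply: measurableI => //; exact: measurableC.
    + by rewrite -BE; exact: measurable_int fiB.
    + by apply/disj_setPS => z [[Sz _] [nSz _]].
  - move=> F mF tF PF; rewrite /P /= setI_bigcupl integral_bigcup.
    + by rewrite eseries0// => n _ _; exact: PF.
    + exact: trivIset_setIr.
    + by move=> k; exact: measurableI.
    + rewrite -setI_bigcupl; apply: integrableS fiB => //.
      by apply: measurableI => //; exact: bigcup_measurable.
have h : ae_eq lebQ B (EFin \o f) (cst 0%E).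
  apply: integral_ae_eq => //.
  move=> E EB mE; rewrite integral0 -[RHS](PA E mE); congr (integral _ _ _).
  by apply/esym/setIidl.
by apply: filterS h => z /= + Bz => /(_ Bz) [].
Qed.

(** Products of a test function in space and one in time are enough.  The domain is
    a countable union of rational boxes, where [ae_eq0_on_box] applies. *)
Lemma fundamental_lemma : ae_eq lebQ Q f (fun=> 0).
Proof.
have H (p : 'rV[rat]_d * 'rV[rat]_d) :
    {ae lebQ, forall z, rat_box p `<=` Om -> (rat_box p `*` I_T) z -> f z = 0}.
  have [pO|npO] := pselect (rat_box p `<=` Om).
    by have := ae_eq0_on_box pO; apply: filterS => z /= h _; exact: h.
  by apply: aeW.
have := ae_forall_countable H.
apply: filterS => z h [Oz Iz].
have : (\bigcup_(p in [set p | rat_box p `<=` Om]) rat_box p) z.1 by rewrite -open_rat_box.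
by move=> [p pO pz]; exact: (h p).
Qed.

End fundamental_lemma.

(** * Integration by parts against periodic functions *)

Section test_function_theory.
Context {R : realType} {V : normedModType R}.
Implicit Types (U : set V) (phi : V -> R).

Lemma test_continuous U phi : test_function U phi -> continuous phi.
Proof. by move=> [/(_ 0%N)]. Qed.

Lemma test_derivable U phi (x v : V) : test_function U phi -> derivable phi x v.
Proof. by move=> [/(_ 1%N)[_ /(_ v)[]]]. Qed.

Lemma test_bounded U phi : test_function U phi -> exists M, forall x, `|phi x| <= M.
Proof.
move=> [sphi [K [cK _ phi0]]].
have : compact (phi @` K).
  by apply: continuous_compact => //; apply: continuous_subspaceT; exact: (sphi 0%N).
move=> /compact_bounded[M [_ HM]]; exists (`|M| + 1) => x.
have [Kx|nKx] := pselect (K x); last by rewrite phi0// normr0 addr_ge0.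
by apply: HM; [rewrite (le_lt_trans (ler_norm _))// ltrDl|exists x].
Qed.

Lemma test_derive U phi v : test_function U phi -> test_function U (fun x => 'D_v phi x).
Proof.
move=> [sphi [K [cK KU phi0]]]; split=> [k|].
  by have [_ /(_ v)[]] := sphi k.+1.
exists K; split => // x nKx.
have cl : closed K by apply: compact_closed => //; exact: norm_hausdorff.
have : \near x, phi x = 0.
  have : nbhs x (~` K) by apply: open_nbhs_nbhs; split => //; exact: closed_openC.
  by apply: filterS => y; exact: phi0.
by move=> /(near_eq_derive v) ->; rewrite derive_cst.
Qed.

End test_function_theory.

Section interval_weak_derivative.
Context {R : realType}.
Local Notation lebt := (@lebesgue_measure R).

Lemma derive_smooth_is_derive (f : R -> R) (x : R) : smooth f -> is_derive x 1 f ('D_1 f x).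
Proof. by move=> /(_ 1%N)[_ /(_ 1)[df _]]; exact: DeriveDef. Qed.

Lemma derive_smooth (f : R -> R) : smooth f -> smooth (fun x => 'D_1 f x).
Proof. by move=> sf k; have [_ /(_ 1)[]] := sf k.+1. Qed.

Lemma derive_smoothstep_bounded : exists C : R, forall x : R, `|'D_1 (@smoothstep R) x| <= C.
Proof.
have := @smoothstep_smooth R => ss.
have : compact ((fun x : R => 'D_1 (@smoothstep R) x) @` `[(-1), 2]%classic).
  apply: continuous_compact; last exact: segment_compact.
  by apply: continuous_subspaceT; exact: (derive_smooth ss 0%N).
move=> /compact_bounded[M [_ HM]]; exists (`|M| + 1) => x.
have [h|h] := boolP (x \in `[(-1), 2]).
  by apply: HM; [rewrite (le_lt_trans (ler_norm _))// ltrDl|exists x].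
have [a Ha] : exists a : R, \near x, smoothstep x = a.
  move: h; rewrite in_itv /= negb_and -!ltNge => /orP[h|h].
    exists 0; near=> y; rewrite smoothstep0//; apply: ltW; near: y; apply: lt_nbhsl; lra.
  exists 1; near=> y; rewrite smoothstep1//; apply: ltW; near: y; apply: lt_nbhsr; lra.
by rewrite (near_eq_derive (1 : R) Ha) derive_cst normr0 addr_ge0.
Unshelve. all: by end_near.
Qed.

Lemma leb_itvoo (a b : R) : a < b -> fine (lebt `]a, b[%classic) = b - a.
Proof. by move=> ab; rewrite lebesgue_measure_itv /= lte_fin ab -EFinB. Qed.

Variable T : R.
Hypothesis T0 : 0 < T.
Local Notation I_T := (`]0, T[%classic : set R).
Let mI : @measurable _ (measurableTypeR R) I_T. Proof. exact: measurable_itv. Qed.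
Let Ifin : (lebt I_T < +oo)%E. Proof. exact: lebesgue_itvoo_lty. Qed.

Local Notation theta n := (cutoff 0 T n).

(** The derivative grows like [n], but lives on two layers of width of order
    [1 / n], so its mass stays bounded. *)
Lemma derive_cutoff_bounded : exists C : R, 0 <= C /\
  forall n t, `|'D_1 (theta n) t| <= C * n.+1%:R.
Proof.
have [C HC] := derive_smoothstep_bounded.
have C0 : 0 <= C by exact: le_trans (normr_ge0 _) (HC 0).
exists (2 * C); split=> [|n t]; first by rewrite mulr_ge0.
have ss := @smoothstep_smooth R.
set m := n.+1%:R : R; have m0 : 0 <= m by rewrite ler0n.
have d1 := is_derive_comp_lin (derive_smooth_is_derive (m * t + - (m * 0 + 1)) ss).
have d2 := is_derive_comp_lin (derive_smooth_is_derive (- m * t + (m * T - 1)) ss).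
have [_ ->] := is_derive_mulf d1 d2.
set a := 'D_(1 : R) smoothstep (m * t + _); set b := 'D_(1 : R) smoothstep (- m * t + _); set v := smoothstep _; set u := smoothstep _.
have hu : `|u| <= 1 by rewrite ger0_norm ?smoothstep_ge0// smoothstep_le1.
have hv : `|v| <= 1 by rewrite ger0_norm ?smoothstep_ge0// smoothstep_le1.
have ha : `|a| <= C by exact: HC.
have hb : `|b| <= C by exact: HC.
have h1 : `|a| * `|v| <= C by apply: le_trans ha; rewrite ler_piMr.
have h2 : `|u| * `|b| <= C by apply: le_trans hb; rewrite ler_piMl.
rewrite [X in `|X|](_ : _ = m * (a * v - u * b)); last by ring.
rewrite normrM (ger0_norm m0) [leRHS]mulrC ler_wpM2l// (le_trans (ler_normB _ _))//.
by rewrite [`|a * v|]normrM [`|u * b|]normrM mulr_natl mulr2n; exact: lerD h1 h2.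
Qed.

Lemma derive_cutoff_eq0 n t : 2 / n.+1%:R < t < T - 2 / n.+1%:R -> 'D_1 (theta n) t = 0.
Proof.
have n0 : 0 < n.+1%:R :> R by rewrite ltr0n.
move=> /andP[h1 h2]; have : \near t, theta n t = 1.
  near=> s; have g1 : 2 / n.+1%:R < s by near: s; exact: lt_nbhsr.
  have g2 : s < T - 2 / n.+1%:R by near: s; exact: lt_nbhsl.
  move: g1; rewrite ltr_pdivrMr// => g1.
  move: g2; rewrite ltrBrDr -ltrBrDl ltr_pdivrMr// => g2.
  by rewrite /cutoff !smoothstep1 ?mulr1//; lra.
by move=> /(near_eq_derive (1 : R)) ->; rewrite derive_cst.
Unshelve. all: by end_near.
Qed.

(* [K] is the weak derivative of [h], known only against compactly supported
   functions; continuity of [h] up to the end points and equality of the end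
   values will allow the periodic function [c] instead. *)
Variables (h K c : R -> R).
Hypothesis h_cont : forall t, 0 <= t <= T -> forall e, 0 < e ->
  exists2 del, 0 < del & forall s, 0 <= s <= T -> `|s - t| < del -> `|h s - h t| < e.
Hypothesis h_per : h 0 = h T.
Hypothesis hi : integrableR lebt I_T h.
Hypothesis Ki : integrableR lebt I_T K.
Hypothesis weak : forall chi, test_function I_T chi ->
  \int[lebt]_(t in I_T) (h t * 'D_1 chi t) = - \int[lebt]_(t in I_T) (K t * chi t).
Hypothesis sc : smooth c.
Hypothesis c_per : c 0 = c T.

Let sth n : smooth (theta n). Proof. exact: cutoff_smooth. Qed.

Let intR_mul_cont (f g : R -> R) : integrableR lebt I_T f -> continuous g ->
  integrableR lebt I_T (fun t => f t * g t).
Proof.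
move=> fi cg; have [M HM] := continuous_itv_bounded 0 T cg.
apply: (le_intR mI _ _ (intRZ mI M (integrable_norm fi))).
  apply: measurable_funM; first exact: intR_meas fi.
  by apply: measurable_funTS; exact: continuous_measurable_fun.
by move=> t It; rewrite normrM mulrC ler_wpM2r// HM.
Qed.

Let cutoff_cvg_int (f : R -> R) : integrableR lebt I_T f ->
  (fun n => \int[lebt]_(t in I_T) (f t * theta n t)) @ \oo --> \int[lebt]_(t in I_T) f t.
Proof.
move=> fi; apply: (Rint_dominated_cvg mI _ _ (integrable_norm fi)).
- move=> n; apply: measurable_funM; first exact: intR_meas fi.
  by apply: measurable_funTS; exact: (continuous_measurable_fun (sth n 0%N)).
- exact: intR_meas fi.
- apply: aeW => t It; rewrite -[X in _ --> X]mulr1; apply: cvgM; first exact: cvg_cst.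
  by have := @cutoff_cvg R 0 T t; rewrite (_ : (t \in `]0, T[) = true).
- apply: aeW => t It n; rewrite normrM ler_piMr//.
  by have /andP[h1 h2] := cutoff_bound 0 T n t; rewrite ger0_norm.
Qed.

(** The derivative of the cutoff has integral zero, so the common value [u0] of
    [h c] at both ends may be subtracted; what remains is small on the layers,
    where the derivative has bounded mass. *)
Let boundary_layer :
  (fun n => \int[lebt]_(t in I_T) (h t * c t * 'D_1 (theta n) t)) @ \oo --> (0 : R).
Proof.
have [C [C0 HC]] := derive_cutoff_bounded.
pose u t := h t * c t; pose u0 := h 0 * c 0.
have cc : continuous c := sc 0%N.
have ui : integrableR lebt I_T u by exact: intR_mul_cont.
have cd n : continuous (fun t => 'D_1 (theta n) t) := derive_smooth (sth n) 0%N.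
have near_end (t0 : R) : 0 <= t0 <= T -> h t0 * c t0 = u0 -> forall e, 0 < e ->
    exists2 del, 0 < del & forall s, 0 <= s <= T -> `|s - t0| < del -> `|u s - u0| <= e.
  move=> ht0 <- e e0; have [M HM] := continuous_itv_bounded 0 T cc.
  have [del1 d1 H1] := h_cont ht0 ltr01.
  (* Moduli of continuity chosen so that each factor of the product contributes [e / 2]. *)
  pose B := `|h t0| + 1; pose C' := `|c t0|.
  have [del2 d2 H2] := h_cont ht0 (divr_gt0 e0 (ltr_wpDl (addr_ge0 (normr_ge0 (c t0)) (normr_ge0 (c t0))) (ltr0n R 2) : 0 < C' + C' + 2)).
  have B0 : 0 < B by rewrite ltr_wpDl.
  have /cvgrPdist_lt/(_ _ (divr_gt0 e0 (mulr_gt0 (ltr0n R 2) B0))) /nbhs_ballP[del3 /= d3 H3] := cc t0.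
  exists (Num.min del1 (Num.min del2 del3)); first by rewrite !lt_min d1 d2 d3.
  move=> s hs; rewrite !lt_min => /and3P[s1 s2 s3].
  have k1 := H1 s hs s1; have k2 := H2 s hs s2.
  have k3 : `|c t0 - c s| < e / (2 * B) by apply: H3; rewrite /ball /= distrC.
  have hB : `|h s| <= B.
    have -> : h s = h t0 + (h s - h t0) by ring.
    by rewrite (le_trans (ler_normD _ _))// lerD2l ltW.
  have -> : u s - h t0 * c t0 = - (h s * (c t0 - c s)) + (h s - h t0) * c t0 by rewrite /u; ring.
  apply: (le_trans (ler_normD _ _)); rewrite normrN !normrM.
  have g1 : `|h s| * `|c t0 - c s| <= e / 2.
    have -> : e / 2 = B * (e / (2 * B)) by field; rewrite gt_eqF.
    by rewrite ler_pM// ltW.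
  have g2 : `|h s - h t0| * `|c t0| <= e / 2.
    have p : 0 < C' + C' + 2 by rewrite ltr_wpDl// addr_ge0// /C' normr_ge0.
    apply: (@le_trans _ _ (e / (C' + C' + 2) * C')); first by rewrite ler_wpM2r// ltW.
    rewrite mulrAC ler_pdivrMr//; have : 0 <= C' by exact: normr_ge0.
    by move=> C'0; nra.
  lra.
have key e : 0 < e -> exists N, forall n, (N <= n)%N ->
    `|\int[lebt]_(t in I_T) (u t * 'D_1 (theta n) t)| <= 4 * C * e.
  move=> e0.
  have [|//|del1 d1 H1] := near_end 0 _ _ e e0; first by rewrite lexx ltW.
  have [||del2 d2 H2] := near_end T _ _ e e0; [by rewrite lexx ltW|by rewrite -h_per -c_per|].
  have [N HN] : exists N, forall n, (N <= n)%N ->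
      [/\ 2 / n.+1%:R < del1, 2 / n.+1%:R < del2 & 4 / n.+1%:R < T].
    pose del := Num.min (Num.min del1 del2) (T / 2).
    have del0 : 0 < del by rewrite !lt_min d1 d2 divr_gt0.
    have [M _ HM] := @nbhs_infty_gtr R (2 / del).
    exists M => n Mn; have /= := HM n Mn; rewrite ltr_pdivrMr// => hh.
    have n0 : 0 < n.+1%:R :> R by rewrite ltr0n.
    have : 2 < n.+1%:R * del by apply: (lt_le_trans hh); rewrite ler_pM2r// ler_nat.
    have m1 : del <= del1 by rewrite /del !ge_min lexx.
    have m2 : del <= del2 by rewrite /del !ge_min lexx orbT.
    have m3 : del <= T / 2 by rewrite /del !ge_min lexx orbT.
    move=> hd; split; rewrite ltr_pdivrMr//.
    - by rewrite mulrC (lt_le_trans hd)// ler_pM2l.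
    - by rewrite mulrC (lt_le_trans hd)// ler_pM2l.
    - have : n.+1%:R * del <= n.+1%:R * (T / 2) by rewrite ler_pM2l.
      lra.
  exists N => n Nn; have [n1 n2 n3] := HN n Nn.
  have n0 : 0 < n.+1%:R :> R by rewrite ltr0n.
  set r := 2 / n.+1%:R in n1 n2 *; have r0 : 0 < r by rewrite divr_gt0.
  have rT : r + r < T.
    by apply: le_lt_trans n3; rewrite le_eqVlt; apply/orP; left; apply/eqP; rewrite /r; field; rewrite gt_eqF.
  have iD := continuous_intR 0 T (@cd n).
  have D0 : \int[lebt]_(t in I_T) 'D_1 (theta n) t = 0.
    rewrite (Rint_FTC T0 (@cd n) (fun x => derive_smooth_is_derive x (sth n))).
    rewrite !cutoff_support ?subrr//; apply/negP; rewrite negb_and -!ltNge add0r.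
      by rewrite invr_gt0 n0.
    by rewrite ltrBlDr ltrDl invr_gt0 n0 orbT.
  pose J := `]r, T - r[%classic : set (measurableTypeR R).
  have JI : J `<=` I_T.
    move=> t; rewrite /J /= !in_itv /= => /andP[t1 t2].
    by rewrite (lt_trans r0 t1) (lt_trans t2)// ltrBlDr ltrDl.
  have mJ : measurable J by exact: measurable_itv.
  have iJ : integrableR lebt I_T (\1_J : R -> R).
    by apply: (intR_bounded mI Ifin (M := 1)) => // t _; rewrite indicE; case: (_ \in _); rewrite ?normr1 ?normr0.
  have EJ : \int[lebt]_(t in I_T) (\1_J t : R) = T - r - r.
    rewrite /Rintegral integral_indic// (_ : J `&` I_T = J); last by apply/setIidl.
    by apply: leb_itvoo; rewrite ltrBrDr.
  have i1 : integrableR lebt I_T (fun t => u t * 'D_1 (theta n) t) by exact: intR_mul_cont.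
  have i2 := intRZ mI u0 iD.
  have -> : \int[lebt]_(t in I_T) (u t * 'D_1 (theta n) t) =
     \int[lebt]_(t in I_T) (u t * 'D_1 (theta n) t - u0 * 'D_1 (theta n) t).
    by rewrite (RintegralB mI i1 i2) (RintegralZl u0 mI iD) D0 mulr0 subr0.
  apply: (le_trans (le_normr_Rintegral mI (intRB mI i1 i2))).
  have i3 : integrableR lebt I_T (fun t => e * (C * n.+1%:R) * (1 - \1_J t)).
    by apply: intRZ => //; apply: intRB => //; exact: cst_intR.
  apply: (le_trans (Rint_le mI (integrable_norm (intRB mI i1 i2)) i3 _)); last first.
    rewrite (RintegralZl _ mI (intRB mI (cst_intR mI 1 Ifin) iJ)).
    rewrite (RintegralB mI (cst_intR mI 1 Ifin) iJ) EJ Rint_cstI// mul1r.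
    have -> : T - (T - r - r) = 4 / n.+1%:R by rewrite /r; field; rewrite gt_eqF.
    have -> : e * (C * n.+1%:R) * (4 / n.+1%:R) = 4 * C * e by field; rewrite gt_eqF.
    by [].
  move=> t It /=; rewrite [X in `|X|](_ : _ = (u t - u0) * 'D_1 (theta n) t); last by rewrite mulrBl.
  rewrite normrM indicE.
  case: (boolP (t \in J)) => [/set_mem|].
    by rewrite /J /= in_itv /= => tJ; rewrite derive_cutoff_eq0// normr0 !mulr0 subrr mulr0.
  rewrite notin_setE /J /= in_itv /= => tJ; rewrite subr0 mulr1.
  apply: ler_pM => //; move: It; rewrite /= in_itv /= => /andP[t0 tT].
  have tin : 0 <= t <= T by rewrite !ltW.
  have [tr|tr] := leP t r.
    by apply: H1 => //; rewrite subr0 gtr0_norm// (le_lt_trans tr).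
  apply: H2 => //; rewrite distrC gtr0_norm ?subr_gt0//.
  have : T - r <= t by rewrite leNgt; apply/negP => tr'; apply: tJ; rewrite tr.
  lra.
apply/cvgrPdist_le => e e0.
(* [C] may be zero, whence the [+ 1]. *)
have e'0 : 0 < e / (4 * C + 1) by rewrite divr_gt0// ltr_wpDl// mulr_ge0.
have [N HN] := key _ e'0; exists N => // n /= Nn.
rewrite sub0r normrN; apply: (le_trans (HN n Nn)).
rewrite mulrA ler_pdivrMr ?ltr_wpDl// ?mulr_ge0//.
by rewrite mulrC ler_pM2l// lerDl.
Qed.

(** Test with [theta n * c] and let [n] grow; the term in which the cutoff is
    differentiated vanishes in the limit by [boundary_layer]. *)
Lemma periodic_weak_ibp :
  \int[lebt]_(t in I_T) (h t * 'D_1 c t) = - \int[lebt]_(t in I_T) (K t * c t).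
Proof.
have cc : continuous c := sc 0%N.
have cc' : continuous (fun t => 'D_1 c t) := derive_smooth sc 0%N.
have cd n : continuous (fun t => 'D_1 (theta n) t) := derive_smooth (sth n) 0%N.
have i1 : integrableR lebt I_T (fun t => h t * 'D_1 c t) by exact: intR_mul_cont.
have i2 : integrableR lebt I_T (fun t => K t * c t) by exact: intR_mul_cont.
have i3 : integrableR lebt I_T (fun t => h t * c t) by exact: intR_mul_cont.
have cv1 := cutoff_cvg_int i1; have cv2 := cutoff_cvg_int i2.
have cv3 := boundary_layer.
have E n : \int[lebt]_(t in I_T) (h t * c t * 'D_1 (theta n) t) +
    \int[lebt]_(t in I_T) (h t * 'D_1 c t * theta n t) =
    - \int[lebt]_(t in I_T) (K t * c t * theta n t).
  have ct : test_function I_T (fun t => theta n t * c t).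
    have [_ [S [cS SI S0]]] := @cutoff_test R T 0 T n (lexx 0) (lexx T).
    split; first by move=> k; apply: CkM; [exact: cutoff_smooth|exact: sc].
    by exists S; split => // t nS; rewrite S0// mul0r.
  have := weak ct.
  rewrite (@eq_Rint _ (measurableTypeR R) _ lebt I_T (fun t => K t * (theta n t * c t)) (fun t => K t * c t * theta n t)); last by move=> t _; ring.
  move=> <-.
  have cth : continuous (theta n) := sth n 0%N.
  have j1 := intR_mul_cont i3 (@cd n); have j2 := intR_mul_cont i1 cth.
  rewrite -(RintegralD mI j1 j2); apply: eq_Rint => t _.
  have [_ ->] := is_derive_mulf (derive_smooth_is_derive t (sth n)) (derive_smooth_is_derive t sc).
  by ring.
have L : (fun n => \int[lebt]_(t in I_T) (h t * c t * 'D_1 (theta n) t) +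
    \int[lebt]_(t in I_T) (h t * 'D_1 c t * theta n t)) @ \oo --> \int[lebt]_(t in I_T) (h t * 'D_1 c t).
  by rewrite -[X in _ --> X]add0r; exact: cvgD.
have L2 : (fun n => - \int[lebt]_(t in I_T) (K t * c t * theta n t)) @ \oo -->
    - \int[lebt]_(t in I_T) (K t * c t) by exact: cvgN.
have -> := esym (cvg_lim (@Rhausdorff R) L); have -> := esym (cvg_lim (@Rhausdorff R) L2).
by congr (lim (_ @ \oo)); apply/funext => n; rewrite [LHS]E.
Qed.

End interval_weak_derivative.

(** * Square-integrable vector fields *)

Section vector_valued.
Context {R : realType} {d : nat} {dp : measure_display} {X : measurableType dp}.
Variables (mu : {measure set X -> \bar R}) (D : set X).
Hypothesis mD : measurable D.
Implicit Types g h : X -> 'rV[R]_d.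

Lemma measurable_fun_rV_on g : (forall i, measurable_fun D (fun x => g x ord0 i)) ->
  measurable_fun D g.
Proof.
move=> mg; apply: (@measurability _ _ X 'rV[R]_d D g
  (\big[setU/set0]_(i < d) preimage_set_system setT (@rV_coord R d i) measurable)) => //.
move=> _ [B + <-]; rewrite -bigcup_seq => -[i _ [Y mY <-]].
by have := mg i mD Y mY; rewrite setTI.
Qed.

Lemma rV_coord_meas g i : measurable_fun D g -> measurable_fun D (fun x => g x ord0 i).
Proof. by move=> mg; apply: (measurableT_comp (@measurable_rV_coord R d i)). Qed.

Lemma measurable_fun_rVB g h : measurable_fun D g -> measurable_fun D h ->
  measurable_fun D (fun x => g x - h x).
Proof.
move=> mg mh; apply: measurable_fun_rV_on => i; under eq_fun do rewrite !mxE.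
by apply: measurable_funB; exact: rV_coord_meas.
Qed.

Lemma dotE (u v : 'rV[R]_d) : dot u v = \sum_i u ord0 i * v ord0 i.
Proof. by []. Qed.

Lemma dot_ge0 (u : 'rV[R]_d) : 0 <= dot u u.
Proof. by apply: sumr_ge0 => i _; rewrite -expr2 sqr_ge0. Qed.

Lemma le_sqr_dot (u : 'rV[R]_d) i : u ord0 i ^+ 2 <= dot u u.
Proof.
by rewrite dotE (bigD1 i)//= -expr2 lerDl sumr_ge0// => j _; rewrite -expr2 sqr_ge0.
Qed.

Lemma measurable_dot g h : measurable_fun D g -> measurable_fun D h ->
  measurable_fun D (fun x => dot (g x) (h x)).
Proof.
move=> mg mh; rewrite (_ : (fun x => _) = (fun x => \sum_i g x ord0 i * h x ord0 i))//.
by apply: measurable_sum => i; apply: measurable_funM; exact: rV_coord_meas.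
Qed.

Lemma sqnormv_ge0 g : (0 <= sqnormv mu D g)%E.
Proof. by apply: integral_ge0 => x _; rewrite lee_fin dot_ge0. Qed.

Lemma sqnorm_coord_le g i : measurable_fun D g ->
  (sqnorm mu D (fun x => g x ord0 i) <= sqnormv mu D g)%E.
Proof.
move=> mg; apply: ge0_le_integral => //.
- by move=> x _; rewrite lee_fin sqr_ge0.
- by apply/measurable_EFinP; apply: measurable_funX; exact: rV_coord_meas.
- by apply/measurable_EFinP; exact: measurable_dot.
- by move=> x _; rewrite lee_fin le_sqr_dot.
Qed.

Lemma L2vP g : L2v mu D g <-> forall i, L2 mu D (fun x => g x ord0 i).
Proof.
split=> [[mg fg] i|H].
  by split; [exact: rV_coord_meas|exact: le_lt_trans (sqnorm_coord_le i mg) fg].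
have mg : measurable_fun D g by apply: measurable_fun_rV_on => i; exact: L2_meas (H i).
split => //; rewrite /sqnormv.
have fi : integrableR mu D (fun x => dot (g x) (g x)).
  by apply: intR_sum => // i _; exact: L2_mul.
by rewrite (intR_EFin mD fi) ltry.
Qed.

Lemma L2v_coord g i : L2v mu D g -> L2 mu D (fun x => g x ord0 i).
Proof. by move/L2vP. Qed.

Lemma L2v_dot g h : L2v mu D g -> L2v mu D h -> integrableR mu D (fun x => dot (g x) (h x)).
Proof. by move=> g2 h2; apply: intR_sum => // i _; apply: L2_mul => //; exact: L2v_coord. Qed.

Lemma L2v_sub g h : L2v mu D g -> L2v mu D h -> L2v mu D (fun x => g x - h x).
Proof.
move=> g2 h2; apply/L2vP => i; have := L2B mD (L2v_coord i g2) (L2v_coord i h2).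
by apply: eq_L2 => // x _; rewrite !mxE.
Qed.

Lemma sqnormvE g : L2v mu D g -> sqnormv mu D g = (\int[mu]_(x in D) dot (g x) (g x))%:E.
Proof. by move=> g2; rewrite /sqnormv (intR_EFin mD (L2v_dot g2 g2)). Qed.

Lemma sqnorm_sub_le (f f' : X -> R) : measurable_fun D f -> measurable_fun D f' ->
  (sqnorm mu D (fun x => (f x - f' x)%R) <= 2%:E * sqnorm mu D f + 2%:E * sqnorm mu D f')%E.
Proof.
move=> mf mf'; rewrite /sqnorm.
rewrite -!ge0_integralZl//; try by [move=> x _; rewrite lee_fin sqr_ge0|
  apply/measurable_EFinP; exact: measurable_funX].
rewrite -ge0_integralD//; first last.
- by apply/measurable_EFinP; apply: measurable_funM => //; exact: measurable_funX.
- by move=> x _; rewrite lee_fin mulr_ge0// sqr_ge0.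
- by apply/measurable_EFinP; apply: measurable_funM => //; exact: measurable_funX.
- by move=> x _; rewrite lee_fin mulr_ge0// sqr_ge0.
apply: ge0_le_integral => //.
- by move=> x _; rewrite lee_fin sqr_ge0.
- by apply/measurable_EFinP; apply: measurable_funX; exact: measurable_funB.
- apply/measurable_EFinP; apply: measurable_funD;
   by apply: measurable_funM => //; exact: measurable_funX.
- move=> x _; rewrite -!EFinM -EFinD lee_fin.
  by have := sqr_ge0 (f x + f' x); lra.
Qed.

Lemma sqnormv_sub_le g h : measurable_fun D g -> measurable_fun D h ->
  (sqnormv mu D (fun x => (g x - h x)%R) <= 2%:E * sqnormv mu D g + 2%:E * sqnormv mu D h)%E.
Proof.
move=> mg mh; rewrite /sqnormv.
rewrite -!ge0_integralZl//; try by [move=> x _; rewrite lee_fin dot_ge0|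
  apply/measurable_EFinP; exact: measurable_dot].
rewrite -ge0_integralD//; first last.
- by apply/measurable_EFinP; apply: measurable_funM => //; exact: measurable_dot.
- by move=> x _; rewrite lee_fin mulr_ge0// dot_ge0.
- by apply/measurable_EFinP; apply: measurable_funM => //; exact: measurable_dot.
- by move=> x _; rewrite lee_fin mulr_ge0// dot_ge0.
have mgh := measurable_fun_rVB mg mh.
apply: ge0_le_integral => //.
- by move=> x _; rewrite lee_fin dot_ge0.
- by apply/measurable_EFinP; exact: measurable_dot.
- apply/measurable_EFinP; apply: measurable_funD;
   by apply: measurable_funM => //; exact: measurable_dot.
- move=> x _; rewrite -!EFinM -EFinD lee_fin !dotE !mulr_sumr -big_split /=.
  apply: ler_sum => i _; rewrite !mxE.
  by have := sqr_ge0 (g x ord0 i + h x ord0 i); lra.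
Qed.

End vector_valued.

(** * Weak derivatives and zero traces on the space-time cylinder *)

Section space_time.
Context {R : realType} {d : nat}.
Variables (Om : set 'rV[R]_d) (T : R).
Hypotheses (Om_open : open Om) (T0 : 0 < T).
Hypothesis Om_fin : (lebesgue_rV R d Om < +oo)%E.
Local Notation leb := (lebesgue_rV R d : {measure set _ -> \bar R}).
Local Notation lebt := (@lebesgue_measure R).
Local Notation lebQ := ((leb \x lebt)%E : {measure set _ -> \bar R}).
Local Notation I_T := (`]0, T[%classic : set R).
Local Notation Q := (QT Om T).
Local Notation point := ('rV[R]_d * measurableTypeR R)%type.

Let mOm : measurable Om. Proof. exact: open_rV_measurable. Qed.
Let mI : @measurable _ (measurableTypeR R) I_T. Proof. exact: measurable_itv. Qed.
Let mQ : measurable (Q : set point). Proof. exact: QT_measurable. Qed.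
Let Ifin : (lebt I_T < +oo)%E. Proof. exact: lebesgue_itvoo_lty. Qed.

Lemma QT_finite : (lebQ Q < +oo)%E.
Proof.
rewrite /= /QT product_measure1E//; apply: lte_mul_pinfty => //.
by rewrite ge0_fin_numE.
Qed.

Lemma open_prod_measurable (A : set ('rV[R]_d * R)) : open A -> measurable (A : set point).
Proof.
move=> oA.
(* An open set is a countable union of rational products, hence measurable for
   the product sigma-algebra. *)
pose B (p : ('rV[rat]_d * 'rV[rat]_d) * (rat * rat)) : set point :=
  rat_box p.1 `*` `]ratr p.2.1, ratr p.2.2[%classic.
have -> : A = \bigcup_(p in [set p | B p `<=` A]) B p.
  apply/seteqP; split=> [[x t] Axt|z [p pA]]; last exact: pA.
  have : nbhs (x, t) A by exact: open_nbhs_nbhs.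
  move=> [[U V] /= [Ux Vt] UVA].
  have [U' [oU' U'x U'U]] : exists U', [/\ open U', U' x & U' `<=` U].
    by move: Ux; rewrite nbhsE => -[U' [oU' U'x] U'U]; exists U'.
  have : (\bigcup_(p in [set p | rat_box p `<=` U']) rat_box p) x by rewrite -open_rat_box.
  move=> [p pU px].
  move: Vt => /nbhs_ballP[e /= e0 eV].
  have [q1] := @rat_in_itvoo R (t - e) t ltac:(by rewrite ltrBlDr ltrDl).
  rewrite in_itv /= => /andP[q1a q1b].
  have [q2] := @rat_in_itvoo R t (t + e) ltac:(by rewrite ltrDl).
  rewrite in_itv /= => /andP[q2a q2b].
  exists (p, (q1, q2)) => /=; last by split => //=; rewrite in_itv /= q1b q2a.
  move=> [y s] [/= py]; rewrite in_itv /= => /andP[s1 s2].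
  apply: UVA; split => /=; first by apply: U'U; exact: pU.
  by apply: eV; rewrite /ball /= ltr_distlC; apply/andP; split; lra.
rewrite bigcup_mkcond; apply: countable_bigcupT_measurable; first exact: countableP.
move=> p; case: ifP => _ //; apply: measurableX; first exact: box_measurable.
exact: measurable_itv.
Qed.

Lemma continuous_prod_measurable (f : 'rV[R]_d * R -> R) : continuous f ->
  measurable_fun setT (f : point -> R).
Proof.
move=> /continuousP cf; apply: (measurability _ (RGenOpens.measurableE R)).
move=> _ [_ [a [b ->]] <-]; rewrite setTI; apply: open_prod_measurable.
exact/cf/interval_open.
Qed.

Lemma test_L2Q phi : test_function Q phi -> L2Q Om T phi.
Proof.
move=> tphi; have [M HM] := test_bounded tphi.
apply: (L2_bounded mQ (M := M) QT_finite) => //.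
apply: measurable_funTS; apply: continuous_prod_measurable; exact: test_continuous tphi.
Qed.

Lemma test_L2 psi : test_function Om psi -> L2 leb Om psi.
Proof.
move=> tpsi; have [M HM] := test_bounded tpsi.
apply: (L2_bounded mOm (M := M) Om_fin) => //.
apply: measurable_funTS; apply: continuous_rV_measurable; exact: test_continuous tpsi.
Qed.

Lemma fundamental_lemma_L2 f : L2Q Om T f ->
  (forall psi chi, test_function Om psi -> test_function I_T chi ->
    \int[lebQ]_(z in Q) (f z * (psi z.1 * chi z.2)) = 0) ->
  ae_eq lebQ Q f (fun=> 0).
Proof.
by move=> f2; apply: fundamental_lemma => //; exact: (L2_intR mQ QT_finite).
Qed.

Section weak_derivatives.
Implicit Types (v : 'rV[R]_d * R -> R) (g : 'rV[R]_d * R -> 'rV[R]_d).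

Lemma is_grad_grad v : (exists g, is_grad Om T v g) -> is_grad Om T v (grad Om T v).
Proof. by move=> [g hg]; have := @xgetPex _ (fun=> 0) [set g | is_grad Om T v g]; apply; exists g. Qed.

Lemma is_dt_dt v : (exists w, is_dt Om T v w) -> is_dt Om T v (dt Om T v).
Proof. by move=> [g hg]; have := @xgetPex _ (fun=> 0) [set w | is_dt Om T v w]; apply; exists g. Qed.

Lemma is_div_div (tau : 'rV[R]_d * R -> 'rV[R]_d) :
  (exists w : 'rV[R]_d * R -> R, is_div Om T tau w) -> is_div Om T tau (div Om T tau).
Proof. by move=> [w hw]; have := @xgetPex _ (fun=> 0) [set w | is_div Om T tau w]; apply; exists w. Qed.

(** Subtract the two identities for test functions of product form and apply the
    fundamental lemma coordinate by coordinate. *)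
Lemma is_grad_unique v g g' : is_grad Om T v g -> is_grad Om T v g' -> ae_eq lebQ Q g g'.
Proof.
move=> [g2 Hg] [g'2 Hg'].
have H i : {ae lebQ, forall z, Q z -> g z ord0 i - g' z ord0 i = 0}.
  have gi := L2v_coord mQ i g2; have g'i := L2v_coord mQ i g'2.
  apply: fundamental_lemma_L2; first exact: L2B.
  move=> psi chi tpsi tchi; have tp := test_function_prod tpsi tchi.
  have tp2 := test_L2Q tp.
  rewrite (@eq_Rint _ point _ lebQ Q _ (fun z => g z ord0 i * (psi z.1 * chi z.2) -
    g' z ord0 i * (psi z.1 * chi z.2))); last by move=> z _; rewrite mulrBl.
  rewrite (RintegralB mQ (L2_mul mQ gi tp2) (L2_mul mQ g'i tp2)).
  have := Hg _ i tp; rewrite (Hg' _ i tp) => /oppr_inj ->.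
  by rewrite subrr.
have := ae_forall_countable H; apply: filterS => z h Qz.
by apply/rowP => i; apply/eqP; rewrite -subr_eq0 (h i Qz).
Qed.

Lemma is_grad_sub v v' g g' : L2Q Om T v -> L2Q Om T v' ->
  is_grad Om T v g -> is_grad Om T v' g' -> is_grad Om T (v \- v') (fun z => g z - g' z).
Proof.
move=> v2 v'2 [g2 Hg] [g'2 Hg']; split; first exact: (L2v_sub mQ).
move=> phi i tphi; have tD := test_derive ((delta_mx ord0 i, 0) : 'rV[R]_d * R) tphi.
have D2 := test_L2Q tD; have p2 := test_L2Q tphi.
rewrite (@eq_Rint _ point _ lebQ Q _ (fun z => v z * 'D_((delta_mx ord0 i, 0) : 'rV[R]_d * R) phi z -
   v' z * 'D_((delta_mx ord0 i, 0) : 'rV[R]_d * R) phi z)); last by move=> z _; rewrite mulrBl.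
rewrite (RintegralB mQ (L2_mul mQ v2 D2) (L2_mul mQ v'2 D2)) Hg// Hg'//.
rewrite (@eq_Rint _ point _ lebQ Q (fun z => (g z - g' z) ord0 i * phi z) (fun z => g z ord0 i * phi z - g' z ord0 i * phi z)); last first.
  by move=> z _; rewrite !mxE mulrBl.
rewrite (RintegralB mQ (L2_mul mQ (L2v_coord mQ i g2) p2) (L2_mul mQ (L2v_coord mQ i g'2) p2)).
by rewrite opprB opprK addrC.
Qed.

End weak_derivatives.

Section H10.
Implicit Types (u : 'rV[R]_d -> R) (g : 'rV[R]_d -> 'rV[R]_d).

Lemma test_meas psi : test_function Om psi -> measurable_fun Om psi.
Proof. by move/test_L2; case. Qed.

Lemma classical_grad_L2v psi : test_function Om psi -> L2v leb Om (classical_grad psi).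
Proof.
move=> tpsi; apply/(L2vP leb mOm) => i.
have := test_L2 (test_derive (delta_mx ord0 i) tpsi).
by apply: (eq_L2 mOm) => x _; rewrite !mxE.
Qed.

Lemma test_sub psi psi' : test_function Om psi -> test_function Om psi' ->
  test_function Om (fun x => psi x - psi' x).
Proof.
move=> [s [K [cK KO z]]] [s' [K' [cK' KO' z']]]; split; first by move=> k; exact: CkB.
exists (K `|` K'); split.
- exact: compactU.
- by move=> x [/KO|/KO'].
- by move=> x /not_orP[/z -> /z' ->]; rewrite subr0.
Qed.

Lemma H10_sub u g u' g' : measurable_fun Om u -> measurable_fun Om g ->
  measurable_fun Om u' -> measurable_fun Om g' ->
  H10_with_grad Om u g -> H10_with_grad Om u' g' ->
  H10_with_grad Om (fun x => u x - u' x) (fun x => g x - g' x).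
Proof.
move=> mu mg mu' mg' [phi [tp cu cg]] [phi' [tp' cu' cg']].
have sq (a b c : nat -> \bar R) : (forall k, 0 <= c k)%E ->
    (forall k, c k <= 2%:E * a k + 2%:E * b k)%E ->
    a @ \oo --> 0%E -> b @ \oo --> 0%E -> c @ \oo --> 0%E.
  move=> c0 cab a0 b0.
  have h : (fun k => 2%:E * a k + 2%:E * b k)%E @ \oo --> 0%E.
    rewrite -[X in _ --> X]adde0; apply: cvgeD => //.
      by rewrite -[X in _ --> X](mule0 2%:E); apply: cvgeZl.
    by rewrite -[X in _ --> X](mule0 2%:E); apply: cvgeZl.
  apply: (@squeeze_cvge _ _ _ _ (fun=> 0%E) _ _ _ _ (cvg_cst _) h).
  by apply: nearW => k; rewrite c0 cab.
exists (fun k x => phi k x - phi' k x); split.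
- by move=> k; exact: test_sub.
- apply: (sq _ _ _ _ _ cu cu') => k; first exact: sqnorm_ge0.
  rewrite (_ : (fun x => _) = (fun x => (phi k x - u x) - (phi' k x - u' x))).
    by apply: sqnorm_sub_le => //; apply: measurable_funB => //; exact: test_meas.
  by apply/funext => x; ring.
- apply: (sq _ _ _ _ _ cg cg') => k; first exact: sqnormv_ge0.
  rewrite (_ : (fun x => _) = (fun x => (classical_grad (phi k) x - g x) - (classical_grad (phi' k) x - g' x))).
    have [m1 _] := classical_grad_L2v (tp k); have [m2 _] := classical_grad_L2v (tp' k).
    by apply: sqnormv_sub_le => //; exact: measurable_fun_rVB.
  apply/funext => x; apply/rowP => i; rewrite !mxE.
  rewrite (deriveB (@test_derivable _ _ _ _ x (delta_mx ord0 i) (tp k)) (@test_derivable _ _ _ _ x (delta_mx ord0 i) (tp' k))).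
  by ring.
Qed.

Lemma H10_ae u g g' : measurable_fun Om g -> measurable_fun Om g' -> ae_eq leb Om g g' ->
  H10_with_grad Om u g -> H10_with_grad Om u g'.
Proof.
move=> mg mg' gg' [phi [tp cu cg]]; exists phi; split => //.
rewrite (_ : (fun k => _) = (fun k => sqnormv leb Om (fun x => classical_grad (phi k) x - g x)))//.
apply/funext => k; apply: ae_eq_integral => //.
- apply/measurable_EFinP.
  have [m1 _] := classical_grad_L2v (tp k).
  by apply: measurable_dot; exact: measurable_fun_rVB.
- apply/measurable_EFinP.
  have [m1 _] := classical_grad_L2v (tp k).
  by apply: measurable_dot; exact: measurable_fun_rVB.
- by apply: filterS gg' => x /= + Ox => /(_ Ox) ->.
Qed.

End H10.

Lemma L2Qv_slice2_meas (g : 'rV[R]_d * R -> 'rV[R]_d) t : measurable_fun Q g -> I_T t ->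
  measurable_fun Om (fun x => g (x, t)).
Proof.
move=> mg It; apply: (measurable_fun_rV_on mOm) => i.
exact: (@slice2_meas _ _ _ (measurableTypeR R) R Om I_T mOm mI _ t (rV_coord_meas i mg) It).
Qed.

(** The trace condition refers to the chosen representative of the gradient, so
    the gradient of the difference must be compared with the difference of the
    gradients, almost everywhere on almost every slice. *)
Lemma zero_trace_sub v v' : L2Q Om T v -> L2Q Om T v' ->
  (exists g, is_grad Om T v g) -> (exists g, is_grad Om T v' g) ->
  zero_lateral_trace Om T v -> zero_lateral_trace Om T v' -> zero_lateral_trace Om T (v \- v').
Proof.
move=> v2 v'2 /is_grad_grad hg /is_grad_grad hg'.
have hs := is_grad_sub v2 v'2 hg hg'.
have hd : is_grad Om T (v \- v') (grad Om T (v \- v')) by apply: is_grad_grad; eexists; exact: hs.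
have /(@ae_prod_slice2 _ _ _ _ _ leb lebt) E := is_grad_unique hs hd.
have [[mg _] _] := hg; have [[mg' _] _] := hg'; have [[md _] _] := hd.
apply: filterS3 E => t h3 h1 h2 It.
have m1 := @slice2_meas _ _ _ (measurableTypeR R) R Om I_T mOm mI _ t (L2_meas v2) It.
have m2 := @slice2_meas _ _ _ (measurableTypeR R) R Om I_T mOm mI _ t (L2_meas v'2) It.
have := H10_sub m1 (L2Qv_slice2_meas mg It) m2 (L2Qv_slice2_meas mg' It) (h1 It) (h2 It).
apply: H10_ae.
- by apply: (measurable_fun_rVB mOm); exact: L2Qv_slice2_meas.
- exact: L2Qv_slice2_meas.
- by apply: filterS h3 => x /= h Ox; exact: h.
Qed.

End space_time.

(** * The half-order norm and the half-order form *)

Section space_time_fourier.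
Context {R : realType} {d : nat}.
Variables (Om : set 'rV[R]_d) (T : R).
Hypotheses (Om_open : open Om) (T0 : 0 < T).
Hypothesis Om_fin : (lebesgue_rV R d Om < +oo)%E.
Local Notation leb := (lebesgue_rV R d : {measure set _ -> \bar R}).
Local Notation lebt := (@lebesgue_measure R).
Local Notation lebQ := ((leb \x lebt)%E : {measure set _ -> \bar R}).
Local Notation I_T := (`]0, T[%classic : set R).
Local Notation Q := (QT Om T).
Local Notation point := ('rV[R]_d * measurableTypeR R)%type.
Local Notation om := (omega T).
Local Notation fc := (fourier_cos T).
Local Notation fs := (fourier_sin T).
Implicit Types (v w y : 'rV[R]_d * R -> R).

Let mOm : measurable Om. Proof. exact: open_rV_measurable. Qed.
Let mI : @measurable _ (measurableTypeR R) I_T. Proof. exact: measurable_itv. Qed.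
Let mQ : measurable (Q : set point). Proof. exact: QT_measurable. Qed.
Let Ifin : (lebt I_T < +oo)%E. Proof. exact: lebesgue_itvoo_lty. Qed.

Lemma slice1_L2Q v : L2Q Om T v ->
  {ae leb, forall x, Om x -> L2 lebt I_T (fun t => v (x, t))}.
Proof. by move=> v2; exact: (slice1_L2 mOm mI v2). Qed.

Lemma slice2_L2Q v : L2Q Om T v ->
  {ae lebt, forall t, I_T t -> L2 leb Om (fun x => v (x, t))}.
Proof. by move=> v2; exact: (slice2_L2 mOm mI v2). Qed.

Lemma Fubini1Q v : integrableR lebQ Q v ->
  \int[lebQ]_(z in Q) v z = \int[leb]_(x in Om) \int[lebt]_(t in I_T) v (x, t).
Proof. by move=> iv; exact: (Fubini1 mOm mI iv). Qed.

Lemma Fubini2Q v : integrableR lebQ Q v ->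
  \int[lebQ]_(z in Q) v z = \int[lebt]_(t in I_T) \int[leb]_(x in Om) v (x, t).
Proof. by move=> iv; exact: (Fubini2 mOm mI iv). Qed.

Lemma Rint_timeQ v : integrableR lebQ Q v ->
  integrableR leb Om (fun x => \int[lebt]_(t in I_T) v (x, t)).
Proof. by move=> iv; exact: (Rint_slice1_intR mOm mI iv). Qed.

Lemma measurable_fun_fst_on (f : 'rV[R]_d -> R) : measurable_fun Om f ->
  measurable_fun (Q : set point) (fun z : point => f z.1).
Proof.
move=> mf; apply: (measurable_comp mOm _ mf) => //; last exact: measurable_funTS.
by move=> _ [[x t] [Ox _] <-].
Qed.

Lemma L2Q_mul_time (c : R -> R) v : continuous c -> L2Q Om T v ->
  L2Q Om T (fun z => v z * c z.2).
Proof.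
move=> cc v2; have [M HM] := continuous_itv_bounded 0 T cc.
have h : L2 lebQ Q (fun z : point => c z.2 * v z).
  apply: (L2_bmul mQ (M := M)) => // [|[x t] [_ It]]; last exact: HM.
  apply: measurable_funTS; apply: (@measurableT_comp _ _ _ point (measurableTypeR R) R) => //.
  exact: continuous_measurable_fun.
by apply: (eq_L2 mQ _ h) => z _; rewrite mulrC.
Qed.

(** Cauchy-Schwarz on each slice, against the constant [1]. *)
Lemma Rint_time_L2 v : L2Q Om T v ->
  L2 leb Om (fun x => \int[lebt]_(t in I_T) v (x, t)).
Proof.
move=> v2; have iv := L2_intR mQ (QT_finite T Om_open Om_fin) v2.
have isq := Rint_timeQ (L2_sq mQ v2).
apply: (L2_sq_le_ae mOm (intR_meas (Rint_timeQ iv)) (intRZ mOm T isq)).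
have := slice1_L2Q v2; apply: filterS => x /= + Ox => /(_ Ox) vx2.
have := Rint_CS mI vx2 (L2_cst T 1).
rewrite (@eq_Rint _ (measurableTypeR R) _ lebt I_T _ (fun t => v (x, t))); last by move=> t _; rewrite mulr1.
rewrite expr1n (Rint_cstI T0) mul1r => h.
rewrite -[X in X <= _](ger0_norm (sqr_ge0 _)) normrX.
apply: (le_trans (lerXn2r 2 _ _ h)); rewrite ?nnegrE ?mulr_ge0 ?sqrtr_ge0//.
have i0 : 0 <= \int[lebt]_(t in I_T) (v (x, t) ^+ 2).
  by apply: Rintegral_ge0 => t _; exact: sqr_ge0.
by rewrite exprMn (sqr_sqrtr i0) (sqr_sqrtr (ltW T0)) mulrC.
Qed.

Lemma fourier_cos_L2 v k : L2Q Om T v -> L2 leb Om (fc v k).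
Proof.
move=> v2; have h := @L2Q_mul_time (fun t => cos (k%:R * om * t)) v (@continuous_cosM _ _) v2.
exact: (L2Z mOm (2 / T) (Rint_time_L2 h)).
Qed.

Lemma fourier_sin_L2 v k : L2Q Om T v -> L2 leb Om (fs v k).
Proof.
move=> v2; have h := @L2Q_mul_time (fun t => sin (k%:R * om * t)) v (@continuous_sinM _ _) v2.
exact: (L2Z mOm (2 / T) (Rint_time_L2 h)).
Qed.

(** Linearity of the coefficients holds only at the points whose slices are square
    integrable. *)
Lemma fourierB v w : L2Q Om T v -> L2Q Om T w ->
  {ae leb, forall x, Om x -> forall k,
    fc (v \- w) k x = fc v k x - fc w k x /\ fs (v \- w) k x = fs v k x - fs w k x}.
Proof.
move=> v2 w2; have := slice1_L2Q w2; have := slice1_L2Q v2.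
apply: filterS2 => x vx wx Ox k; have {}vx := vx Ox; have {}wx := wx Ox.
have e : forall t, I_T t -> v (x, t) - w (x, t) = 1 * v (x, t) + (-1) * w (x, t).
  by move=> t _; rewrite mul1r mulN1r.
have := @fcosL R T 1 (-1) _ _ k vx wx; have := @fsinL R T 1 (-1) _ _ k vx wx.
rewrite -(eq_fcos _ e) -(eq_fsin _ e) !mul1r !mulN1r => s c.
by split; [exact: c|exact: s].
Qed.

(** The squared half-order norm is the sum of these energies, up to the factor
    [T / 2]. *)
Definition half_energy v k : R := k%:R * om *
  (\int[leb]_(x in Om) (fc v k x ^+ 2) + \int[leb]_(x in Om) (fs v k x ^+ 2)).

Lemma half_energy_ge0 v k : 0 <= half_energy v k.
Proof.
apply: mulr_ge0; first by rewrite mulr_ge0// ltW// omega_gt0.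
by apply: addr_ge0; apply: Rintegral_ge0 => x _; exact: sqr_ge0.
Qed.

Lemma sqnorm_half_term v k : L2Q Om T v ->
  ((k%:R * om)%:E * (sqnorm leb Om (fc v k) + sqnorm leb Om (fs v k)) = (half_energy v k)%:E)%E.
Proof.
by move=> v2; rewrite (sqnormE mOm (fourier_cos_L2 k v2)) (sqnormE mOm (fourier_sin_L2 k v2)).
Qed.

Lemma sqnorm_half_energy v : L2Q Om T v ->
  (sqnorm_half Om T v = (T / 2)%:E * \sum_(1 <= k <oo) (half_energy v k)%:E)%E.
Proof.
by move=> v2; rewrite /sqnorm_half; congr (_ * _)%E; apply: eq_eseriesr => k _;
  exact: sqnorm_half_term.
Qed.

Lemma sqnorm_half_ge0 v : (0 <= sqnorm_half Om T v)%E.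
Proof.
apply: mule_ge0; first by rewrite lee_fin divr_ge0// ltW.
apply: nneseries_ge0 => k _ _; apply: mule_ge0.
  by rewrite lee_fin mulr_ge0// ltW// omega_gt0.
by apply: adde_ge0; exact: sqnorm_ge0.
Qed.

Lemma sqnorm_half_ltyP v : L2Q Om T v -> (sqnorm_half Om T v < +oo)%E <->
  exists M, forall N, \sum_(1 <= k < N) half_energy v k <= M.
Proof.
move=> v2; rewrite sqnorm_half_energy//.
have T2 : 0 < T / 2 by rewrite divr_gt0.
have pos : forall n, (1 <= n)%N -> xpredT n -> (0 <= (half_energy v n)%:E)%E.
  by move=> n _ _; rewrite lee_fin half_energy_ge0.
split=> [|[M HM]].
  set s := (\sum_(1 <= k <oo) _)%E => slt.
  have s0 : (0 <= s)%E by exact: nneseries_ge0.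
  have sfin : s \is a fin_num.
    rewrite ge0_fin_numE// ltey; apply/negP => /eqP soo; move: slt.
    by rewrite soo gt0_muley ?lte_fin// ltxx.
  exists (fine s) => N; rewrite -lee_fin -sumEFin fineK//.
  exact: (nneseries_lim_ge N pos).
have : (\sum_(1 <= k <oo) (half_energy v k)%:E <= M%:E)%E.
  apply: lime_le; first exact: is_cvg_nneseries.
  by apply: nearW => N; rewrite sumEFin lee_fin.
move=> h; apply: (@le_lt_trans _ _ ((T / 2)%:E * M%:E)%E); last by rewrite -EFinM ltry.
by rewrite lee_pmul2l// lte_fin.
Qed.

Lemma half_energy_sub v w k : L2Q Om T v -> L2Q Om T w ->
  half_energy (v \- w) k <= 2 * half_energy v k + 2 * half_energy w k.
Proof.
move=> v2 w2; have vw2 : L2Q Om T (v \- w) by exact: (L2B mQ v2 w2).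
rewrite /half_energy !(mulrCA 2) -mulrDr ler_wpM2l//.
  by rewrite mulr_ge0// ltW// omega_gt0.
have E := fourierB v2 w2.
have L (f g h : 'rV[R]_d -> R) : L2 leb Om f -> L2 leb Om g -> L2 leb Om h ->
    {ae leb, forall x, Om x -> h x = f x - g x} ->
    \int[leb]_(x in Om) (h x ^+ 2) <=
    2 * \int[leb]_(x in Om) (f x ^+ 2) + 2 * \int[leb]_(x in Om) (g x ^+ 2).
  move=> f2 g2 h2 hfg.
  rewrite -(RintegralZl _ mOm (L2_sq mOm f2)) -(RintegralZl _ mOm (L2_sq mOm g2)).
  have if2 := intRZ mOm 2 (L2_sq mOm f2); have ig2 := intRZ mOm 2 (L2_sq mOm g2).
  rewrite -(RintegralD mOm if2 ig2).
  have d2 := L2B mOm f2 g2.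
  rewrite (@Rint_ae _ _ _ leb Om mOm (fun x => h x ^+ 2) (fun x => (f x - g x) ^+ 2)).
  - apply: (Rint_le mOm (L2_sq mOm d2) (intRD mOm if2 ig2)) => x _.
    by have := sqr_ge0 (f x + g x); lra.
  - exact: intR_meas (L2_sq mOm h2).
  - exact: intR_meas (L2_sq mOm d2).
  - by apply: filterS hfg => x /= + Ox => /(_ Ox) ->.
have c : \int[leb]_(x in Om) (fc (v \- w) k x ^+ 2) <=
    2 * \int[leb]_(x in Om) (fc v k x ^+ 2) + 2 * \int[leb]_(x in Om) (fc w k x ^+ 2).
  apply: L; try exact: fourier_cos_L2.
  by apply: filterS E => x h Ox; have [] := h Ox k.
have s : \int[leb]_(x in Om) (fs (v \- w) k x ^+ 2) <=
    2 * \int[leb]_(x in Om) (fs v k x ^+ 2) + 2 * \int[leb]_(x in Om) (fs w k x ^+ 2).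
  apply: L; try exact: fourier_sin_L2.
  by apply: filterS E => x h Ox; have [] := h Ox k.
rewrite (mulrDr 2) (mulrDr 2) addrACA; exact: lerD c s.
Qed.

Lemma sqnorm_half_sub v w : L2Q Om T v -> L2Q Om T w ->
  (sqnorm_half Om T v < +oo)%E -> (sqnorm_half Om T w < +oo)%E ->
  (sqnorm_half Om T (v \- w)%R < +oo)%E.
Proof.
move=> v2 w2 /(sqnorm_half_ltyP v2)[M HM] /(sqnorm_half_ltyP w2)[M' HM'].
apply/(sqnorm_half_ltyP (L2B mQ v2 w2)); exists (2 * M + 2 * M') => N.
apply: (@le_trans _ _ (\sum_(1 <= k < N) (2 * half_energy v k + 2 * half_energy w k))).
  by apply: ler_sum => k _; exact: half_energy_sub.
have two : 0 <= 2 :> R by [].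
rewrite big_split /= -!mulr_sumr.
exact: (lerD (ler_wpM2l two (HM N)) (ler_wpM2l two (HM' N))).
Qed.

Lemma H1half_sub v w : H1half Om T v -> H1half Om T w -> H1half Om T (v \- w).
Proof.
move=> [v2 gv hv zv] [w2 gw hw zw]; split.
- exact: (L2B mQ v2 w2).
- by have := is_grad_sub Om_open Om_fin v2 w2 (is_grad_grad gv) (is_grad_grad gw); eexists; exact: H.
- exact: sqnorm_half_sub.
- exact: zero_trace_sub.
Qed.

Section half_form.
Variables (sig : 'rV[R]_d -> R) (sig_up : R).
Hypothesis sig_meas : measurable_fun Om sig.
Hypothesis sig_bd : forall x, Om x -> `|sig x| <= sig_up.

Definition half_term y v k : R := k%:R * om *
  \int[leb]_(x in Om) (sig x * (fc y k x * - fs v k x + fs y k x * fc v k x)).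

(** The term of index [0] vanishes, so the sum may start there. *)
Lemma half_formE y v : half_form Om T sig y v = T / 2 * limn (series (half_term y v)).
Proof.
congr (_ * _); congr (lim (_ @ \oo)); apply/funext => N; rewrite /series /=.
case: N => [|N]; first by rewrite !big_geq.
by rewrite [RHS]big_ltn// /half_term !mul0r add0r.
Qed.

Lemma half_term_intR y v k : L2Q Om T y -> L2Q Om T v -> integrableR leb Om
  (fun x => sig x * (fc y k x * - fs v k x + fs y k x * fc v k x)).
Proof.
move=> y2 v2.
have a := L2_mul mOm (L2_bmul mOm sig_meas sig_bd (fourier_cos_L2 k y2)) (L2N mOm (fourier_sin_L2 k v2)).
have b := L2_mul mOm (L2_bmul mOm sig_meas sig_bd (fourier_sin_L2 k y2)) (fourier_cos_L2 k v2).
by apply: eq_intR (intRD mOm a b) => // x _; rewrite mulrDr !mulrA.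
Qed.

Lemma half_term_le y v k : L2Q Om T y -> L2Q Om T v ->
  `|half_term y v k| <= `|sig_up| * (half_energy y k + half_energy v k).
Proof.
move=> y2 v2; have k0 : 0 <= k%:R * om by rewrite mulr_ge0// ltW// omega_gt0.
rewrite /half_term normrM ger0_norm// /half_energy -mulrDr [leRHS]mulrCA; apply: ler_wpM2l => //.
have hi := half_term_intR k y2 v2.
have cy := L2_sq mOm (fourier_cos_L2 k y2); have sy := L2_sq mOm (fourier_sin_L2 k y2).
have cv := L2_sq mOm (fourier_cos_L2 k v2); have sv := L2_sq mOm (fourier_sin_L2 k v2).
apply: (le_trans (le_normr_Rintegral mOm hi)).
rewrite -(RintegralD mOm cy sy) -(RintegralD mOm cv sv).
have iy := intRD mOm cy sy; have iv := intRD mOm cv sv.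
rewrite -(RintegralD mOm iy iv) -(RintegralZl _ mOm (intRD mOm iy iv)).
apply: (Rint_le mOm (integrable_norm hi) (intRZ mOm _ (intRD mOm iy iv))) => x Ox.
rewrite /= normrM; apply: ler_pM => //.
  by rewrite (le_trans (sig_bd Ox))// ler_norm.
have := norm_dot2_le (fc y k x) (- fs v k x) (fs y k x) (fc v k x).
by rewrite mulrNN -!expr2 [X in _ <= _ + X]addrC.
Qed.

(** Absolute convergence, by comparison with the energies of both arguments.  It is
    what makes the form, defined as a limit, linear in its first argument. *)
Lemma cvg_half_term y v : L2Q Om T y -> L2Q Om T v ->
  (sqnorm_half Om T y < +oo)%E -> (sqnorm_half Om T v < +oo)%E ->
  cvgn (series (half_term y v)).
Proof.
move=> y2 v2 /(sqnorm_half_ltyP y2)[M HM] /(sqnorm_half_ltyP v2)[M' HM'].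
apply: normed_cvg; apply: nondecreasing_is_cvgn.
  apply/nondecreasing_seqP => n; rewrite /= !seriesEnat /= big_nat_recr//= lerDl.
  exact: normr_ge0.
exists (`|sig_up| * (M + M')) => _ [N _ <-]; rewrite /series /=.
apply: (@le_trans _ _ (\sum_(0 <= k < N) `|sig_up| * (half_energy y k + half_energy v k))).
  by apply: ler_sum => k _; exact: half_term_le.
have e w : \sum_(0 <= k < N) half_energy w k = \sum_(1 <= k < N) half_energy w k.
  case: N => [|N]; first by rewrite !big_geq.
  by rewrite [LHS]big_ltn// /half_energy !mul0r add0r.
rewrite -mulr_sumr big_split /= !e.
exact: (ler_wpM2l (normr_ge0 _) (lerD (HM N) (HM' N))).
Qed.

Lemma half_form_subl y w v : L2Q Om T y -> L2Q Om T w -> L2Q Om T v ->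
  (sqnorm_half Om T y < +oo)%E -> (sqnorm_half Om T w < +oo)%E ->
  (sqnorm_half Om T v < +oo)%E ->
  half_form Om T sig (y \- w) v = half_form Om T sig y v - half_form Om T sig w v.
Proof.
move=> y2 w2 v2 hy hw hv; rewrite !half_formE -mulrBr; congr (_ * _).
rewrite -limB; [|exact: cvg_half_term|exact: cvg_half_term].
congr (lim (_ @ \oo)); apply/funext => N; rewrite /series /= fctE -sumrB.
apply: eq_bigr => k _; rewrite /half_term -mulrBr; congr (_ * _).
have iy := half_term_intR k y2 v2; have iw := half_term_intR k w2 v2.
have yw2 : L2Q Om T (y \- w) by exact: (L2B mQ y2 w2).
rewrite -(RintegralB mOm iy iw); apply: (Rint_ae mOm).
- exact: intR_meas (half_term_intR k yw2 v2).
- exact: intR_meas (intRB mOm iy iw).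
- by have := fourierB y2 w2; apply: filterS => x h Ox; have [-> ->] := h Ox k; ring.
Qed.

End half_form.
End space_time_fourier.

(** * Fourier coefficients of a periodic time derivative *)

Section time_derivative.
Context {R : realType} {d : nat}.
Variables (Om : set 'rV[R]_d) (T : R).
Hypotheses (Om_open : open Om) (T0 : 0 < T).
Hypothesis Om_fin : (lebesgue_rV R d Om < +oo)%E.
Local Notation leb := (lebesgue_rV R d : {measure set _ -> \bar R}).
Local Notation lebt := (@lebesgue_measure R).
Local Notation lebQ := ((leb \x lebt)%E : {measure set _ -> \bar R}).
Local Notation I_T := (`]0, T[%classic : set R).
Local Notation Q := (QT Om T).
Local Notation point := ('rV[R]_d * measurableTypeR R)%type.
Local Notation om := (omega T).
Local Notation fc := (fourier_cos T).
Local Notation fs := (fourier_sin T).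

Let mOm : measurable Om. Proof. exact: open_rV_measurable. Qed.
Let mI : @measurable _ (measurableTypeR R) I_T. Proof. exact: measurable_itv. Qed.
Let mQ : measurable (Q : set point). Proof. exact: QT_measurable. Qed.
Let Ifin : (lebt I_T < +oo)%E. Proof. exact: lebesgue_itvoo_lty. Qed.
Let Qfin : (lebQ Q < +oo)%E. Proof. exact: QT_finite. Qed.

(** Functions of the space variable become functions on the cylinder, where the
    fundamental lemma applies to them. *)
Lemma intR_fst (A : 'rV[R]_d -> R) : integrableR leb Om A ->
  integrableR lebQ Q (fun z : point => A z.1).
Proof.
move=> iA; apply/(intR_restrict _ _ mQ).
have mA := measurable_fun_fst_on (T := T) Om_open (intR_meas iA).
have mR : measurable_fun setT (EFin \o ((fun z : point => A z.1) \_ Q)).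
  by apply/measurable_EFinP; apply/(measurable_restrictT _ mQ).
apply/(integrable12ltyP leb lebt mR).
rewrite (_ : (fun x => _) = (fun x => `|(A \_ Om) x|%:E * lebt I_T)%E); last first.
  apply/funext => x.
  have e t : ((fun z : point => A z.1) \_ Q) (x, t) =
      (if x \in Om then (fun=> A x) \_ I_T else fun=> 0) t.
    by have := congr1 (@^~ t) (@restrict_slice1 _ _ _ (measurableTypeR R) R Om I_T (fun z : point => A z.1) x).
  rewrite /= patchE; case: ifPn => Ox; last first.
    rewrite normr0 mul0e; apply: integral0_eq => t _ /=.
    by rewrite e (negbTE Ox) normr0.
  rewrite -(integral_cst lebt mI) integral_mkcond; apply: eq_integral => t _ /=.
  by rewrite e Ox !patchE; case: ifP; rewrite //= normr0.
rewrite ge0_integralZr//; first last.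
- by apply/measurable_EFinP; apply: measurableT_comp => //; apply/(measurable_restrictT _ mOm); exact: intR_meas iA.
apply: lte_mul_pinfty.
- by apply: integral_ge0.
- rewrite ge0_fin_numE; last by apply: integral_ge0.
  by have /integrableP[] := (intR_restrict leb A mOm).1 iA.
- exact: Ifin.
Qed.

Lemma test_fst_L2Q psi : test_function Om psi -> L2Q Om T (fun z : point => psi z.1).
Proof.
move=> tpsi; have [M HM] := test_bounded tpsi.
apply: (L2_bounded mQ (M := M) Qfin) => //.
apply: measurable_funTS; apply: continuous_prod_measurable.
move=> z; apply: (@continuous_comp _ _ _ (fst : 'rV[R]_d * R -> 'rV[R]_d) psi).
  exact: cvg_fst.
exact: (test_continuous tpsi).
Qed.

Variables (v w : 'rV[R]_d * R -> R).
Hypotheses (v2 : L2Q Om T v) (v_dt : is_dt Om T v w) (v_per : time_periodic Om T v).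

Let w2 : L2Q Om T w. Proof. by case: v_dt. Qed.

Section tested.
Variable psi : 'rV[R]_d -> R.
Hypothesis tpsi : test_function Om psi.

Let psi2 : L2 leb Om psi. Proof. exact: test_L2. Qed.
Let psiQ2 : L2Q Om T (fun z : point => psi z.1). Proof. exact: test_fst_L2Q. Qed.

Lemma tested_intR f : L2Q Om T f ->
  integrableR lebt I_T (fun t => \int[leb]_(x in Om) (f (x, t) * psi x)).
Proof. by move=> f2; have := Rint_slice2_intR mOm mI (L2_mul mQ f2 psiQ2). Qed.

Lemma tested_Fubini f (c : R -> R) : L2Q Om T f -> continuous c ->
  \int[lebQ]_(z in Q) (f z * (psi z.1 * c z.2)) =
  \int[lebt]_(t in I_T) ((\int[leb]_(x in Om) (f (x, t) * psi x)) * c t).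
Proof.
move=> f2 cc; have fc2 := L2Q_mul_time Om_open cc f2.
have h := L2_mul mQ fc2 psiQ2.
rewrite (@eq_Rint _ point _ lebQ Q _ (fun z => f z * c z.2 * psi z.1)); last first.
  by move=> z _; rewrite [psi _ * _]mulrC mulrA.
rewrite (Fubini2Q Om_open h); apply: (Rint_ae mI).
- exact: intR_meas (Rint_slice2_intR mOm mI h).
- apply: measurable_funM; first exact: intR_meas (tested_intR f2).
  by apply: measurable_funTS; exact: continuous_measurable_fun.
apply: (@filterS _ _ (ae_filter_ringOfSetsType _)) (slice2_L2Q Om_open f2) => t /= + It => /(_ It) ft2.
rewrite [RHS]mulrC -(RintegralZl _ mOm (L2_mul mOm ft2 psi2)).
by apply: eq_Rint => x _; ring.
Qed.

(** Pairing [v] with a test function in space gives a function of time that is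
    almost everywhere equal to one continuous up to the end points with equal end
    values, because [v] has a periodic representative with values in L2. *)
Lemma tested_periodic_ibp (c : R -> R) : smooth c -> c 0 = c T ->
  \int[lebt]_(t in I_T) ((\int[leb]_(x in Om) (v (x, t) * psi x)) * 'D_1 c t) =
  - \int[lebt]_(t in I_T) ((\int[leb]_(x in Om) (w (x, t) * psi x)) * c t).
Proof.
move=> sc cper; have [W [W2 Wv Wc Wper]] := v_per.
pose h t := \int[leb]_(x in Om) (W t x * psi x).
have h_cont t : 0 <= t <= T -> forall e, 0 < e ->
    exists2 del, 0 < del & forall s, 0 <= s <= T -> `|s - t| < del -> `|h s - h t| < e.
  move=> tT e e0; set n := Num.sqrt (\int[leb]_(x in Om) (psi x ^+ 2)).
  have n0 : 0 <= n by exact: sqrtr_ge0.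
  have n1 : 0 < n + 1 by rewrite ltr_wpDl.
  have en0 : 0 < (e / (n + 1)) ^+ 2 by rewrite exprn_gt0// divr_gt0.
  have [del del0 Hdel] := Wc t tT _ en0; exists del => // s sT st.
  have WB := L2B mOm (W2 s sT) (W2 t tT).
  have := Hdel s sT st; rewrite (sqnormE mOm WB) lte_fin => small.
  rewrite /h -(RintegralB mOm (L2_mul mOm (W2 s sT) psi2) (L2_mul mOm (W2 t tT) psi2)).
  rewrite (@eq_Rint _ _ _ leb Om _ (fun x => (W s x - W t x) * psi x)); last first.
    by move=> x _; rewrite mulrBl.
  apply: (le_lt_trans (Rint_CS mOm WB psi2)); rewrite -/n.
  (* The factor [n + 1] instead of [n] keeps the division legitimate when [psi] vanishes. *)
have small' : Num.sqrt (\int[leb]_(x in Om) ((W s x - W t x) ^+ 2)) < e / (n + 1).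
    rewrite -[X in _ < X](ger0_norm (ltW (divr_gt0 e0 n1))) -sqrtr_sqr.
    by rewrite ltr_sqrt.
  apply: (@le_lt_trans _ _ (e / (n + 1) * n)); first by rewrite ler_wpM2r// ltW.
  by rewrite mulrAC ltr_pdivrMr// ltr_pM2l// ltrDl.
have zT : (0 : R) <= 0 <= T by apply/andP; split => //; exact: ltW.
have TT : 0 <= T <= T by apply/andP; split => //; exact: ltW.
have hper : h 0 = h T.
  apply: (Rint_ae mOm).
  - exact: intR_meas (L2_mul mOm (W2 0 zT) psi2).
  - exact: intR_meas (L2_mul mOm (W2 T TT) psi2).
  - by apply: filterS Wper => x /= + Ox => /(_ Ox) ->.
have mh : measurable_fun (I_T : set (measurableTypeR R)) h.
  apply: open_continuous_measurable_fun => // t; rewrite inE => It.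
  apply/cvgrPdist_lt => e e0.
  have It' : 0 <= t <= T by move: It; rewrite /= in_itv /= => /andP[/ltW -> /ltW].
  have [del del0 Hdel] := h_cont t It' e e0.
  have nI : nbhs t I_T by apply: open_nbhs_nbhs; split => //; exact: itv_open.
  near=> s; rewrite distrC; apply: Hdel.
    have : I_T s by near: s.
    by rewrite /= in_itv /= => /andP[/ltW -> /ltW].
  by rewrite distrC; near: s; apply: (@cvgr_dist_lt _ _ _ _ _ id t) => //; exact: cvg_id.
have hae : {ae lebt, forall t, I_T t -> h t = \int[leb]_(x in Om) (v (x, t) * psi x)}.
  apply: (@filterS2 _ _ (ae_filter_ringOfSetsType _) _ _ _ _) Wv (slice2_L2Q Om_open v2) => t Wt vt It.
  have It' : 0 <= t <= T by move: It; rewrite /= in_itv /= => /andP[/ltW -> /ltW].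
  apply: (Rint_ae mOm).
  - exact: intR_meas (L2_mul mOm (W2 t It') psi2).
  - exact: intR_meas (L2_mul mOm (vt It) psi2).
  - by apply: filterS (Wt It) => x /= + Ox => /(_ Ox) ->.
have ih : integrableR lebt I_T h.
  apply: (intR_ae mI (intR_meas (tested_intR v2)) mh _ (tested_intR v2)).
  by apply: (@filterS _ _ (ae_filter_ringOfSetsType _)) hae => t /= + It => /(_ It) ->.
have hv (c' : R -> R) : continuous c' -> \int[lebt]_(t in I_T) (h t * c' t) =
    \int[lebt]_(t in I_T) ((\int[leb]_(x in Om) (v (x, t) * psi x)) * c' t).
  move=> cc'.
  have mc' : measurable_fun (I_T : set (measurableTypeR R)) c'.
    by apply: measurable_funTS; exact: continuous_measurable_fun.
  apply: (Rint_ae mI).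
  - exact: measurable_funM.
  - by apply: measurable_funM => //; exact: intR_meas (tested_intR v2).
  - by apply: (@filterS _ _ (ae_filter_ringOfSetsType _)) hae => t /= + It => /(_ It) ->.
rewrite -hv; last exact: (derive_smooth sc 0%N).
apply: (periodic_weak_ibp T0 h_cont hper ih (tested_intR w2)) => // chi tchi.
have tD : test_function I_T (fun t : R => 'D_1 chi t) by exact: test_derive.
rewrite hv; last exact: test_continuous tD.
rewrite -(tested_Fubini v2 (test_continuous tD)) -(tested_Fubini w2 (test_continuous tchi)).
have [_ /(_ _ (test_function_prod tpsi tchi)) <-] := v_dt.
apply: eq_Rint => z _; rewrite derive_prod_t//.
exact: test_derivable tchi.
Unshelve. all: by end_near.
Qed.

End tested.

(** By [tested_periodic_ibp] the difference of the two sides, a function of [x], is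
    orthogonal to all test functions in space. *)
Lemma slice_periodic_ibp (c : R -> R) : smooth c -> c 0 = c T ->
  {ae leb, forall x, Om x ->
    \int[lebt]_(t in I_T) (v (x, t) * 'D_1 c t) = - \int[lebt]_(t in I_T) (w (x, t) * c t)}.
Proof.
move=> sc cper.
have cc : continuous c := sc 0%N.
have cc' : continuous (fun t => 'D_1 c t) := derive_smooth sc 0%N.
have a2 := L2Q_mul_time Om_open cc' v2; have b2 := L2Q_mul_time Om_open cc w2.
have ab2 : L2Q Om T (fun z => v z * 'D_1 c z.2 + w z * c z.2) by exact: (L2D mQ a2 b2).
have iab := L2_intR mQ Qfin ab2.
pose A x := \int[lebt]_(t in I_T) (v (x, t) * 'D_1 c t + w (x, t) * c t).
have iA : integrableR leb Om A := Rint_timeQ Om_open iab.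
have A0 : ae_eq lebQ Q (fun z : point => A z.1) (fun=> 0).
  apply: (fundamental_lemma Om_open (intR_fst iA)) => psi chi tpsi tchi.
  have psi2 := test_L2 Om_open Om_fin tpsi.
  have psiQ2 := test_fst_L2Q tpsi.
  have A2 : L2 leb Om A := Rint_time_L2 Om_open T0 Om_fin ab2.
  have Apsi : \int[leb]_(x in Om) (A x * psi x) = 0.
    have i1 := L2_mul mQ ab2 psiQ2.
    transitivity (\int[lebQ]_(z in Q) ((v z * 'D_1 c z.2 + w z * c z.2) * psi z.1)).
      rewrite (Fubini1Q Om_open i1); apply: (Rint_ae mOm).
      - exact: intR_meas (L2_mul mOm A2 psi2).
      - exact: intR_meas (Rint_timeQ Om_open i1).
      have := slice1_L2Q Om_open ab2; apply: filterS => x /= + Ox => /(_ Ox) x2.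
      rewrite mulrC -(RintegralZl _ mI (L2_intR mI Ifin x2)).
      by apply: eq_Rint => t _; rewrite mulrC.
    have i2 := L2_mul mQ a2 psiQ2; have i3 := L2_mul mQ b2 psiQ2.
    rewrite (@eq_Rint _ point _ lebQ Q _ (fun z => v z * 'D_1 c z.2 * psi z.1 + w z * c z.2 * psi z.1)); last by move=> z _; rewrite mulrDl.
    rewrite (RintegralD mQ i2 i3).
    rewrite (@eq_Rint _ point _ lebQ Q (fun z => v z * _ * _) (fun z => v z * (psi z.1 * 'D_1 c z.2))); last by move=> z _; ring.
    rewrite (@eq_Rint _ point _ lebQ Q (fun z => w z * _ * _) (fun z => w z * (psi z.1 * c z.2))); last by move=> z _; ring.
    rewrite (tested_Fubini tpsi v2 cc') (tested_Fubini tpsi w2 cc).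
    by rewrite (tested_periodic_ibp tpsi sc cper) addNr.
  have AQ := intR_fst (L2_mul mOm A2 psi2).
  have [M HM] := test_bounded tchi.
  have ichi : integrableR lebt I_T chi by apply: continuous_intR; exact: test_continuous tchi.
  have i : integrableR lebQ Q (fun z : point => A z.1 * (psi z.1 * chi z.2)).
    apply: (le_intR mQ _ _ (intRZ mQ M (integrable_norm AQ))).
      rewrite (_ : (fun z => _) = (fun z : point => (A z.1 * psi z.1) * chi z.2)); last by apply/funext => z; rewrite mulrA.
      apply: measurable_funM; first exact: intR_meas AQ.
      apply: measurable_funTS; apply: (@measurableT_comp _ _ _ point (measurableTypeR R) R) => //.
      exact: continuous_measurable_fun (test_continuous tchi).
    by move=> z _ /=; rewrite mulrA normrM [leRHS]mulrC ler_wpM2l.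
  rewrite (Fubini1Q Om_open i).
  rewrite (@eq_Rint _ _ _ leb Om _ (fun x => (\int[lebt]_(t in I_T) chi t) * (A x * psi x))); last first.
    move=> x _; rewrite [RHS]mulrC -(RintegralZl _ mI ichi).
    by apply: eq_Rint => t _; rewrite mulrA.
  by rewrite (RintegralZl _ mOm (L2_mul mOm A2 psi2)) Apsi mulr0.
have A0' := @ae_eq_slice1 _ _ _ (measurableTypeR R) R leb lebt Om I_T _ _ A0.
have := slice1_L2Q Om_open b2; have := slice1_L2Q Om_open a2; move: A0'.
apply: filterS3 => x Ax ax bx Ox.
have ia := L2_intR mI Ifin (ax Ox); have ib := L2_intR mI Ifin (bx Ox).
have : \int[lebt]_(t in I_T) (A x) = \int[lebt]_(t in I_T) 0.
  by apply: (Rint_ae mI) => //; exact: Ax.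
rewrite !(Rint_cstI T0) mul0r => /eqP; rewrite mulf_eq0 (gt_eqF T0) orbF.
by rewrite /A (RintegralD mI ia ib) addr_eq0 => /eqP.
Qed.

(** [slice_periodic_ibp] for the trigonometric functions; the cosine of frequency
    zero gives the vanishing mean. *)
Lemma fourier_dt : {ae leb, forall x, Om x ->
  \int[lebt]_(t in I_T) w (x, t) = 0 /\
  forall k, fc w k x = k%:R * om * fs v k x /\ fs w k x = - (k%:R * om * fc v k x)}.
Proof.
have H k : {ae leb, forall x, Om x ->
    (\int[lebt]_(t in I_T) (v (x, t) * 'D_1 (fun t => cos (k%:R * om * t)) t) =
     - (\int[lebt]_(t in I_T) (w (x, t) * cos (k%:R * om * t)))) /\
    (\int[lebt]_(t in I_T) (v (x, t) * 'D_1 (fun t => sin (k%:R * om * t)) t) =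
     - (\int[lebt]_(t in I_T) (w (x, t) * sin (k%:R * om * t))))}.
  have [sc ss] := smooth_trig (k%:R * om).
  have c0 : cos (k%:R * om * 0) = cos (k%:R * om * T) by rewrite mulr0 cos0 (cos_freqT T0).
  have s0 : sin (k%:R * om * 0) = sin (k%:R * om * T) by rewrite mulr0 sin0 (sin_freqT T0).
  have := slice_periodic_ibp ss s0; have := slice_periodic_ibp sc c0.
  by apply: filterS2 => x hc hs Ox; split; [exact: hc|exact: hs].
have v2' := slice1_L2Q Om_open v2.
have := ae_forall_countable H; move: v2'; apply: filterS2 => x vx h Ox.
have {}vx := vx Ox.
have dC k t : 'D_1 (fun t => cos (k%:R * om * t)) t = - (k%:R * om) * sin (k%:R * om * t).
  exact: (@derive_val _ _ _ _ _ _ _ (is_derive_cosM _ _)).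
have dS k t : 'D_1 (fun t => sin (k%:R * om * t)) t = k%:R * om * cos (k%:R * om * t).
  exact: (@derive_val _ _ _ _ _ _ _ (is_derive_sinM _ _)).
have hc k : \int[lebt]_(t in I_T) (w (x, t) * cos (k%:R * om * t)) =
    k%:R * om * \int[lebt]_(t in I_T) (v (x, t) * sin (k%:R * om * t)).
  have [+ _] := h k Ox; move=> /eqP; rewrite -eqr_oppLR => /eqP <-.
  have i := L2_mul mI vx (@L2_sinM _ T (k%:R * om)).
  rewrite -(RintegralZl _ mI i) -(RintN mI); last first.
    have i' := intRZ mI (- (k%:R * om)) i; apply: eq_intR i' => // t _.
    by rewrite dC; ring.
  by apply: eq_Rint => t _; rewrite dC; ring.
have hs k : \int[lebt]_(t in I_T) (w (x, t) * sin (k%:R * om * t)) =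
    - (k%:R * om * \int[lebt]_(t in I_T) (v (x, t) * cos (k%:R * om * t))).
  have [_ +] := h k Ox; move=> /eqP; rewrite -eqr_oppLR => /eqP <-.
  have i := L2_mul mI vx (@L2_cosM _ T (k%:R * om)).
  rewrite -(RintegralZl _ mI i); congr (- _).
  by apply: eq_Rint => t _; rewrite dS; ring.
split.
  have := hc 0%N; rewrite !mul0r => h0; rewrite -[RHS]h0.
  by apply: eq_Rint => t _; rewrite mul0r cos0 mulr1.
by move=> k; rewrite /fourier_cos /fourier_sin hc hs; split; ring.
Qed.

(** On the coefficients, [v] is [w] divided by the frequency [k om], which is at
    least [om]. *)
Lemma half_energy_dt k : (0 < k)%N -> half_energy Om T v k <=
  om^-1 * \int[leb]_(x in Om) (fc w k x ^+ 2 + fs w k x ^+ 2).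
Proof.
have aux (o K S : R) : 0 < o -> 1 <= K -> 0 <= S -> K * o * S <= o^-1 * ((K * o) ^+ 2 * S).
  move=> o0 K1 S0; rewrite (_ : o^-1 * _ = K * (K * o * S)); last by field; rewrite gt_eqF.
  have K0 : 0 <= K := le_trans ler01 K1.
  by rewrite ler_peMl// mulr_ge0// mulr_ge0// ltW.
move=> k0; have om0 := omega_gt0 T0; have k1 : 1 <= k%:R :> R by rewrite ler1n.
have c2 := L2_sq mOm (fourier_cos_L2 Om_open T0 Om_fin k v2).
have s2 := L2_sq mOm (fourier_sin_L2 Om_open T0 Om_fin k v2).
have cw2 := L2_sq mOm (fourier_cos_L2 Om_open T0 Om_fin k w2).
have sw2 := L2_sq mOm (fourier_sin_L2 Om_open T0 Om_fin k w2).
rewrite (@Rint_ae _ _ _ leb Om mOm _ (fun x => (k%:R * om) ^+ 2 * (fc v k x ^+ 2 + fs v k x ^+ 2))).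
- rewrite (RintegralZl _ mOm (intRD mOm c2 s2)) (RintegralD mOm c2 s2) /half_energy.
  apply: aux => //; apply: addr_ge0; apply: Rintegral_ge0 => x _; exact: sqr_ge0.
- exact: intR_meas (intRD mOm cw2 sw2).
- exact: intR_meas (intRZ mOm _ (intRD mOm c2 s2)).
- by apply: filterS fourier_dt => x h Ox; have [_ /(_ k)[-> ->]] := h Ox; ring.
Qed.

(** [half_energy_dt] and Bessel's inequality on almost every slice. *)
Lemma H11_half_lty : (sqnorm_half Om T v < +oo)%E.
Proof.
have om0 := omega_gt0 T0; have T2 : 0 < T / 2 by rewrite divr_gt0.
apply/(sqnorm_half_ltyP Om_open T0 Om_fin v2).
exists (om^-1 * ((T / 2)^-1 * \int[lebQ]_(z in Q) (w z ^+ 2))) => N.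
have i k : integrableR leb Om (fun x => fc w k x ^+ 2 + fs w k x ^+ 2).
  by apply: intRD => //; apply: (L2_sq mOm); [exact: fourier_cos_L2|exact: fourier_sin_L2].
apply: (@le_trans _ _ (\sum_(1 <= k < N) om^-1 * \int[leb]_(x in Om) (fc w k x ^+ 2 + fs w k x ^+ 2))).
  by rewrite !big_nat; apply: ler_sum => k /andP[k0 _]; exact: half_energy_dt.
rewrite -mulr_sumr; apply: ler_wpM2l; first by rewrite invr_ge0 ltW.
rewrite -(Rint_sum mOm _ (fun k _ => i k)) ler_pdivlMl//.
rewrite -(RintegralZl _ mOm (intR_sum mOm _ (fun k _ => i k))).
have iw := Rint_timeQ Om_open (L2_sq mQ w2).
rewrite (Fubini1Q Om_open (L2_sq mQ w2)).
have iS := intRZ mOm (T / 2) (intR_sum mOm (index_iota 1 N) (P := xpredT) (fun k _ => i k)).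
rewrite /Rintegral; apply: fine_le; [exact: integrable_fin_num iS|exact: integrable_fin_num iw|].
apply: ae_ge0_le_integral => //.
- move=> x _; rewrite lee_fin; apply: mulr_ge0; first exact: ltW.
  by apply: sumr_ge0 => k _; rewrite addr_ge0// sqr_ge0.
- by apply/measurable_EFinP; exact: intR_meas iS.
- by move=> x _; rewrite lee_fin; apply: Rintegral_ge0 => t _; exact: sqr_ge0.
- by apply/measurable_EFinP; exact: intR_meas iw.
have := slice1_L2Q Om_open w2; apply: filterS => x /= + Ox => /(_ Ox) wx.
by rewrite lee_fin; have := bessel T0 N wx.
Qed.

(** By [fourier_dt] the [k]-th term pairs the coefficients of the time derivative
    [w] with those of [q]; at almost every [x] Parseval's identity sums them to the
    integral of [w q], because [w] has zero mean.  Dominated convergence, with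
    the bound of [fpart_bound], exchanges this limit with the integral in space. *)
Lemma half_form_dt (sig : 'rV[R]_d -> R) (sig_up : R) q :
  measurable_fun Om sig -> (forall x, Om x -> `|sig x| <= sig_up) -> L2Q Om T q ->
  half_form Om T sig v q = \int[lebQ]_(z in Q) (sig z.1 * w z * q z).
Proof.
move=> msig bsig q2.
have om0 := omega_gt0 T0; have T2 : 0 < T / 2 by rewrite divr_gt0.
pose P N x := sig x * fpart T N (fun t => w (x, t)) (fun t => q (x, t)).
have ik k : integrableR leb Om (fun x => sig x * (fc w k x * fc q k x + fs w k x * fs q k x)).
  have a := L2_mul mOm (L2_bmul mOm msig bsig (fourier_cos_L2 Om_open T0 Om_fin k w2)) (fourier_cos_L2 Om_open T0 Om_fin k q2).
  have b := L2_mul mOm (L2_bmul mOm msig bsig (fourier_sin_L2 Om_open T0 Om_fin k w2)) (fourier_sin_L2 Om_open T0 Om_fin k q2).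
  by apply: eq_intR (intRD mOm a b) => // x _; rewrite mulrDr !mulrA.
have tE k : half_term Om T sig v q k =
    \int[leb]_(x in Om) (sig x * (fc w k x * fc q k x + fs w k x * fs q k x)).
  have iv := half_term_intR Om_open T0 Om_fin msig bsig k v2 q2.
  rewrite /half_term -(RintegralZl _ mOm iv); apply: (Rint_ae mOm).
  - exact: intR_meas (intRZ mOm _ iv).
  - exact: intR_meas (ik k).
  - by apply: filterS fourier_dt => x h Ox; have [_ /(_ k)[-> ->]] := h Ox; ring.
have PE N x : P N x = T / 2 * \sum_(1 <= k < N) (sig x * (fc w k x * fc q k x + fs w k x * fs q k x)).
  by rewrite /P /fpart mulrCA; congr (_ * _); rewrite mulr_sumr.
have iP N : integrableR leb Om (P N).
  have h := intRZ mOm (T / 2) (intR_sum mOm (index_iota 1 N) (P := xpredT) (fun k _ => ik k)).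
  by apply: eq_intR h => // x _; rewrite PE.
have sE : (fun N => T / 2 * series (half_term Om T sig v q) N) =
    (fun N => \int[leb]_(x in Om) P N x).
  apply/funext => N.
  rewrite (@eq_Rint _ _ _ leb Om _ _ (fun x _ => PE N x)).
  rewrite (RintegralZl _ mOm (intR_sum mOm _ (fun k _ => ik k))) (Rint_sum mOm _ (fun k _ => ik k)).
  congr (_ * _); rewrite seriesEnat /=.
  case: N => [|N]; first by rewrite !big_geq.
  rewrite big_ltn//; rewrite {1}/half_term !mul0r add0r.
  by apply: eq_bigr => k _; rewrite tE.
have wq : integrableR lebQ Q (fun z => w z * q z) := L2_mul mQ w2 q2.
have iwq := Rint_timeQ Om_open wq.
have iw := Rint_timeQ Om_open (L2_sq mQ w2); have iq := Rint_timeQ Om_open (L2_sq mQ q2).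
have ig := intRZ mOm sig_up (intRD mOm iw iq).
pose L x := sig x * \int[lebt]_(t in I_T) (w (x, t) * q (x, t)).
have cv : (fun N => \int[leb]_(x in Om) P N x) @ \oo --> \int[leb]_(x in Om) L x.
  apply: (Rint_dominated_cvg mOm _ _ ig).
  - by move=> N; exact: intR_meas (iP N).
  - by apply: measurable_funM => //; exact: intR_meas iwq.
  - have := slice1_L2Q Om_open q2; have := slice1_L2Q Om_open w2; have := fourier_dt.
    apply: filterS3 => x h wx qx Ox; have [m0 _] := h Ox.
    apply: cvgM; first exact: cvg_cst.
    by have := parseval T0 (wx Ox) (qx Ox); rewrite m0 !mul0r subr0.
  - have := slice1_L2Q Om_open q2; have := slice1_L2Q Om_open w2.
    apply: filterS2 => x wx qx Ox N; rewrite /P normrM; apply: ler_pM => //; first exact: bsig.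
exact: (fpart_bound T0 N (wx Ox) (qx Ox)).
have isq : integrableR lebQ Q (fun z => sig z.1 * w z * q z).
  apply: L2_mul => //; apply: (L2_bmul mQ (M := sig_up)) => //; last by move=> [x t] [Ox _]; exact: bsig.
  exact: measurable_fun_fst_on.
rewrite half_formE (Fubini1Q Om_open isq).
transitivity (\int[leb]_(x in Om) L x); last first.
  apply: (Rint_ae mOm).
  - by apply: measurable_funM => //; exact: intR_meas iwq.
  - exact: intR_meas (Rint_timeQ Om_open isq).
  have := slice1_intR mOm mI wq; apply: filterS => x /= + Ox => /(_ Ox) ix.
  by rewrite /L -(RintegralZl _ mI ix); apply: eq_Rint => t _; rewrite mulrA.
move: cv; rewrite -sE => cv.
have : (fun N => (T / 2)^-1 * (T / 2 * series (half_term Om T sig v q) N)) @ \oo -->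
    (T / 2)^-1 * \int[leb]_(x in Om) L x.
  by apply: cvgM => //; exact: cvg_cst.
rewrite (_ : (fun N => _) = series (half_term Om T sig v q)); last first.
  by apply/funext => N; rewrite mulKf// gt_eqF.
by move=> /cvg_lim -> //; rewrite mulVKf// gt_eqF.
Qed.

End time_derivative.

(** * Green's formula for the divergence *)

Section divergence.
Context {R : realType} {d : nat}.
Variables (Om : set 'rV[R]_d) (T : R).
Hypotheses (Om_open : open Om) (T0 : 0 < T).
Hypothesis Om_fin : (lebesgue_rV R d Om < +oo)%E.
Local Notation leb := (lebesgue_rV R d : {measure set _ -> \bar R}).
Local Notation lebt := (@lebesgue_measure R).
Local Notation lebQ := ((leb \x lebt)%E : {measure set _ -> \bar R}).
Local Notation I_T := (`]0, T[%classic : set R).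
Local Notation Q := (QT Om T).
Local Notation point := ('rV[R]_d * measurableTypeR R)%type.

Let mOm : measurable Om. Proof. exact: open_rV_measurable. Qed.
Let mI : @measurable _ (measurableTypeR R) I_T. Proof. exact: measurable_itv. Qed.
Let mQ : measurable (Q : set point). Proof. exact: QT_measurable. Qed.

Lemma slice2_L2Qv (g : 'rV[R]_d * R -> 'rV[R]_d) : L2Qv Om T g ->
  {ae lebt, forall t, I_T t -> L2v leb Om (fun x => g (x, t))}.
Proof.
move=> g2.
have H i : {ae lebt, forall t, I_T t -> L2 leb Om (fun x => g (x, t) ord0 i)}.
  exact: (slice2_L2Q Om_open (L2v_coord mQ i g2)).
by have := ae_forall_countable H; apply: filterS => t h It; apply/(L2vP _ mOm) => i; exact: h.
Qed.

(** Both sides are continuous along the test functions that approximate [u] in the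
    norm of H1. *)
Lemma H10_green u g (s : 'rV[R]_d -> 'rV[R]_d) (f : 'rV[R]_d -> R) :
  L2 leb Om u -> L2v leb Om g -> L2v leb Om s -> L2 leb Om f -> H10_with_grad Om u g ->
  (forall phi, test_function Om phi ->
     \int[leb]_(x in Om) dot (s x) (classical_grad phi x) =
     - \int[leb]_(x in Om) (f x * phi x)) ->
  \int[leb]_(x in Om) dot (s x) (g x) = - \int[leb]_(x in Om) (f x * u x).
Proof.
move=> u2 g2 s2 f2 [phi [tphi cu cg]] Hs.
have cr : (fun k => \int[leb]_(x in Om) (phi k x * f x)) @ \oo --> \int[leb]_(x in Om) (u x * f x).
  by apply: (L2_cvg_int mOm u2 f2 _ cu) => k; exact: (test_meas Om_open Om_fin).
have ci i : (fun k => \int[leb]_(x in Om) (classical_grad (phi k) x ord0 i * s x ord0 i)) @ \oo -->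
    \int[leb]_(x in Om) (g x ord0 i * s x ord0 i).
  have mk k : measurable_fun Om (classical_grad (phi k)).
    by have [] := classical_grad_L2v Om_open Om_fin (tphi k).
  apply: (L2_cvg_int mOm (L2v_coord mOm i g2) (L2v_coord mOm i s2)).
    by move=> k; exact: rV_coord_meas.
  apply: (@squeeze_cvge _ _ _ _ (fun=> 0%E) _ _ _ _ (cvg_cst _) cg).
  apply: nearW => k; rewrite sqnorm_ge0 /=.
  have := @sqnorm_coord_le _ _ _ _ leb Om mOm (fun x => classical_grad (phi k) x - g x) i.
  rewrite (_ : (fun x => _) = (fun x => classical_grad (phi k) x ord0 i - g x ord0 i)); last first.
    by apply/funext => x; rewrite !mxE.
  by apply; apply: (measurable_fun_rVB mOm) => //; case: g2.
have e (h : 'rV[R]_d -> 'rV[R]_d) : L2v leb Om h -> \int[leb]_(x in Om) dot (s x) (h x) =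
    \sum_i \int[leb]_(x in Om) (h x ord0 i * s x ord0 i).
  move=> h2; rewrite -(Rint_sum mOm); last first.
    by move=> i _; apply: (L2_mul mOm); exact: L2v_coord.
  by apply: eq_Rint => x _; apply: eq_bigr => i _; rewrite mulrC.
have cl : (fun k => \int[leb]_(x in Om) dot (s x) (classical_grad (phi k) x)) @ \oo -->
    \int[leb]_(x in Om) dot (s x) (g x).
  rewrite e// (_ : (fun k => _) = (fun k => \sum_i \int[leb]_(x in Om) (classical_grad (phi k) x ord0 i * s x ord0 i))).
    apply: cvg_big => [|i _]; [exact: add_continuous|exact: ci].
  by apply/funext => k; rewrite e//; exact: classical_grad_L2v.
rewrite (@eq_Rint _ _ _ leb Om (fun x => f x * u x) (fun x => u x * f x)); last by move=> x _; rewrite mulrC.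
have cl' : (fun k => \int[leb]_(x in Om) dot (s x) (classical_grad (phi k) x)) @ \oo -->
    - \int[leb]_(x in Om) (u x * f x).
  rewrite (_ : (fun k => _) = (fun k => - \int[leb]_(x in Om) (phi k x * f x))).
    exact: cvgN.
  apply/funext => k; rewrite Hs//; congr (- _).
  by apply: eq_Rint => x _; rewrite mulrC.
by rewrite -(cvg_lim _ cl)// -(cvg_lim _ cl').
Qed.

Lemma div_green tau g q : L2Qv Om T tau -> is_div Om T tau g -> L2Q Om T g -> H1half Om T q ->
  \int[lebQ]_(z in Q) dot (tau z) (grad Om T q z) = - \int[lebQ]_(z in Q) (g z * q z).
Proof.
move=> tau2 [_ Hdiv] g2 [q2 /is_grad_grad[gq2 _] _ q0].
have i1 : integrableR lebQ Q (fun z => dot (tau z) (grad Om T q z)) by exact: (L2v_dot mQ).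
have i2 : integrableR lebQ Q (fun z => g z * q z) by exact: (L2_mul mQ).
rewrite (Fubini2Q Om_open i1) (Fubini2Q Om_open i2).
have j2 := Rint_slice2_intR mOm mI i2.
have j2' := intRN j2.
rewrite -(RintN mI j2); apply: (Rint_ae mI).
- exact: intR_meas (Rint_slice2_intR mOm mI i1).
- exact: (intR_meas j2').
have h1 := slice2_L2Qv tau2; have h2 := slice2_L2Qv gq2; have h3 := slice2_L2Q Om_open q2.
have h4 : {ae lebt, forall t, I_T t -> L2v leb Om (fun x => tau (x, t)) /\
    L2v leb Om (fun x => grad Om T q (x, t)) /\ L2 leb Om (fun x => q (x, t))}.
  by move: h1 h2 h3; apply: (@filterS3 _ _ (ae_filter_ringOfSetsType _)) => t a b c It; split; [exact: a|split; [exact: b|exact: c]].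
move: h4 Hdiv q0; apply: (@filterS3 _ _ (ae_filter_ringOfSetsType _)) => t a b c It.
have [s2 [gr2 qt2]] := a It; have [gt2 Ht] := b It.
exact: (H10_green qt2 gr2 s2 gt2 (c It) Ht).
Qed.

End divergence.

(** * The residual identity and the error bound *)

Section dot_product.
Context {R : realType} {d : nat}.
Implicit Types a b c : 'rV[R]_d.

Lemma dotBl a b c : dot (a - b) c = dot a c - dot b c.
Proof. by rewrite !dotE -sumrB; apply: eq_bigr => i _; rewrite !mxE mulrBl. Qed.

Lemma dotDl a b c : dot (a + b) c = dot a c + dot b c.
Proof. by rewrite !dotE -big_split; apply: eq_bigr => i _; rewrite !mxE mulrDl. Qed.

Lemma dotZl (k : R) a b : dot (k *: a) b = k * dot a b.
Proof. by rewrite !dotE mulr_sumr; apply: eq_bigr => i _; rewrite !mxE mulrA. Qed.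

Lemma Rint_amgm_dot (dp : measure_display) (X : measurableType dp)
    (mu : {measure set X -> \bar R}) (D : set X) (mD : measurable D)
    (g h : X -> 'rV[R]_d) (s : R) : 0 < s -> L2v mu D g -> L2v mu D h ->
  2 * `|\int[mu]_(x in D) dot (g x) (h x)| <=
  s * \int[mu]_(x in D) dot (g x) (g x) + s^-1 * \int[mu]_(x in D) dot (h x) (h x).
Proof.
move=> s0 g2 h2.
have gi i := L2v_coord mD i g2; have hi i := L2v_coord mD i h2.
have e (u u' : X -> 'rV[R]_d) : L2v mu D u -> L2v mu D u' ->
    \int[mu]_(x in D) dot (u x) (u' x) =
    \sum_i \int[mu]_(x in D) (u x ord0 i * u' x ord0 i).
  move=> u2 u'2; rewrite -(Rint_sum mD)// => i _.
  by apply: L2_mul => //; exact: L2v_coord.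
rewrite !e// !mulr_sumr -big_split /=.
apply: (@le_trans _ _ (2 * \sum_i `|\int[mu]_(x in D) (g x ord0 i * h x ord0 i)|)).
  by rewrite ler_pM2l// ler_norm_sum.
rewrite mulr_sumr; apply: ler_sum => i _.
rewrite (@eq_Rint _ _ _ mu D (fun x => g x ord0 i * g x ord0 i) (fun x => g x ord0 i ^+ 2))//.
rewrite (@eq_Rint _ _ _ mu D (fun x => h x ord0 i * h x ord0 i) (fun x => h x ord0 i ^+ 2))//.
exact: Rint_amgm.
Qed.

End dot_product.

Section a_posteriori.
Context {R : realType} {d : nat}.
Variables (Om : set 'rV[R]_d) (T : R).
Hypotheses (Om_open : open Om) (T0 : 0 < T).
Hypothesis Om_fin : (lebesgue_rV R d Om < +oo)%E.
Local Notation leb := (lebesgue_rV R d : {measure set _ -> \bar R}).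
Local Notation lebt := (@lebesgue_measure R).
Local Notation lebQ := ((leb \x lebt)%E : {measure set _ -> \bar R}).
Local Notation I_T := (`]0, T[%classic : set R).
Local Notation Q := (QT Om T).
Local Notation point := ('rV[R]_d * measurableTypeR R)%type.

Let mOm : measurable Om. Proof. exact: open_rV_measurable. Qed.
Let mI : @measurable _ (measurableTypeR R) I_T. Proof. exact: measurable_itv. Qed.
Let mQ : measurable (Q : set point). Proof. exact: QT_measurable. Qed.

Lemma H11_dt v : H11 Om T v -> is_dt Om T v (dt Om T v).
Proof. by move=> [_ _ wv _ _]; exact: is_dt_dt. Qed.

Lemma H11_H1half v : H11 Om T v -> H1half Om T v.
Proof.
move=> Hv; have dv := H11_dt Hv; have [v2 gv _ zv pv] := Hv.
by split => //; exact: (H11_half_lty Om_open T0 Om_fin v2 dv pv).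
Qed.

Lemma H1half_grad v : H1half Om T v -> L2Qv Om T (grad Om T v).
Proof. by move=> [_ /is_grad_grad[] ]. Qed.

Lemma grad_sub v w : H1half Om T v -> H1half Om T w ->
  ae_eq lebQ Q (grad Om T (v \- w)) (fun z => grad Om T v z - grad Om T w z).
Proof.
move=> Hv Hw; have [v2 /is_grad_grad gv _ _] := Hv; have [w2 /is_grad_grad gw _ _] := Hw.
have [_ /is_grad_grad gvw _ _] := H1half_sub Om_open T0 Om_fin Hv Hw.
exact: (is_grad_unique Om_open Om_fin gvw (is_grad_sub Om_open Om_fin v2 w2 gv gw)).
Qed.

Variables (sig nu : 'rV[R]_d -> R) (sig_up nu_up lam : R).
Hypotheses (sig_meas : measurable_fun Om sig) (nu_meas : measurable_fun Om nu).
Hypothesis sig_bd : forall x, Om x -> `|sig x| <= sig_up.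
Hypothesis nu_bd : forall x, Om x -> `|nu x| <= nu_up.

Lemma L2Q_bmul (f : 'rV[R]_d -> R) (M : R) v : measurable_fun Om f ->
  (forall x, Om x -> `|f x| <= M) -> L2Q Om T v -> L2Q Om T (fun z => f z.1 * v z).
Proof.
move=> mf bf v2; apply: (L2_bmul mQ (M := M)) => //; first exact: measurable_fun_fst_on.
by move=> [x t] [Ox _]; exact: bf.
Qed.

Lemma nu_dot_intR g h : L2Qv Om T g -> L2Qv Om T h ->
  integrableR lebQ Q (fun z => nu z.1 * dot (g z) (h z)).
Proof.
move=> g2 h2.
have G2 : L2v lebQ Q (fun z : point => nu z.1 *: g z).
  apply/(L2vP _ mQ) => i; have := L2Q_bmul nu_meas nu_bd (L2v_coord mQ i g2).
  by apply: (eq_L2 mQ) => z _; rewrite !mxE.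
by apply: eq_intR (L2v_dot mQ G2 h2) => // z _; rewrite dotZl.
Qed.

Definition Bform_density (y p z q : 'rV[R]_d * R -> R) (gy gp gz gq : 'rV[R]_d * R -> 'rV[R]_d)
    (s : 'rV[R]_d * R) : R :=
  y s * z s - nu s.1 * dot (gp s) (gz s) + nu s.1 * dot (gy s) (gq s) + lam^-1 * (p s * q s).

Section density.
Variables (y p z q : 'rV[R]_d * R -> R) (gy gp gz gq : 'rV[R]_d * R -> 'rV[R]_d).
Hypotheses (y2 : L2Q Om T y) (p2 : L2Q Om T p) (z2 : L2Q Om T z) (q2 : L2Q Om T q).
Hypotheses (gy2 : L2Qv Om T gy) (gp2 : L2Qv Om T gp) (gz2 : L2Qv Om T gz) (gq2 : L2Qv Om T gq).

Let i1 : integrableR lebQ Q (fun s => y s * z s). Proof. exact: (L2_mul mQ y2 z2). Qed.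
Let i2 : integrableR lebQ Q (fun s => nu s.1 * dot (gp s) (gz s)). Proof. exact: nu_dot_intR. Qed.
Let i3 : integrableR lebQ Q (fun s => nu s.1 * dot (gy s) (gq s)). Proof. exact: nu_dot_intR. Qed.
Let i4 : integrableR lebQ Q (fun s => lam^-1 * (p s * q s)).
Proof. exact: (intRZ mQ _ (L2_mul mQ p2 q2)). Qed.

Lemma Bform_density_intR : integrableR lebQ Q (Bform_density y p z q gy gp gz gq).
Proof. exact: (intRD mQ (intRD mQ (intRB mQ i1 i2) i3) i4). Qed.

Lemma Rint_Bform_density : \int[lebQ]_(s in Q) Bform_density y p z q gy gp gz gq s =
  \int[lebQ]_(s in Q) (y s * z s) - \int[lebQ]_(s in Q) (nu s.1 * dot (gp s) (gz s))
  + \int[lebQ]_(s in Q) (nu s.1 * dot (gy s) (gq s))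
  + lam^-1 * \int[lebQ]_(s in Q) (p s * q s).
Proof.
have i12 := intRB mQ i1 i2; have i123 := intRD mQ i12 i3.
have := RintegralD mQ i123 i4; rewrite (RintegralD mQ i12 i3) (RintegralB mQ i1 i2).
by rewrite (RintegralZl _ mQ (L2_mul mQ p2 q2)).
Qed.

End density.

(** The gradient of a difference is only almost everywhere the difference of the
    gradients, since it is a chosen representative. *)
Lemma Bform_subl y p eta zeta z q : H1half Om T y -> H1half Om T p ->
  H1half Om T eta -> H1half Om T zeta -> H1half Om T z -> H1half Om T q ->
  Bform Om T sig nu lam (y \- eta) (p \- zeta) z q =
  Bform Om T sig nu lam y p z q - Bform Om T sig nu lam eta zeta z q.
Proof.
have aux (a b c e f g : R) : a - b + (c - e) + (f - g) = a + c + f - (b + e + g) by ring.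
move=> Hy Hp He Hz Hz' Hq.
have [y2 _ hy _] := Hy; have [p2 _ hp _] := Hp; have [e2 _ he _] := He.
have [ze2 _ hze _] := Hz; have [z2 _ hz _] := Hz'; have [q2 _ hq _] := Hq.
have gy2 := H1half_grad Hy; have gp2 := H1half_grad Hp; have ge2 := H1half_grad He.
have gze2 := H1half_grad Hz; have gz2 := H1half_grad Hz'; have gq2 := H1half_grad Hq.
have Hye := H1half_sub Om_open T0 Om_fin Hy He; have Hpz := H1half_sub Om_open T0 Om_fin Hp Hz.
have [ye2 _ _ _] := Hye; have [pz2 _ _ _] := Hpz.
have gye2 := H1half_grad Hye; have gpz2 := H1half_grad Hpz.
rewrite /Bform (half_form_subl Om_open T0 Om_fin sig_meas sig_bd p2 ze2 z2 hp hze hz).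
rewrite (half_form_subl Om_open T0 Om_fin sig_meas sig_bd y2 e2 q2 hy he hq).
have d1 := Bform_density_intR y2 p2 z2 q2 gy2 gp2 gz2 gq2.
have d2 := Bform_density_intR e2 ze2 z2 q2 ge2 gze2 gz2 gq2.
have d3 := Bform_density_intR ye2 pz2 z2 q2 gye2 gpz2 gz2 gq2.
have -> : intQ Om T (Bform_density (y \- eta) (p \- zeta) z q (grad Om T (y \- eta))
    (grad Om T (p \- zeta)) (grad Om T z) (grad Om T q)) =
  intQ Om T (Bform_density y p z q (grad Om T y) (grad Om T p) (grad Om T z) (grad Om T q)) -
  intQ Om T (Bform_density eta zeta z q (grad Om T eta) (grad Om T zeta) (grad Om T z) (grad Om T q)).
  rewrite /intQ -(RintegralB mQ d1 d2); apply: (Rint_ae mQ).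
  - exact: intR_meas d3.
  - exact: intR_meas (intRB mQ d1 d2).
  - move: (grad_sub Hy He) (grad_sub Hp Hz).
    apply: (@filterS2 _ _ (ae_filter_ringOfSetsType _)) => s /= a b Qs.
    by rewrite /Bform_density (a Qs) (b Qs) !dotBl /=; ring.
exact: aux.
Qed.

Lemma Bform_H11 eta zeta z q : H11 Om T eta -> H11 Om T zeta -> H1half Om T z -> H1half Om T q ->
  Bform Om T sig nu lam eta zeta z q =
  \int[lebQ]_(s in Q) (eta s * z s)
  - \int[lebQ]_(s in Q) (nu s.1 * dot (grad Om T zeta s) (grad Om T z s))
  + \int[lebQ]_(s in Q) (nu s.1 * dot (grad Om T eta s) (grad Om T q s))
  + lam^-1 * \int[lebQ]_(s in Q) (zeta s * q s)
  + \int[lebQ]_(s in Q) (sig s.1 * dt Om T zeta s * z s)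
  + \int[lebQ]_(s in Q) (sig s.1 * dt Om T eta s * q s).
Proof.
move=> He Hz Hz' Hq; have [e2 _ _ _ pe] := He; have [ze2 _ _ _ pz] := Hz.
have [z2 _ _ _] := Hz'; have [q2 _ _ _] := Hq.
have ge2 := H1half_grad (H11_H1half He); have gze2 := H1half_grad (H11_H1half Hz).
have gz2 := H1half_grad Hz'; have gq2 := H1half_grad Hq.
rewrite /Bform (half_form_dt Om_open T0 Om_fin ze2 (H11_dt Hz) pz sig_meas sig_bd z2).
rewrite (half_form_dt Om_open T0 Om_fin e2 (H11_dt He) pe sig_meas sig_bd q2).
by rewrite -(Rint_Bform_density e2 ze2 z2 q2 ge2 gze2 gz2 gq2).
Qed.

Section residuals.
Variables (yd eta zeta : 'rV[R]_d * R -> R) (tau rho : 'rV[R]_d * R -> 'rV[R]_d).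
Hypotheses (yd2 : L2Q Om T yd) (He : H11 Om T eta) (Hz : H11 Om T zeta).
Hypotheses (Ht : Hdiv Om T tau) (Hr : Hdiv Om T rho).
Local Notation R1 := (Res1 Om T sig lam eta zeta tau).
Local Notation R2 := (Res2 Om T nu eta tau).
Local Notation R3 := (Res3 Om T sig yd eta zeta rho).
Local Notation R4 := (Res4 Om T nu zeta rho).

Let e2 : L2Q Om T eta. Proof. by case: He. Qed.
Let z2 : L2Q Om T zeta. Proof. by case: Hz. Qed.
Let de2 : L2Q Om T (dt Om T eta). Proof. by case: (H11_dt He). Qed.
Let dz2 : L2Q Om T (dt Om T zeta). Proof. by case: (H11_dt Hz). Qed.
Let ge2 : L2Qv Om T (grad Om T eta). Proof. exact: H1half_grad (H11_H1half He). Qed.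
Let gz2 : L2Qv Om T (grad Om T zeta). Proof. exact: H1half_grad (H11_H1half Hz). Qed.
Let t2 : L2Qv Om T tau. Proof. by case: Ht. Qed.
Let r2 : L2Qv Om T rho. Proof. by case: Hr. Qed.
Let dvt : is_div Om T tau (div Om T tau). Proof. by case: Ht => _ /is_div_div. Qed.
Let dvr : is_div Om T rho (div Om T rho). Proof. by case: Hr => _ /is_div_div. Qed.
Let sde2 : L2Q Om T (fun s => sig s.1 * dt Om T eta s). Proof. exact: (L2Q_bmul sig_meas sig_bd de2). Qed.
Let sdz2 : L2Q Om T (fun s => sig s.1 * dt Om T zeta s). Proof. exact: (L2Q_bmul sig_meas sig_bd dz2). Qed.
Let lz2 : L2Q Om T (fun s => lam^-1 * zeta s). Proof. exact: (L2Z mQ). Qed.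

Let nu_grad_L2 v : L2Qv Om T (grad Om T v) -> L2Qv Om T (fun s => nu s.1 *: grad Om T v s).
Proof.
move=> g2; apply/(L2vP _ mQ) => i; have := L2Q_bmul nu_meas nu_bd (L2v_coord mQ i g2).
by apply: (eq_L2 mQ) => s _; rewrite !mxE.
Qed.

Lemma Res2_L2 : L2Qv Om T R2.
Proof. exact: (L2v_sub mQ t2 (nu_grad_L2 ge2)). Qed.

Lemma Res4_L2 : L2Qv Om T R4.
Proof.
apply/(L2vP _ mQ) => i.
have := L2D mQ (L2v_coord mQ i r2) (L2v_coord mQ i (nu_grad_L2 gz2)).
by apply: (eq_L2 mQ) => s _; rewrite !mxE.
Qed.

Lemma Res1_L2 : (sqnormQ Om T R1 < +oo)%E -> L2Q Om T R1.
Proof.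
move=> h; split => //; have [mdiv _] := dvt.
by apply: measurable_funB => //; apply: measurable_funD; [exact: L2_meas sde2|exact: L2_meas lz2].
Qed.

Lemma Res3_L2 : (sqnormQ Om T R3 < +oo)%E -> L2Q Om T R3.
Proof.
move=> h; split => //; have [mdiv _] := dvr.
apply: measurable_funB; last exact: L2_meas yd2.
by apply: measurable_funB => //; apply: measurable_funD; [exact: L2_meas sdz2|exact: L2_meas e2].
Qed.

Hypotheses (R12 : L2Q Om T R1) (R32 : L2Q Om T R3).

Let dt2 : L2Q Om T (div Om T tau).
Proof.
have := L2B mQ (L2D mQ sde2 lz2) R12.
by apply: (eq_L2 mQ) => s _; rewrite /Res1; ring.
Qed.

Let dr2 : L2Q Om T (div Om T rho).
Proof.
have := L2B mQ (L2B mQ (L2D mQ sdz2 e2) yd2) R32.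
by apply: (eq_L2 mQ) => s _; rewrite /Res3; ring.
Qed.

(** The solution property replaces the exact solution by [yd].  On the approximation
    the half-order terms become integrals of time derivatives by [half_form_dt], and
    the fluxes enter through Green's formula, whose two sides cancel. *)
Lemma Bform_residuals y p z q : H1half Om T y -> H1half Om T p -> H1half Om T z -> H1half Om T q ->
  Bform Om T sig nu lam y p z q = intQ Om T (fun s => yd s * z s) ->
  Bform Om T sig nu lam (y \- eta) (p \- zeta) z q =
  - (\int[lebQ]_(s in Q) (R3 s * z s)) + \int[lebQ]_(s in Q) dot (R4 s) (grad Om T z s)
  - \int[lebQ]_(s in Q) (R1 s * q s) + \int[lebQ]_(s in Q) dot (R2 s) (grad Om T q s).
Proof.
have aux (a b c e f g h k l : R) : a - (b - c + e + f + g + h) =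
    - (g + b - k - a) + (- k + c) - (h + f - l) + (- l - e) by ring.
move=> Hy Hp Hz' Hq sol.
have [z'2 _ _ _] := Hz'; have [q2 _ _ _] := Hq.
have gz'2 := H1half_grad Hz'; have gq2 := H1half_grad Hq.
rewrite (Bform_subl Hy Hp (H11_H1half He) (H11_H1half Hz) Hz' Hq) sol Bform_H11// /intQ.
have E3 : \int[lebQ]_(s in Q) (R3 s * z s) = \int[lebQ]_(s in Q) (sig s.1 * dt Om T zeta s * z s)
    + \int[lebQ]_(s in Q) (eta s * z s) - \int[lebQ]_(s in Q) (div Om T rho s * z s)
    - \int[lebQ]_(s in Q) (yd s * z s).
  have a1 := L2_mul mQ sdz2 z'2; have a2 := L2_mul mQ e2 z'2.
  have a3 := L2_mul mQ dr2 z'2; have a4 := L2_mul mQ yd2 z'2.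
  have a12 := intRD mQ a1 a2; have a123 := intRB mQ a12 a3.
  rewrite -(RintegralD mQ a1 a2) -(RintegralB mQ a12 a3) -(RintegralB mQ a123 a4).
  by apply: eq_Rint => s _; rewrite /Res3; ring.
have E1 : \int[lebQ]_(s in Q) (R1 s * q s) = \int[lebQ]_(s in Q) (sig s.1 * dt Om T eta s * q s)
    + lam^-1 * \int[lebQ]_(s in Q) (zeta s * q s) - \int[lebQ]_(s in Q) (div Om T tau s * q s).
  have a1 := L2_mul mQ sde2 q2; have a2 := L2_mul mQ z2 q2.
  have a3 := L2_mul mQ dt2 q2; have a2' := intRZ mQ lam^-1 a2.
  have a12 := intRD mQ a1 a2'.
  rewrite -(RintegralZl _ mQ a2) -(RintegralD mQ a1 a2') -(RintegralB mQ a12 a3).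
  by apply: eq_Rint => s _; rewrite /Res1; ring.
have E4 : \int[lebQ]_(s in Q) dot (R4 s) (grad Om T z s) =
    \int[lebQ]_(s in Q) dot (rho s) (grad Om T z s)
    + \int[lebQ]_(s in Q) (nu s.1 * dot (grad Om T zeta s) (grad Om T z s)).
  rewrite -(RintegralD mQ (L2v_dot mQ r2 gz'2) (nu_dot_intR gz2 gz'2)).
  by apply: eq_Rint => s _; rewrite dotDl dotZl.
have E2 : \int[lebQ]_(s in Q) dot (R2 s) (grad Om T q s) =
    \int[lebQ]_(s in Q) dot (tau s) (grad Om T q s)
    - \int[lebQ]_(s in Q) (nu s.1 * dot (grad Om T eta s) (grad Om T q s)).
  rewrite -(RintegralB mQ (L2v_dot mQ t2 gq2) (nu_dot_intR ge2 gq2)).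
  by apply: eq_Rint => s _; rewrite dotBl dotZl.
rewrite E1 E2 E3 E4 (div_green Om_open Om_fin t2 dvt dt2 Hq) (div_green Om_open Om_fin r2 dvr dr2 Hz').
exact: aux.
Qed.

(** Four weighted arithmetic-geometric inequalities with the same weight, added and
    then optimised by [amgm_sqrt]. *)
Lemma Bform_residual_bound y p z q : H1half Om T y -> H1half Om T p ->
  H1half Om T z -> H1half Om T q ->
  Bform Om T sig nu lam y p z q = intQ Om T (fun s => yd s * z s) ->
  Bform Om T sig nu lam (y \- eta) (p \- zeta) z q <=
  Num.sqrt (\int[lebQ]_(s in Q) (R1 s ^+ 2) + \int[lebQ]_(s in Q) dot (R2 s) (R2 s) +
    \int[lebQ]_(s in Q) (R3 s ^+ 2) + \int[lebQ]_(s in Q) dot (R4 s) (R4 s)) *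
  Num.sqrt (\int[lebQ]_(s in Q) (z s ^+ 2) + \int[lebQ]_(s in Q) dot (grad Om T z s) (grad Om T z s) +
    (\int[lebQ]_(s in Q) (q s ^+ 2) + \int[lebQ]_(s in Q) dot (grad Om T q s) (grad Om T q s))).
Proof.
move=> Hy Hp Hz' Hq sol.
have [z'2 _ _ _] := Hz'; have [q2 _ _ _] := Hq.
have gz'2 := H1half_grad Hz'; have gq2 := H1half_grad Hq.
have sq0 (f : 'rV[R]_d * R -> R) : 0 <= \int[lebQ]_(s in Q) (f s ^+ 2).
  by apply: Rintegral_ge0 => s _; exact: sqr_ge0.
have dd0 (f : 'rV[R]_d * R -> 'rV[R]_d) : 0 <= \int[lebQ]_(s in Q) dot (f s) (f s).
  by apply: Rintegral_ge0 => s _; exact: dot_ge0.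
rewrite (Bform_residuals Hy Hp Hz' Hq sol).
have aux (s a1 a2 a3 a4 x1 x2 x3 x4 y1 y2 y3 y4 : R) :
    2 * `|a1| <= s * x1 + s^-1 * y1 -> 2 * `|a2| <= s * x2 + s^-1 * y2 ->
    2 * `|a3| <= s * x3 + s^-1 * y3 -> 2 * `|a4| <= s * x4 + s^-1 * y4 ->
    2 * (- a1 + a2 - a3 + a4) <= s * (x3 + x4 + x1 + x2) + s^-1 * (y1 + y2 + (y3 + y4)).
  move=> h1 h2 h3 h4.
  have n1 : - a1 <= `|a1| by rewrite -normrN ler_norm.
  have n3 : - a3 <= `|a3| by rewrite -normrN ler_norm.
  have := ler_norm a2; have := ler_norm a4; lra.
apply: amgm_sqrt.
- by rewrite !addr_ge0.
- by rewrite !addr_ge0.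
- move=> s s0; have h3 := Rint_amgm mQ s0 R32 z'2; have h1 := Rint_amgm mQ s0 R12 q2.
  have h4 := Rint_amgm_dot mQ s0 Res4_L2 gz'2; have h2 := Rint_amgm_dot mQ s0 Res2_L2 gq2.
  exact: (aux _ _ _ _ _ _ _ _ _ _ _ _ _ h3 h4 h1 h2).
Qed.

End residuals.

Lemma norm_1half_fin z q : H1half Om T z -> H1half Om T q ->
  exists2 r, norm_1half Om T z q = r%:E &
  Num.sqrt (\int[lebQ]_(s in Q) (z s ^+ 2) + \int[lebQ]_(s in Q) dot (grad Om T z s) (grad Om T z s) +
    (\int[lebQ]_(s in Q) (q s ^+ 2) + \int[lebQ]_(s in Q) dot (grad Om T q s) (grad Om T q s))) <= r.
Proof.
move=> Hz Hq; have [z2 _ hz _] := Hz; have [q2 _ hq _] := Hq.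
have gz2 := H1half_grad Hz; have gq2 := H1half_grad Hq.
have hz0 := sqnorm_half_ge0 Om T0 z; have hq0 := sqnorm_half_ge0 Om T0 q.
have [a az] : exists a, sqnorm_half Om T z = a%:E.
  exists (fine (sqnorm_half Om T z)); rewrite fineK; first by [].
  by rewrite ge0_fin_numE; [exact: hz|exact: hz0].
have [b bq] : exists b, sqnorm_half Om T q = b%:E.
  exists (fine (sqnorm_half Om T q)); rewrite fineK; first by [].
  by rewrite ge0_fin_numE; [exact: hq|exact: hq0].
rewrite /norm_1half /sqnormQ /sqnormQv (sqnormE mQ z2) (sqnormE mQ q2) (sqnormvE mQ gz2) (sqnormvE mQ gq2) az bq.
rewrite -!EFinD poweR_EFin; eexists; first by [].
move: hz0 hq0; rewrite az bq !lee_fin => a0 b0.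
have sq0 (f : 'rV[R]_d * R -> R) : 0 <= \int[lebQ]_(s in Q) (f s ^+ 2).
  by apply: Rintegral_ge0 => s _; exact: sqr_ge0.
have dd0 (f : 'rV[R]_d * R -> 'rV[R]_d) : 0 <= \int[lebQ]_(s in Q) dot (f s) (f s).
  by apply: Rintegral_ge0 => s _; exact: dot_ge0.
rewrite powR12_sqrt; last by rewrite !addr_ge0.
rewrite ler_sqrt; last by rewrite !addr_ge0.
by apply: lerD; rewrite lerDl.
Qed.

End a_posteriori.

Lemma mu1_gt0 (R : realType) (lam nu_lo sig_lo : R) :
  0 < lam -> 0 < nu_lo -> 0 < sig_lo -> 0 < mu1 lam nu_lo sig_lo.
Proof.
move=> l0 n0 s0; have q0 : 0 < Num.sqrt lam by rewrite sqrtr_gt0.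
have q1 : 0 < 1 / Num.sqrt lam by rewrite divr_gt0.
rewrite /mu1 divr_gt0 ?sqrtr_gt0 ?mulr_gt0 ?lt_min ?q0 ?q1 ?n0 ?s0//.
by rewrite ltr_wpDr// mulr_ge0// le_max ltW.
Qed.

Theorem theorem2 (R : realType) (d : nat) (d_range : (1 <= d <= 3)%N)
    (Om : set 'rV[R]_d) (Om_domain : bounded_lipschitz_domain Om)
    (T : R) (T_gt0 : 0 < T)
    (sig nu : 'rV[R]_d -> R) (sig_lo sig_up nu_lo nu_up : R)
    (sig_meas : measurable_fun Om sig) (nu_meas : measurable_fun Om nu)
    (sig_lo_gt0 : 0 < sig_lo) (nu_lo_gt0 : 0 < nu_lo)
    (sig_bounds : forall x, Om x -> sig_lo <= sig x <= sig_up)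
    (nu_bounds : forall x, Om x -> nu_lo <= nu x <= nu_up)
    (lam : R) (lam_gt0 : 0 < lam)
    (yd : 'rV[R]_d * R -> R) (yd_L2 : L2Q Om T yd)
    (y p : 'rV[R]_d * R -> R) (y_H : H1half Om T y) (p_H : H1half Om T p)
    (yp_solution : forall z q : 'rV[R]_d * R -> R,
      H1half Om T z -> H1half Om T q ->
      Bform Om T sig nu lam y p z q = intQ Om T (fun s => yd s * z s))
    (eta zeta : 'rV[R]_d * R -> R) (eta_H : H11 Om T eta) (zeta_H : H11 Om T zeta)
    (tau rho : 'rV[R]_d * R -> 'rV[R]_d) (tau_H : Hdiv Om T tau) (rho_H : Hdiv Om T rho)
    (inf_sup : forall w r : 'rV[R]_d * R -> R, H1half Om T w -> H1half Om T r ->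
      ((mu1 lam nu_lo sig_lo)%:E * norm_1half Om T w r
         <= sup_quotient Om T sig nu lam w r
         <= (mu2 lam nu_up sig_up)%:E * norm_1half Om T w r)%E) :
  (norm_1half Om T (y \- eta)%R (p \- zeta)%R <=
   (1 / mu1 lam nu_lo sig_lo)%:E *
   (sqnormQ Om T (Res1 Om T sig lam eta zeta tau) +
    sqnormQv Om T (Res2 Om T nu eta tau) +
    sqnormQ Om T (Res3 Om T sig yd eta zeta rho) +
    sqnormQv Om T (Res4 Om T nu zeta rho)) `^ 2^-1)%E.
Proof.
have [Om_open _ _ Om_bd _] := Om_domain.
have mOm := open_rV_measurable Om_open.
have Om_fin := bounded_lebesgue_lty mOm Om_bd.
have mQ := @QT_measurable _ _ Om T Om_open.
have sig_bd x : Om x -> `|sig x| <= sig_up.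
  by move=> Ox; have /andP[l u] := sig_bounds x Ox; rewrite gtr0_norm// (lt_le_trans sig_lo_gt0).
have nu_bd x : Om x -> `|nu x| <= nu_up.
  by move=> Ox; have /andP[l u] := nu_bounds x Ox; rewrite gtr0_norm// (lt_le_trans nu_lo_gt0).
have m0 := mu1_gt0 lam_gt0 nu_lo_gt0 sig_lo_gt0.
have R22 := Res2_L2 Om_open T_gt0 Om_fin nu_meas nu_bd eta_H tau_H.
have R42 := Res4_L2 Om_open T_gt0 Om_fin nu_meas nu_bd zeta_H rho_H.
have n1 : (0 <= sqnormQ Om T (Res1 Om T sig lam eta zeta tau))%E by exact: sqnorm_ge0.
have n2 : (0 <= sqnormQv Om T (Res2 Om T nu eta tau))%E by exact: sqnormv_ge0.
have n3 : (0 <= sqnormQ Om T (Res3 Om T sig yd eta zeta rho))%E by exact: sqnorm_ge0.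
have n4 : (0 <= sqnormQv Om T (Res4 Om T nu zeta rho))%E by exact: sqnormv_ge0.
have n12 := adde_ge0 n1 n2; have n123 := adde_ge0 n12 n3; have n1234 := adde_ge0 n123 n4.
rewrite (poweR12_sqrt n1234) div1r.
(* The residuals need not be square integrable, as the divergences may fail to be
   so; the bound is then infinite. *)
have [|fin] := leP +oo%E (sqnormQ Om T (Res1 Om T sig lam eta zeta tau) +
    sqnormQv Om T (Res2 Om T nu eta tau) + sqnormQ Om T (Res3 Om T sig yd eta zeta rho) +
    sqnormQv Om T (Res4 Om T nu zeta rho))%E.
  by rewrite leye_eq => /eqP -> /=; rewrite gt0_muley ?leey// lte_fin invr_gt0.
have fin123 := le_lt_trans (leeDl _ n4) fin.
have fin3 := le_lt_trans (leeDr _ n12) fin123.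
have fin1 := le_lt_trans (leeDl _ n2) (le_lt_trans (leeDl _ n3) fin123).
have R12 := Res1_L2 Om_open sig_meas sig_bd eta_H zeta_H tau_H fin1.
have R32 := Res3_L2 Om_open sig_meas sig_bd yd_L2 eta_H zeta_H rho_H fin3.
rewrite /sqnormQ /sqnormQv (sqnormE mQ R12) (sqnormE mQ R32) (sqnormvE mQ R22) (sqnormvE mQ R42).
rewrite -!EFinD /=.
have eH := H1half_sub Om_open T_gt0 Om_fin y_H (H11_H1half Om_open T_gt0 Om_fin eta_H).
have zH := H1half_sub Om_open T_gt0 Om_fin p_H (H11_H1half Om_open T_gt0 Om_fin zeta_H).
rewrite lee_pdivlMl//.
have /andP[+ _] := inf_sup _ _ eH zH; move=> /le_trans; apply.
apply: ge_ereal_sup => _ [z [q [zz qq _ ->]]]; rewrite lee_fin.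
have [r -> hr] := norm_1half_fin Om_open T_gt0 zz qq.
have := Bform_residual_bound Om_open T_gt0 Om_fin sig_meas nu_meas sig_bd nu_bd yd_L2 eta_H zeta_H
  tau_H rho_H R12 R32 y_H p_H zz qq (yp_solution z q zz qq).
move=> /le_trans => /(_ _ (ler_wpM2l (sqrtr_ge0 _) hr)) h.
(* The quotient by a vanishing norm is zero by convention. *)
rewrite /=; have [r0|r0] := eqVneq r 0; first by rewrite r0 invr0 mulr0 sqrtr_ge0.
have r1 : 0 < r by rewrite lt_neqAle eq_sym r0 (le_trans (sqrtr_ge0 _) hr).
by rewrite ler_pdivrMr.
Qed.
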